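(* Let $k$ be a commutative ring and let $B$ be a $k$-bialgebra with counit $\varepsilon$. Then the Hopf algebra homology groups $H_\bullet(B,k)=H(C_\bullet(B),d)$, with the coproduct and cobracket induced by the cup coproduct and the canonical cobracket of the cooperad with comultiplication $C_\bullet(B)$ described in the context, form a Gerstenhaber coalgebra. Hence, if $B$ is $k$-projective, the groups $\mathrm{Tor}^B_\bullet(k,k)$ constitute a Gerstenhaber coalgebra and as such, in particular, carry the structure of a graded cocommutative $k$-coalgebra.
   Context: The general convention in force is that $k$ is a commutative ring or a field, of characteristic zero if need be. Tensor products are over $k$. $C_p(B)=B^{\otimes p}$, elementary tensors are written $(x_1,\dots,x_p)$, and $x^{(1)}\otimes x^{(2)}$ is Sweedler notation for the coproduct of $B$. The differential is $$d(b_1,\dots,b_n)=(\varepsilon(b_1)b_2,b_3,\dots,b_n)+\sum_{i=1}^{n-1}(-1)^i(b_1,\dots,b_ib_{i+1},\dots,b_n)+(-1)^n(b_1,\dots,b_{n-1}\varepsilon(b_n)).$$ When $B$ is $k$-projective, $H_\bullet(B,k)\cong\mathrm{Tor}^B_\bullet(k,k)$, where $k$ is a $B$-module via $\varepsilon$. $C_\bullet(B)$ is a cooperad with partial decompositions, for $p\ge1,q\ge0,1\le i\le p$, $$\Delta_{p,q,i}(x_1,\dots,x_{p+q-1})=(x_1,\dots,x_{i-1},x_i^{(1)}\cdots x_{i+q-1}^{(1)},x_{i+q},\dots,x_{p+q-1})\otimes(x_i^{(2)},\dots,x_{i+q-1}^{(2)})$$ (for $q=0$: insert $1_B$ in position $i$,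 tensored with $1_k$), counit $\varepsilon\colon C_1(B)\to k$, and comultiplication given by $\mu^c(x_1,x_2)=\varepsilon(x_1x_2)$ on $C_2(B)$ and $e^c=\mathrm{id}_k$ on $C_0(B)=k$. Cup coproduct on $C_n(B)$: $\cup^c=\sum_{j=1}^{n+1}(\mu^c\otimes\mathrm{id}^{\otimes2})\circ(\Delta_{2,j-1,1}\otimes\mathrm{id})\circ\Delta_{j,n+1-j,j}$. Cobracket: $\{-\}=(\mathrm{id}-\rho)\circ[-]$ with $[x]=\sum_{p=1}^{n+1}\sum_{i=1}^{p}(-1)^{(n-p)(p-i)}\Delta_{p,n+1-p,i}(x)$ for $x\in C_n(B)$. Flips, on homogeneous elements: $\tau(a\otimes b)=(-1)^{|a||b|}b\otimes a$, $\rho(a\otimes b)=(-1)^{(|a|-1)(|b|-1)}b\otimes a$, $\varrho(a\otimes b)=(-1)^{|a|(|b|-1)}b\otimes a$. A Gerstenhaber coalgebra is a graded $k$-module $V=\bigoplus_{n\ge0}V_n$ with a coassociative coproduct $\cup^c\colon V_n\to\bigoplus_{p+q=n}V_p\otimes V_q$ that is graded cocommutative ($\tau\circ\cup^c=\cup^c$), and a graded Lie cobracket $\{-\}\colon V_n\to\bigoplus_{p+q=n+1}V_p\otimes V_q$ of degree $+1$, meaning a Lie cobracket for the shifted grading: $\mathrm{Im}(\{-\})\subseteq\mathrm{Im}(\mathrm{id}-\rho)$ and $\big(\mathrm{id}+(\mathrm{id}\otimes\rho)\circ(\rho\otimes\mathrm{id})+(\rho\otimes\mathrm{id})\circ(\mathrm{id}\otimes\rho)\big)\circ(\{-\}\otimes\mathrm{id})\circ\{-\}=0$;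 these must satisfy the coLeibniz identity $$(\mathrm{id}\otimes\cup^c)\circ\{-\}=\big(\{-\}\otimes\mathrm{id}+(\varrho\otimes\mathrm{id})\circ(\mathrm{id}\otimes\{-\})\big)\circ\cup^c.$$ Here $\mathrm{id}\otimes\{-\}$ etc. are applied without extra Koszul signs, e.g. $(\mathrm{id}\otimes\{-\})(a\otimes b)=a\otimes\{b\}$.
   Formalization: Over a general ring induced maps H → H⊗H need not exist (e.g. k=Z, B=Z[Z/2]), so the structure on H and Tor is asserted when C(B) is a split complex (proved over a field, or if B and all H_n are k-projective); over any ring the axioms are asserted on C(B) up to boundaries. *)

(* Defs.v *)
From HB Require Import structures.
From mathcomp Require Import all_boot all_algebra boolp.

Set Implicit Arguments.
Unset Strict Implicit.
Unset Printing Implicit Defensive.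

Import GRing.Theory.
Local Open Scope ring_scope.
Local Open Scope quotient_scope.

Section Tensor.
Context {k : comNzRingType}.
Implicit Types M N P : lmodType k.

Definition bilinear_fun M N P (f : M -> N -> P) : Prop :=
  (forall y, linear (f^~ y)) /\ (forall x, linear (f x)).

Definition tsum M N P (f : M -> N -> P) (s : seq (M * N)) : P :=
  \sum_(x <- s) f x.1 x.2.

(* [M \ox N] is the set of formal sums of pairs, two of them being identified
   when no bilinear map separates them.  As the bilinear maps range over all
   target modules (the algebraic tensor product included), this is the usual
   quotient by the bilinearity relations. *)
Definition tensor_rel M N (s t : seq (M * N)) : bool :=
  `[< forall P (f : M -> N -> P), bilinear_fun f -> tsum f s = tsum f t >].

Lemma tensor_relP M N : equiv_class_of (@tensor_rel M N).
Proof.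
split=> [s|s t|t s u].
- by apply/asboolP.
- by apply/asboolP/asboolP => h P f hf; rewrite h.
- by move=> /asboolP h1 /asboolP h2; apply/asboolP => P f hf; rewrite h1 // h2.
Qed.

Canonical tensor_equiv M N := EquivRelPack (@tensor_relP M N).

Definition tensor M N : Type := {eq_quot @tensor_equiv M N}.

HB.instance Definition _ M N := Choice.on (tensor M N).
HB.instance Definition _ M N := EqQuotient.on (tensor M N).

Definition tpi M N (s : seq (M * N)) : tensor M N := \pi s.

Lemma tpiP M N (s t : seq (M * N)) :
  (tpi s = tpi t) <->
  (forall P (f : M -> N -> P), bilinear_fun f -> tsum f s = tsum f t).
Proof.
rewrite /tpi; split=> [|h]; first by move=> /eqquotP /asboolP.
by apply/eqquotP/asboolP.
Qed.

Lemma trepr M N (t : tensor M N) : tpi (repr t) = t.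
Proof. exact: reprK. Qed.

Definition tadd M N (t u : tensor M N) := tpi (repr t ++ repr u).
Definition tscale M N (c : k) (t : tensor M N) :=
  tpi [seq (c *: x.1, x.2) | x <- repr t].
Definition topp M N (t : tensor M N) := tscale (-1) t.

(* Computed on a representative, hence meaningful only for bilinear [f]; then it
   is the induced linear map on [M \ox N]. *)
Definition tlift M N P (f : M -> N -> P) (t : tensor M N) : P :=
  tsum f (repr t).

Lemma tlift_pi M N P (f : M -> N -> P) s :
  bilinear_fun f -> tlift f (tpi s) = tsum f s.
Proof. by move=> hf; have /tpiP := trepr (tpi s); apply. Qed.

Lemma tensorP M N (t u : tensor M N) :
  (forall P (f : M -> N -> P), bilinear_fun f -> tlift f t = tlift f u) ->
  t = u.
Proof. by move=> h; rewrite -(trepr t) -(trepr u); apply/tpiP. Qed.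

Lemma tlift_add M N P (f : M -> N -> P) t u : bilinear_fun f ->
  tlift f (tadd t u) = tlift f t + tlift f u.
Proof. by move=> hf; rewrite tlift_pi // /tsum big_cat. Qed.

Lemma tlift_scale M N P (f : M -> N -> P) c t : bilinear_fun f ->
  tlift f (tscale c t) = c *: tlift f t.
Proof.
move=> hf; rewrite tlift_pi // /tlift /tsum big_map scaler_sumr.
apply: eq_bigr => -[x y] _ /=; have [/(_ y) h _] := hf.
have h0 : f 0 y = 0.
  have := h (-1) 0 0; rewrite scaleN1r oppr0 addr0 => e.
  by rewrite e scaleN1r addNr.
by have := h c x 0; rewrite !addr0 h0 addr0.
Qed.

Lemma tlift0 M N P (f : M -> N -> P) : bilinear_fun f ->
  tlift f (tpi [::]) = 0.
Proof. by move=> hf; rewrite tlift_pi // /tsum big_nil. Qed.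

Local Ltac tens := let P := fresh in let f := fresh in let hf := fresh in
  apply: tensorP => P f hf;
  rewrite ?(tlift_add, tlift_scale, tlift0) //.

Lemma taddA M N : associative (@tadd M N).
Proof. by move=> x y z; tens; rewrite addrA. Qed.
Lemma taddC M N : commutative (@tadd M N).
Proof. by move=> x y; tens; rewrite addrC. Qed.
Lemma tadd0 M N : left_id (tpi [::]) (@tadd M N).
Proof. by move=> x; tens; rewrite add0r. Qed.
Lemma taddN M N : left_inverse (tpi [::]) (@topp M N) (@tadd M N).
Proof. by move=> x; tens; rewrite scaleN1r addNr. Qed.

HB.instance Definition _ M N := GRing.isZmodule.Build (tensor M N)
  (@taddA M N) (@taddC M N) (@tadd0 M N) (@taddN M N).

Lemma tscaleA M N (a b : k) (t : tensor M N) :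
  tscale a (tscale b t) = tscale (a * b) t.
Proof. by tens; rewrite scalerA. Qed.
Lemma tscale1 M N : left_id 1 (@tscale M N).
Proof. by move=> x; tens; rewrite scale1r. Qed.
Lemma tscaleDr M N : right_distributive (@tscale M N) +%R.
Proof. by move=> a x y; tens; rewrite scalerDr. Qed.
Lemma tscaleDl M N (t : tensor M N) :
  {morph (fun a => tscale a t) : a b / a + b}.
Proof. by move=> a b; tens; rewrite scalerDl. Qed.

HB.instance Definition _ M N := GRing.Zmodule_isLmodule.Build k (tensor M N)
  (@tscaleA M N) (@tscale1 M N) (@tscaleDr M N) (@tscaleDl M N).

Definition tpure M N (x : M) (y : N) : tensor M N := tpi [:: (x, y)].

End Tensor.

Arguments tensor {k} M N.
Notation "M \ox N" := (tensor M N) (at level 40, left associativity) : type_scope.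
Notation "x \tens y" := (tpure x y) (at level 40, left associativity) : ring_scope.

Section TensorTheory.
Context {k : comNzRingType}.
Implicit Types M N P : lmodType k.

Lemma tlift_linear M N P (f : M -> N -> P) : bilinear_fun f -> linear (tlift f).
Proof. by move=> hf a x y; rewrite [LHS]tlift_add // [X in X + _]tlift_scale. Qed.

Lemma tlift_pure M N P (f : M -> N -> P) x y :
  bilinear_fun f -> tlift f (x \tens y) = f x y.
Proof. by move=> hf; rewrite tlift_pi // /tsum big_seq1. Qed.

Lemma tpure_bilinear M N : bilinear_fun (@tpure k M N).
Proof.
split=> z a x y; apply: tensorP => P f hf; rewrite tlift_linear // !tlift_pure //.
- by case: hf => /(_ z a x y).
- by case: hf => _ /(_ z a x y).
Qed.

Lemma tensor_pureE M N (t : M \ox N) :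
  t = \sum_(x <- repr t) x.1 \tens x.2.
Proof.
apply: tensorP => P f hf; rewrite -[LHS](tlift_pi _ hf) trepr [LHS]/tlift /tsum.
elim: (repr t) => [|x s IH]; first by rewrite !big_nil [RHS]tlift0.
by rewrite !big_cons IH [RHS]tlift_add // tlift_pure.
Qed.

Definition tmap M N M' N' (f : M -> M') (g : N -> N') : M \ox N -> M' \ox N' :=
  tlift (fun x y => f x \tens g y).

Definition tassoc M N P : M \ox N \ox P -> M \ox (N \ox P) :=
  tlift (fun t z => tlift (fun x y => x \tens (y \tens z)) t).

Definition tassocV M N P : M \ox (N \ox P) -> M \ox N \ox P :=
  tlift (fun x t => tlift (fun y z => x \tens y \tens z) t).

Definition tswap M N : M \ox N -> N \ox M := tlift (fun x y => y \tens x).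

Lemma tmap_linear M N M' N' (f : M -> M') (g : N -> N') :
  linear f -> linear g -> linear (tmap f g).
Proof.
move=> hf hg; have [h1 h2] := @tpure_bilinear M' N'.
by apply: tlift_linear; split=> z a x y /=; rewrite ?hf ?hg ?h1 ?h2.
Qed.

End TensorTheory.

Section Quotient.
Context {k : comNzRingType}.
Implicit Types M N : lmodType k.

Inductive qspan M (R : M -> Prop) : M -> Prop :=
  | qspan_gen x : R x -> qspan R x
  | qspan0 : qspan R 0
  | qspanP a x y : qspan R x -> qspan R y -> qspan R (a *: x + y).

Definition quot_rel M (R : M -> Prop) (x y : M) : bool := `[< qspan R (x - y) >].

Lemma quot_relP M (R : M -> Prop) : equiv_class_of (quot_rel R).
Proof.
have sym x y : quot_rel R x y -> quot_rel R y x.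
  move=> /asboolP h; apply/asboolP.
  have -> : y - x = -1 *: (x - y) + 0 by rewrite scaleN1r opprB addr0.
  exact: qspanP h (qspan0 _).
split=> [x|x y|y x z].
- by apply/asboolP; rewrite subrr; apply: qspan0.
- by apply/idP/idP; apply: sym.
- move=> /asboolP h1 /asboolP h2; apply/asboolP.
  have -> : x - z = 1 *: (x - y) + (y - z) by rewrite scale1r subrKA.
  exact: qspanP.
Qed.

Canonical quot_equiv M (R : M -> Prop) := EquivRelPack (quot_relP R).

Definition quot M (R : M -> Prop) : Type := {eq_quot quot_equiv R}.

HB.instance Definition _ M (R : M -> Prop) := Choice.on (quot R).
HB.instance Definition _ M (R : M -> Prop) := EqQuotient.on (quot R).

Section QuotientModule.
Variables (M : lmodType k) (R : M -> Prop).

Definition qpi (x : M) : quot R := \pi x.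
Definition qadd (x y : quot R) := qpi (repr x + repr y).
Definition qscale a (x : quot R) := qpi (a *: repr x).
Definition qopp (x : quot R) := qpi (- repr x).

Lemma qpiP x y : (qpi x = qpi y) <-> qspan R (x - y).
Proof.
by rewrite /qpi; split=> [/eqquotP /asboolP|h] //; apply/eqquotP/asboolP.
Qed.

Lemma qrepr x : qpi (repr x) = x.
Proof. exact: reprK. Qed.

Lemma qrepr_pi x : qspan R (repr (qpi x) - x).
Proof. by apply/qpiP; rewrite qrepr. Qed.

Lemma qspanD x y : qspan R x -> qspan R y -> qspan R (x + y).
Proof. by move=> hx; rewrite -[x]scale1r; apply: qspanP. Qed.

Lemma qspanZ a x : qspan R x -> qspan R (a *: x).
Proof. by move=> hx; rewrite -[_ *: _]addr0; apply: qspanP hx (qspan0 _). Qed.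

Lemma qaddE x y : qadd (qpi x) (qpi y) = qpi (x + y).
Proof. by apply/qpiP; rewrite opprD addrACA; apply: qspanD; apply: qrepr_pi. Qed.

Lemma qscaleE a x : qscale a (qpi x) = qpi (a *: x).
Proof. by apply/qpiP; rewrite -scalerBr; apply: qspanZ; apply: qrepr_pi. Qed.

Lemma qoppE x : qopp (qpi x) = qpi (- x).
Proof.
apply/qpiP; set r := repr _.
have -> : - r - - x = -1 *: (r - x) by rewrite scaleN1r opprB opprK addrC.
by apply: qspanZ; apply: qrepr_pi.
Qed.

Lemma qaddA : associative qadd.
Proof.
by move=> x y z; rewrite -(qrepr x) -(qrepr y) -(qrepr z) !qaddE addrA.
Qed.
Lemma qaddC : commutative qadd.
Proof. by move=> x y; rewrite -(qrepr x) -(qrepr y) !qaddE addrC. Qed.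
Lemma qadd0 : left_id (qpi 0) qadd.
Proof. by move=> x; rewrite -(qrepr x) !qaddE add0r. Qed.
Lemma qaddN : left_inverse (qpi 0) qopp qadd.
Proof. by move=> x; rewrite -(qrepr x) qoppE !qaddE addNr. Qed.

HB.instance Definition _ := GRing.isZmodule.Build (quot R)
  qaddA qaddC qadd0 qaddN.

Lemma qscaleA a b x : qscale a (qscale b x) = qscale (a * b) x.
Proof. by rewrite -(qrepr x) !qscaleE scalerA. Qed.
Lemma qscale1 : left_id 1 qscale.
Proof. by move=> x; rewrite -(qrepr x) qscaleE scale1r. Qed.
Lemma qscaleDr : right_distributive qscale +%R.
Proof.
by move=> a x y; rewrite -(qrepr x) -(qrepr y) [_ + _]qaddE !qscaleE
  [RHS]qaddE scalerDr.
Qed.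
Lemma qscaleDl x : {morph (fun a => qscale a x) : a b / a + b}.
Proof. by move=> a b; rewrite -(qrepr x) !qscaleE [RHS]qaddE scalerDl. Qed.

HB.instance Definition _ := GRing.Zmodule_isLmodule.Build k (quot R)
  qscaleA qscale1 qscaleDr qscaleDl.

Lemma qpi_linear : linear qpi.
Proof. by move=> a x y; rewrite -qaddE -qscaleE. Qed.

End QuotientModule.

(* Meaningful only for [f] linear and zero on [R]. *)
Definition qlift M N (R : M -> Prop) (f : M -> N) (x : quot R) : N :=
  f (repr x).

Section QuotientLift.
Variables (M N : lmodType k) (R : M -> Prop) (f : {linear M -> N}).
Hypothesis fR : forall x, R x -> f x = 0.

Lemma qspan_lift x : qspan R x -> f x = 0.
Proof.
elim=> [y /fR //| | a y z _ hy _ hz]; first exact: raddf0.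
by rewrite linearP hy hz scaler0 addr0.
Qed.

Lemma qlift_pi x : qlift f (qpi R x) = f x.
Proof.
by apply/eqP; rewrite /qlift -subr_eq0 -raddfB; apply/eqP/qspan_lift/qrepr_pi.
Qed.

Lemma qlift_linear : linear (@qlift M N R f).
Proof.
move=> a x y; rewrite -(qrepr x) -(qrepr y) -qpi_linear !qlift_pi.
exact: linearP.
Qed.

End QuotientLift.

Section Kernel.
Variables (M N : lmodType k) (g : {linear M -> N}).

Definition ker_pred : {pred M} := [pred x | g x == 0].

Lemma ker_submod : submod_closed ker_pred.
Proof.
split=> [|a x y]; first by rewrite inE raddf0.
by rewrite !inE linearP => /eqP-> /eqP->; rewrite scaler0 addr0.
Qed.

HB.instance Definition _ := GRing.isSubmodClosed.Build k M ker_pred ker_submod.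

Record ker : Type := Ker { kval : M; kvalP : kval \in ker_pred }.

HB.instance Definition _ := [isSub for kval].
HB.instance Definition _ := [Choice of ker by <:].
HB.instance Definition _ := [SubChoice_isSubLmodule of ker by <:].

End Kernel.

Section Homology.
Variables (V : nat -> lmodType k) (d : forall n, {linear V n.+1 -> V n}).

(* The differential out of degree [n], which is zero for [n = 0]. *)
Definition bdry n : {linear V n -> V n.-1} :=
  if n is m.+1 then d m else \0.

Definition cycles n : lmodType k := ker (bdry n).

Definition homology n : lmodType k :=
  quot (fun z : cycles n => exists y : V n.+1, d n y = kval z).

(* Junk value: [hclass x] is the class of [0] when [x] is not a cycle. *)
Definition hclass n (x : V n) : homology n := qpi _ (insubd (0 : cycles n) x).

Definition hproj n (z : cycles n) : homology n := qpi _ z.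

(* The complex is split: [d s d = d] for some graded map [s] of degree 1. *)
Definition split_complex : Prop :=
  exists s : forall n, {linear V n -> V n.+1},
    forall n (x : V n.+1), d n (s n (d n x)) = d n x.

End Homology.

End Quotient.

Section Graded.
Context {k : comNzRingType}.
Implicit Types V W : nat -> lmodType k.

(* A linear map from V to V \ox V, given by its components from [V n] to
   [V p \ox V q]. *)
Definition coop V : Type := forall n p q : nat, V n -> V p \ox V q.

Section Ops.
Variable V : nat -> lmodType k.

(* The three flips.  [p.+1] and [q.+1] stand for [p - 1] and [q - 1], which have
   the same parity; subtraction on [nat] would be wrong in degree 0. *)
Definition flip_tau p q (t : V p \ox V q) : V q \ox V p :=
  (-1) ^+ (p * q) *: tswap t.
Definition flip_rho p q (t : V p \ox V q) : V q \ox V p :=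
  (-1) ^+ (p.+1 * q.+1) *: tswap t.
Definition flip_varrho p q (t : V p \ox V q) : V q \ox V p :=
  (-1) ^+ (p * q.+1) *: tswap t.

Definition rho12 p q r (t : V p \ox V q \ox V r) : V q \ox V p \ox V r :=
  tmap (@flip_rho p q) id t.
Definition rho23 p q r (t : V p \ox V q \ox V r) : V p \ox V r \ox V q :=
  tassocV (tmap id (@flip_rho q r) (tassoc t)).

Unset Implicit Arguments.
Variables cup br : coop V.
Set Implicit Arguments.

(* (id + (id \ox rho)(rho \ox id) + (rho \ox id)(id \ox rho)) ({-} \ox id) {-} in
   the component [V p \ox V q \ox V r].  The inner cobracket starts in degree
   [p + q - 1]; for [p = q = 0] it vanishes by its degree. *)
Definition cojacobiator n p q r (x : V n) : V p \ox V q \ox V r :=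
  let br2 a b c := tmap (br (a + b)%N.-1 a b) id (br n (a + b)%N.-1 c x) in
  br2 p q r + rho23 (rho12 (br2 r p q)) + rho12 (rho23 (br2 q r p)).

(* (id \ox cup) {-} - ({-} \ox id + (varrho \ox id)(id \ox {-})) cup *)
Definition coleibnizator n p q r (x : V n) : V p \ox V q \ox V r :=
  tassocV (tmap id (cup (q + r)%N q r) (br n p (q + r)%N x))
  - (tmap (br (p + q)%N.-1 p q) id (cup n (p + q)%N.-1 r x)
     + tmap (@flip_varrho q p) id
         (tassocV (tmap id (br (p + r)%N.-1 p r) (cup n q (p + r)%N.-1 x)))).

(* ((cup \ox id) - (id \ox cup)) cup *)
Definition coassociator n p q r (x : V n) : V p \ox V q \ox V r :=
  tmap (cup (p + q)%N p q) id (cup n (p + q)%N r x)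
  - tassocV (tmap id (cup (q + r)%N q r) (cup n p (q + r)%N x)).

(* (id - tau) cup *)
Definition cocommutator n p q (x : V n) : V p \ox V q :=
  cup n p q x - flip_tau (cup n q p x).

Record is_cocommutative_coproduct : Prop := {
  cup_linear : forall n p q, linear (cup n p q);
  cup_degree : forall n p q x, (p + q)%N <> n -> cup n p q x = 0;
  cup_coassoc : forall n p q r x, @coassociator n p q r x = 0;
  cup_cocomm : forall n p q x, @cocommutator n p q x = 0
}.

Record is_counit (eps : V 0 -> k^o) : Prop := {
  ccu_linear : linear eps;
  ccu_left : forall n (x : V n),
    tlift (fun a (y : V n) => eps a *: y) (cup n 0%N n x) = x;
  ccu_right : forall n (x : V n),
    tlift (fun (y : V n) a => eps a *: y) (cup n n 0%N x) = x
}.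

Record is_lie_cobracket : Prop := {
  br_linear : forall n p q, linear (br n p q);
  br_degree : forall n p q x, (p + q)%N <> n.+1 -> br n p q x = 0;
  br_image : forall n x, exists w : forall p q, V p \ox V q,
    forall p q, (p + q)%N = n.+1 -> br n p q x = w p q - flip_rho (w q p);
  br_cojacobi : forall n p q r x, @cojacobiator n p q r x = 0
}.

Record is_gerstenhaber_coalgebra : Prop := {
  gc_coproduct : is_cocommutative_coproduct;
  gc_cobracket : is_lie_cobracket;
  gc_coleibniz : forall n p q r x, @coleibnizator n p q r x = 0
}.

End Ops.

Section Induced.
Variables (V : nat -> lmodType k) (d : forall n, {linear V n.+1 -> V n}).

(* The differential of V \ox V (in the component [V p \ox V q]) is
   d \ox id + (-1)^(p + s) id \ox d, with the usual grading of the first factor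
   for [s = 0] and the shifted one, relevant for the cobracket, for [s = 1].
   An element of V \ox V is given by its components. *)
Definition tens_diff (s : nat) (w : forall p q, V p \ox V q) p q : V p \ox V q :=
  tmap (d p) id (w p.+1 q) + (-1) ^+ (p + s) *: tmap id (d q) (w p q.+1).

Definition tens3_diff (s : nat) (w : forall p q r, V p \ox V q \ox V r) p q r :
    V p \ox V q \ox V r :=
  tmap (tmap (d p) id) id (w p.+1 q r)
  + (-1) ^+ (p + s) *: tmap (tmap id (d q)) id (w p q.+1 r)
  + (-1) ^+ (p + s + q) *: tmap id (d r) (w p q r.+1).

(* [fH] is induced by [f]: for every cycle [z], the Kuenneth map sends
   [fH [z]] to the class of [f z] in the homology of V \ox V; that is, [f z] is
   homologous to a sum of tensors of cycles, whose classes make up [fH [z]]. *)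
Definition induces (s : nat) (f : coop V) (fH : coop (homology d)) : Prop :=
  forall n (z : cycles d n),
  exists (y : forall p q, cycles d p \ox cycles d q) (w : forall p q, V p \ox V q),
  forall p q,
    f n p q (kval z) = tmap (@kval _ _ _ _) (@kval _ _ _ _) (y p q) + tens_diff s w p q
    /\ fH n p q (hproj z) = tmap (@hproj _ _ _ _) (@hproj _ _ _ _) (y p q).

(* The axioms of a Gerstenhaber coalgebra on the level of the complex, those on
   V \ox V and V \ox V \ox V holding in homology: the two operations are chain
   maps, and the defects of cocommutativity and of the coLeibniz identity on
   cycles are boundaries.  Coassociativity and the Lie axioms hold strictly.
   No Kuenneth isomorphism enters. *)
Record is_gerstenhaber_coalgebra_up_to_boundaries (cup br : coop V) : Prop := {
  gb_diff : forall n (x : V n.+2), d n (d n.+1 x) = 0;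
  gb_cup_linear : forall n p q, linear (cup n p q);
  gb_cup_degree : forall n p q x, (p + q)%N <> n -> cup n p q x = 0;
  gb_cup_chain : forall n p q (x : V n),
    tens_diff 0 (fun p q => cup n p q x) p q = cup n.-1 p q (bdry d n x);
  gb_coassoc : forall n p q r x, @coassociator V cup n p q r x = 0;
  gb_cocomm : forall n (z : V n), bdry d n z = 0 ->
    exists w, forall p q, cocommutator cup p q z = tens_diff 0 w p q;
  gb_cobracket : is_lie_cobracket br;
  gb_br_chain : forall n p q (x : V n),
    tens_diff 1 (fun p q => br n p q x) p q = br n.-1 p q (bdry d n x);
  gb_coleibniz : forall n (z : V n), bdry d n z = 0 ->
    exists w, forall p q r, coleibnizator cup br p q r z = tens3_diff 1 w p q r
}.

End Induced.

End Graded.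

Section Bialgebra.
Context {k : comNzRingType}.

Definition tmul (B : algType k) (s t : B \ox B) : B \ox B :=
  tlift (fun a b => tlift (fun a' b' => (a * a') \tens (b * b')) t) s.

Record bialgebra (B : algType k) := Bialgebra {
  comul : {linear B -> B \ox B};
  counit : {linear B -> k^o};
  comulA : forall x, tassoc (tmap comul id (comul x)) = tmap id comul (comul x);
  comul_counitl : forall x, tlift (fun a b => counit a *: b) (comul x) = x;
  comul_counitr : forall x, tlift (fun a b => counit b *: a) (comul x) = x;
  comulM : forall x y, comul (x * y) = tmul (comul x) (comul y);
  comul1 : comul 1 = 1 \tens 1;
  counitM : forall x y, counit (x * y) = counit x * counit y;
  counit1 : counit 1 = 1
}.

(* The module [V n] transported to [V m]; zero if [n <> m]. *)
Definition gcast (V : nat -> lmodType k) n m (x : V n) : V m :=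
  if n =P m is ReflectT e then ecast i (V i) e x else 0.

Section Chains.
Variables (B : algType k) (D : bialgebra B).
Local Notation eps := (counit D).

(* [tpow n] is the n-th tensor power of [B]; (x_1, ..., x_n) is
   x_1 \tens (x_2 \tens (... (x_n \tens 1))). *)
Fixpoint tpow n : lmodType k := if n is m.+1 then (B \ox tpow m)%type else k^o.

(* (x_1, x_2, ...) |-> (x_1 x_2, ...) *)
Definition merge2 n : tpow n.+2 -> tpow n.+1 :=
  tlift (fun x : B => tlift (fun (y : B) (t : tpow n) => (x * y) \tens t)).

(* The i-th face of (x_1, ..., x_{n+1}): for [i = 0] apply the counit to x_1,
   for [i = n.+1] apply it to x_{n+1}, otherwise multiply x_i and x_{i+1}. *)
Fixpoint face n (i : nat) : tpow n.+1 -> tpow n :=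
  match n, i with
  | n, 0 => tlift (fun (x : B) (t : tpow n) => eps x *: t)
  | 0, _.+1 => tlift (fun (x : B) (t : tpow 0) => eps x *: t)
  | n.+1, 1 => @merge2 n
  | n.+1, i.+1 => tlift (fun (x : B) (t : tpow n.+1) => x \tens @face n i t)
  end.

Lemma merge2_linear n : linear (@merge2 n).
Proof.
have [tl tr] := @tpure_bilinear k B (tpow n).
have bil (x : B) :
    bilinear_fun (fun (y : B) (t : tpow n) => (x * y) \tens t).
  by split=> [t a y y'|y]; [rewrite /= mulrDr -scalerAr tl | exact: tr].
apply: tlift_linear; split=> [u a x x'|x]; last exact: tlift_linear.
rewrite /= /tlift /tsum scaler_sumr -big_split; apply: eq_bigr => -[y t] _ /=.
by rewrite mulrDl -scalerAl tl.
Qed.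

Lemma face_linear n i : linear (@face n i).
Proof.
have eps_linear m : linear (tlift (fun (x : B) (t : tpow m) => eps x *: t)).
  apply: tlift_linear; split=> [t a x y|x a t u] /=.
    by rewrite linearP scalerDl scalerA.
  by rewrite scalerDr !scalerA mulrC.
elim: n i => [|n IH] [|i].
- exact: (eps_linear 0).
- exact: (eps_linear 0).
- exact: (eps_linear n.+1).
case: i => [|i]; first exact: merge2_linear.
have [tl tr] := @tpure_bilinear k B (tpow n).
apply: tlift_linear; split=> [t a x y|x a t u]; first exact: tl.
by rewrite -tr -IH.
Qed.

Definition bar_fun n (x : tpow n.+1) : tpow n :=
  \sum_(i < n.+2) (-1) ^+ i *: face i x.

Lemma bar_fun_linear n : linear (@bar_fun n).
Proof.
move=> a x y; rewrite /bar_fun scaler_sumr -big_split; apply: eq_bigr => i _ /=.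
by rewrite face_linear scalerDr !scalerA mulrC.
Qed.

HB.instance Definition _ n :=
  GRing.isLinear.Build k (tpow n.+1) (tpow n) *:%R (@bar_fun n) (@bar_fun_linear n).

Definition bar_diff n : {linear tpow n.+1 -> tpow n} := @bar_fun n.

(* (x_1, ..., x_{q+r}) |->
   (x_1' ... x_q', x_{q+1}, ..., x_{q+r}) \tens (x_1'', ..., x_q'')
   where x' \tens x'' is Sweedler notation. *)
Fixpoint decomp1 q r : tpow (q + r) -> tpow r.+1 \ox tpow q :=
  match q with
  | 0 => fun t => ((1 : B) \tens t) \tens (1 : k^o)
  | q.+1 => tlift (fun (x : B) (t : tpow (q + r)) =>
      tlift (fun a b => tmap (tmap ( *%R a) id) (fun v => b \tens v)
                          (@decomp1 q r t)) (comul D x))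
  end.

(* The partial decomposition Delta_{i+1+r, q, i+1}: the first [i] entries of
   (x_1, ..., x_{i+q+r}) are kept, [decomp1] applies to the others. *)
Fixpoint decomp0 i q r : tpow (i + (q + r)) -> tpow (i + r.+1) \ox tpow q :=
  match i with
  | 0 => @decomp1 q r
  | i.+1 => tlift (fun (x : B) (t : tpow (i + (q + r))) =>
      tmap (fun u => x \tens u) id (@decomp0 i q r t))
  end.

(* Delta_{p, q, i} for 1 <= i <= p on [tpow n]; zero unless n = p + q - 1. *)
Definition decomp n p q i (x : tpow n) : tpow p \ox tpow q :=
  let i0 := i.-1 in let r := (p - i)%N in
  tmap (@gcast tpow (i0 + r.+1) p) id
    (@decomp0 i0 q r (@gcast tpow n (i0 + (q + r)) x)).

(* mu^c (x_1, x_2) = eps (x_1 x_2) *)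
Definition mu_c : tpow 2 -> k^o :=
  tlift (fun (x : B) (t : tpow 1) => tlift (fun (y : B) (c : k^o) => c * eps (x * y)) t).

(* The cup coproduct; its component in [tpow p \ox tpow q] comes from the summand
   j = p + 1 (and q = n + 1 - j). *)
Definition bar_cup : coop tpow := fun n p q x =>
  tmap (fun y => tlift (fun u v => mu_c u *: v) (decomp 2 p 1 y)) id
    (decomp p.+1 q p.+1 x).

(* The component of [x] in [tpow p \ox tpow q]; as q = n + 1 - p, the sign
   exponent (n - p)(p - i) is (q - 1)(p - i). *)
Definition bar_circ : coop tpow := fun n p q x =>
  \sum_(1 <= i < p.+1) (-1) ^+ (q.+1 * (p - i)) *: decomp p q i x.

(* (id - rho) [x] *)
Definition bar_br : coop tpow := fun n p q x =>
  bar_circ p q x - flip_rho (bar_circ q p x).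

(* H_n(B, k) *)
Definition bar_homology : nat -> lmodType k := homology bar_diff.

End Chains.

Definition projective (R : nzRingType) (P : lmodType R) : Prop :=
  forall (M N : lmodType R) (g : {linear M -> N}) (f : {linear P -> N}),
    (forall y, exists x, g x = y) ->
    exists h : {linear P -> M}, forall x, g (h x) = f x.

Definition restr (B : algType k) (P : lmodType B) : Type := P.

Section Restriction.
Variables (B : algType k) (P : lmodType B).
HB.instance Definition _ := GRing.Zmodule.on (restr P).
Definition restr_scale (c : k) (x : restr P) : restr P := (c%:A : B) *: (x : P).
Lemma restr_scaleA a b x :
  restr_scale a (restr_scale b x) = restr_scale (a * b) x.
Proof. by rewrite /restr_scale scalerA -scalerAl mul1r scalerA. Qed.
Lemma restr_scale1 : left_id 1 restr_scale.
Proof. by move=> x; rewrite /restr_scale scale1r [LHS]scale1r. Qed.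
Lemma restr_scaleDr : right_distributive restr_scale +%R.
Proof. by move=> a x y; apply: scalerDr. Qed.
Lemma restr_scaleDl x : {morph restr_scale^~ x : a b / a + b}.
Proof. by move=> a b; rewrite /restr_scale scalerDl [LHS]scalerDl. Qed.
HB.instance Definition _ := GRing.Zmodule_isLmodule.Build k (restr P)
  restr_scaleA restr_scale1 restr_scaleDr restr_scaleDl.
End Restriction.

Section Tor.
Variables (B : algType k) (D : bialgebra B).
Local Notation eps := (counit D).

(* The tensor product of the right module k (via the counit) and [P] over [B]. *)
Definition ktens_rel (P : lmodType B) (t : k^o \ox restr P) : Prop :=
  exists (c : k^o) (b : B) (x : P),
    t = (c * eps b) \tens (x : restr P) - c \tens (b *: x : restr P).

Definition ktens (P : lmodType B) : lmodType k := quot (@ktens_rel P).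

Definition ktens_map (P Q : lmodType B) (f : P -> Q) : ktens P -> ktens Q :=
  qlift (fun t => qpi (@ktens_rel Q) (tmap (id : k^o -> k^o) (f : restr P -> restr Q) t)).

Lemma ktens_map_linear (P Q : lmodType B) (f : {linear P -> Q}) :
  linear (ktens_map f).
Proof.
have fl : linear (f : restr P -> restr Q) by move=> a x y; apply: linearP.
pose F (t : k^o \ox restr P) :=
  qpi (@ktens_rel Q) (tmap (id : k^o -> k^o) (f : restr P -> restr Q) t).
have tf : linear (tmap (id : k^o -> k^o) (f : restr P -> restr Q)).
  by apply: tmap_linear.
have Fl : linear F by move=> a x y; rewrite /F tf qpi_linear.
pose F' : {linear k^o \ox restr P -> ktens Q} :=
  HB.pack F (GRing.isLinear.Build _ _ _ _ _ Fl).
apply: (qlift_linear (f := F')) => _ [c [b [x ->]]] /=.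
have bil : bilinear_fun
    (fun (x : k^o) (y : restr P) => x \tens (f y : restr Q)).
  have [tl tr] := @tpure_bilinear k k^o (restr Q).
  by split=> [y|y a z t] /=; [exact: tl | rewrite fl tr].
have Fsub u v : F (u - v) = F u - F v by exact: (raddfB F').
rewrite -[LHS]/(F _) Fsub.
rewrite /F /tmap !tlift_pure //; apply/eqP; rewrite subr_eq0; apply/eqP/qpiP.
by apply: qspan_gen; exists c, b, (f x); rewrite linearZ.
Qed.

HB.instance Definition _ (P Q : lmodType B) (f : {linear P -> Q}) :=
  GRing.isLinear.Build k (ktens P) (ktens Q) *:%R (ktens_map f)
    (@ktens_map_linear P Q f).

(* A projective resolution of k as a left [B]-module via the counit. *)
Record resolution := Resolution {
  res_mod : nat -> lmodType B;
  res_projective : forall n, projective (res_mod n);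
  res_diff : forall n, {linear res_mod n.+1 -> res_mod n};
  res_aug : res_mod 0 -> k;
  res_aug_linear : forall b x y,
    res_aug (b *: x + y) = eps b * res_aug x + res_aug y;
  res_aug_surj : forall c, exists x, res_aug x = c;
  res_exact0 : forall x, res_aug x = 0 <-> exists y, res_diff 0 y = x;
  res_exact : forall n x, res_diff n x = 0 <-> exists y, res_diff n.+1 y = x
}.

Section TorOf.
Variable R : resolution.

Definition tor_diff n : {linear ktens (res_mod R n.+1) -> ktens (res_mod R n)} :=
  ktens_map (res_diff R n).

(* Tor^B_n(k, k), computed by the resolution [R]. *)
Definition Tor : nat -> lmodType k := homology tor_diff.

(* [b \ox (x_1, ..., x_n) |-> b *: g n (x_1, ..., x_n)] is a map of complexes from
   the bar resolution to [R] lifting the identity of k. *)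
Definition is_comparison
    (g : forall n, {linear tpow B n -> restr (res_mod R n)}) : Prop :=
  res_aug (g 0%N (1 : k^o) : res_mod R 0) = 1
  /\ forall n (x : tpow B n.+1),
    res_diff R n (g n.+1 x) =
    tlift (fun (b : B) (t : tpow B n) => (b *: (g n t : res_mod R n) : restr (res_mod R n))) x
    + \sum_(i < n.+1) (-1) ^+ i.+1 *: g n (face D i.+1 x) :> restr (res_mod R n).

(* [phi] is the isomorphism from H_n(B, k) onto Tor^B_n(k, k) induced by a
   comparison of resolutions. *)
Definition is_tor_iso (phi : forall n, bar_homology D n -> Tor n) : Prop :=
  exists2 g, is_comparison g &
  forall n, [/\ linear (phi n), bijective (phi n) &
    forall z : cycles (bar_diff D) n,
      phi n (hproj z) = hclass tor_diff (qpi (@ktens_rel _) ((1 : k^o) \tens g n (kval z)))].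

End TorOf.

End Tor.

Definition is_field (R : comNzRingType) : Prop :=
  forall x : R, x != 0 -> exists y, y * x = 1.

End Bialgebra.

(* Main.v *)
(* The operations are computed on elementary tensors, that is on words in B.  There the
   sum [-] of the partial decompositions satisfies, together with its two- and threefold
   braces, the duals of the pre-Lie and brace identities of a multiplicative operad
   (Gerstenhaber-Voronov).  The bar differential is the bracket with the cochain mu^c and
   the cup coproduct is deconcatenation.  The pre-Lie identity gives d d = 0 and the Lie
   axioms; [-] is a null homotopy of the cocommutator and the twofold brace, up to sign,
   one of the defect of the coLeibniz identity.

   If d s d = d, the class map r(x) = [x - s d x] and the lift i [z] = z - d s z satisfy
   r i = id and i r ~ id, and (r \ox r) f i is the operation induced by f; the identities
   up to boundaries become identities on homology.

   For Tor, the given resolution is compared with the bar resolution B \ox C_n(B), which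
   becomes C(B) after tensoring with k over B. *)
From HB Require Import structures.
Require Import Defs.
From mathcomp Require Import all_boot all_algebra boolp classical_sets functions zify ring.

Set Implicit Arguments.
Unset Strict Implicit.
Unset Printing Implicit Defensive.

Import GRing.Theory.
Local Open Scope ring_scope.

(** * Words, splittings and iterated coproducts *)

Section Lists.
Variables (k : comNzRingType) (B : algType k) (D : bialgebra B).
Implicit Types (P Q : lmodType k) (s t u v w : seq B) (x y : B).

Fixpoint spl (T : Type) (s : seq T) : seq (seq T * seq T) :=
  ([::], s) :: (if s is x :: s' then [seq (x :: z.1, z.2) | z <- spl s'] else [::]).

(* Pairs of words (x_1', ..., x_n'), (x_1'', ..., x_n''). *)
Fixpoint sw (s : seq B) : seq (seq B * seq B) :=
  if s is x :: s' then
    [seq (ab.1 :: z.1, ab.2 :: z.2) | ab <- (repr (comul D x) : seq (B * B)), z <- sw s']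
  else [:: ([::], [::])].

Definition K P s (F : seq B -> seq B -> P) : P := \sum_(z <- spl s) F z.1 z.2.
Definition W P s (F : seq B -> seq B -> P) : P := \sum_(z <- sw s) F z.1 z.2.
Definition K3 P s (F : seq B -> seq B -> seq B -> P) : P :=
  K s (fun u r => K r (fun v w => F u v w)).
Local Notation pi s := (\prod_(x <- s) x).

Lemma mem_spl s z : z \in spl s -> z.1 ++ z.2 = s.
Proof.
elim: s z => [|x s IH] z /=; first by rewrite inE => /eqP->.
rewrite inE => /orP[/eqP-> //|/mapP[z' /IH h ->]] /=.
by rewrite h.
Qed.

Lemma mem_sw s z : z \in sw s -> size z.1 = size s /\ size z.2 = size s.
Proof.
elim: s z => [|x s IH] z /=; first by rewrite inE => /eqP->.
by move=> /allpairsP[[a b] /= [_ /IH [h1 h2] ->]] /=; rewrite h1 h2.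
Qed.

Lemma eq_K P s (F G : seq B -> seq B -> P) :
  (forall u v, u ++ v = s -> F u v = G u v) -> K s F = K s G.
Proof. by move=> h; apply: eq_big_seq => z /mem_spl; apply: h. Qed.

Lemma eq_W P s (F G : seq B -> seq B -> P) :
  (forall u v, size u = size s -> size v = size s -> F u v = G u v) -> W s F = W s G.
Proof. by move=> h; apply: eq_big_seq => z /mem_sw []; apply: h. Qed.

Lemma eq_K3 P s (F G : seq B -> seq B -> seq B -> P) :
  (forall u v w, u ++ v ++ w = s -> F u v w = G u v w) -> K3 s F = K3 s G.
Proof. by move=> h; apply: eq_K => u r e; apply: eq_K => v w e2; apply: h; rewrite e2. Qed.

Lemma KD P s (F G : seq B -> seq B -> P) :
  K s (fun u v => F u v + G u v) = K s F + K s G.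
Proof. exact: big_split. Qed.
Lemma K3D P s (F G : seq B -> seq B -> seq B -> P) :
  K3 s (fun u v w => F u v w + G u v w) = K3 s F + K3 s G.
Proof. by rewrite -KD; apply: eq_K => *; exact: KD. Qed.
Lemma WD P s (F G : seq B -> seq B -> P) :
  W s (fun u v => F u v + G u v) = W s F + W s G.
Proof. exact: big_split. Qed.

Lemma K_lin P Q (f : P -> Q) (hf : linear f) s (F : seq B -> seq B -> P) :
  f (K s F) = K s (fun u v => f (F u v)).
Proof.
pose f' : {linear P -> Q} := HB.pack f (GRing.isLinear.Build _ _ _ _ _ hf).
exact: (raddf_sum f').
Qed.
Lemma W_lin P Q (f : P -> Q) (hf : linear f) s (F : seq B -> seq B -> P) :
  f (W s F) = W s (fun u v => f (F u v)).
Proof.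
pose f' : {linear P -> Q} := HB.pack f (GRing.isLinear.Build _ _ _ _ _ hf).
exact: (raddf_sum f').
Qed.
Lemma K3_lin P Q (f : P -> Q) (hf : linear f) s (F : seq B -> seq B -> seq B -> P) :
  f (K3 s F) = K3 s (fun u v w => f (F u v w)).
Proof. by rewrite /K3 K_lin //; apply: eq_K => *; rewrite K_lin. Qed.
Lemma scale_lin P (a : k) : linear (fun x : P => a *: x).
Proof. by move=> b x y; rewrite scalerDr !scalerA mulrC. Qed.

Lemma KZ P s a (F : seq B -> seq B -> P) : K s (fun u v => a *: F u v) = a *: K s F.
Proof. by rewrite (K_lin (scale_lin a)). Qed.
Lemma WZ P s a (F : seq B -> seq B -> P) : W s (fun u v => a *: F u v) = a *: W s F.
Proof. by rewrite (W_lin (scale_lin a)). Qed.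
Lemma K3Z P s a (F : seq B -> seq B -> seq B -> P) :
  K3 s (fun u v w => a *: F u v w) = a *: K3 s F.
Proof. by rewrite (K3_lin (scale_lin a)). Qed.
Lemma KC P s t (F : seq B -> seq B -> seq B -> seq B -> P) :
  K s (fun u v => K t (fun a b => F u v a b)) = K t (fun a b => K s (fun u v => F u v a b)).
Proof. exact: exchange_big. Qed.
Lemma WC P s t (F : seq B -> seq B -> seq B -> seq B -> P) :
  W s (fun u v => W t (fun a b => F u v a b)) = W t (fun a b => W s (fun u v => F u v a b)).
Proof. exact: exchange_big. Qed.
Lemma WK P s t (F : seq B -> seq B -> seq B -> seq B -> P) :
  W s (fun u v => K t (fun a b => F u v a b)) = K t (fun a b => W s (fun u v => F u v a b)).
Proof. exact: exchange_big. Qed.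
Lemma WK3 P s t (F : seq B -> seq B -> seq B -> seq B -> seq B -> P) :
  W s (fun u v => K3 t (fun a b c => F u v a b c)) =
  K3 t (fun a b c => W s (fun u v => F u v a b c)).
Proof. by rewrite /K3 WK; apply: eq_K => *; rewrite WK. Qed.
Lemma K_nil P (F : seq B -> seq B -> P) : K [::] F = F [::] [::].
Proof. by rewrite /K /= big_seq1. Qed.
Lemma K_cons P x s (F : seq B -> seq B -> P) :
  K (x :: s) F = F [::] (x :: s) + K s (fun u v => F (x :: u) v).
Proof. by rewrite /K /= big_cons big_map. Qed.

Lemma K_cat P s y t (F : seq B -> seq B -> P) :
  K (s ++ y :: t) F = K s (fun a b => F a (b ++ y :: t)) + K t (fun a b => F (s ++ y :: a) b).
Proof.
elim: s F => [|x s IH] F /=; first by rewrite K_cons K_nil.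
by rewrite !K_cons IH addrA.
Qed.

Lemma KA P s (F : seq B -> seq B -> seq B -> P) :
  K s (fun a c => K a (fun u v => F u v c)) = K3 s F.
Proof.
rewrite /K3; elim: s F => [|x s IH] F; first by rewrite !K_nil.
rewrite !K_cons K_nil -addrA -IH -KD; congr (_ + _).
by apply: eq_K => a c _; rewrite K_cons.
Qed.

Lemma K3_cat P s y t (F : seq B -> seq B -> seq B -> P) :
  K3 (s ++ y :: t) F =
  K3 s (fun a b c => F a b (c ++ y :: t)) +
  K s (fun a b => K t (fun c d => F a (b ++ y :: c) d)) +
  K3 t (fun a b c => F (s ++ y :: a) b c).
Proof.
rewrite /K3 K_cat -KD; congr (_ + _).
by apply: eq_K => a b _; rewrite K_cat.
Qed.

Lemma W_nil P (F : seq B -> seq B -> P) : W [::] F = F [::] [::].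
Proof. by rewrite /W /= big_seq1. Qed.
Lemma W_cons P x s (F : seq B -> seq B -> P) :
  W (x :: s) F = W [:: x] (fun a b => W s (fun u v => F (a ++ u) (b ++ v))).
Proof.
rewrite /W /= big_allpairs_dep [RHS]big_flatten big_map.
by apply: eq_bigr => ab _; rewrite big_seq1.
Qed.
Lemma W1 P x (F : seq B -> seq B -> P) :
  W [:: x] F = \sum_(ab <- (repr (comul D x) : seq (B * B))) F [:: ab.1] [:: ab.2].
Proof. by rewrite /W /= big_flatten big_map; apply: eq_bigr => ab _; rewrite big_seq1. Qed.

Lemma W_cat P s t (F : seq B -> seq B -> P) :
  W (s ++ t) F = W s (fun a b => W t (fun u v => F (a ++ u) (b ++ v))).
Proof.
elim: s F => [|x s IH] F /=; first by rewrite W_nil.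
rewrite W_cons [RHS]W_cons; apply: eq_W => a b _ _.
by rewrite IH; do 2!apply: eq_W => *; rewrite !catA.
Qed.

(* Linear in each letter; thus [F] restricts to a linear map on every [tpow n]. *)
Definition ml P (F : seq B -> P) := forall u v, linear (fun x => F (u ++ x :: v)).

Lemma W_spl2 P s (F : seq B -> seq B -> seq B -> P) :
  W s (fun a b => K b (fun u v => F a u v)) =
  K s (fun s1 s2 => W s1 (fun a1 u => W s2 (fun a2 v => F (a1 ++ a2) u v))).
Proof.
elim: s F => [|x s IH] F; first by rewrite !W_nil !K_nil !W_nil.
rewrite W_cons K_cons W_nil.
have E : forall u v, size u = size [:: x] -> size v = size [:: x] ->
  W s (fun u0 v0 => K (v ++ v0) (fun u1 v1 => F (u ++ u0) u1 v1)) =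
  W s (fun u0 v0 => F (u ++ u0) [::] (v ++ v0)) +
  K s (fun s1 s2 => W s1 (fun a1 b1 => W s2 (fun a2 b2 => F (u ++ a1 ++ a2) (v ++ b1) b2))).
  move=> u [|y []] // _ _; rewrite -(IH (fun a b c => F (u ++ a) (y :: b) c)) -WD; apply: eq_W => a b _ _.
  by rewrite K_cons.
rewrite (eq_W E) WD; congr (_ + _); first by rewrite [RHS]W_cons.
rewrite WK; apply: eq_K => s1 s2 _; rewrite [RHS]W_cons; apply: eq_W => *.
by apply: eq_W => *; apply: eq_W => *; rewrite catA.
Qed.

Lemma linear_bigsum (M N : lmodType k) (f : M -> N) (hf : linear f) I (r : seq I) (F : I -> M) :
  f (\sum_(i <- r) F i) = \sum_(i <- r) f (F i).
Proof.
pose f' : {linear M -> N} := HB.pack f (GRing.isLinear.Build _ _ _ _ _ hf).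
exact: (raddf_sum f').
Qed.

Lemma linear_Z (M N : lmodType k) (f : M -> N) (hf : linear f) a m : f (a *: m) = a *: f m.
Proof.
pose f' : {linear M -> N} := HB.pack f (GRing.isLinear.Build _ _ _ _ _ hf).
by rewrite -[a *: m]addr0 hf -[f 0]/(f' 0) raddf0 addr0.
Qed.

Lemma sum_linear (M N : lmodType k) I (r : seq I) (F : I -> M -> N) :
  (forall i, linear (F i)) -> linear (fun m => \sum_(i <- r) F i m).
Proof.
move=> h a x y; rewrite scaler_sumr -big_split; apply: eq_bigr => i _; exact: h.
Qed.

Lemma linear_comp (M N Q : lmodType k) (f : M -> N) (g : N -> Q) :
  linear f -> linear g -> linear (fun m => g (f m)).
Proof. by move=> hf hg a x y /=; rewrite hf hg. Qed.

Lemma tassoc_bilinear (M N P : lmodType k) :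
  bilinear_fun (fun (t : M \ox N) (z : P) => tlift (fun (x : M) (y : N) => x \tens (y \tens z)) t).
Proof.
have [t1 t2] := @tpure_bilinear k M (N \ox P).
have [t3 t4] := @tpure_bilinear k N P.
split=> [z|t].
  apply: tlift_linear; split=> [y|x]; first exact: t1.
  by apply: (linear_comp (f := fun y : N => y \tens z)); [exact: t3 | exact: t2].
apply: sum_linear => -[x y] /=.
by apply: (linear_comp (f := fun z : P => y \tens z)); [exact: t4 | exact: t2].
Qed.

Lemma tassoc_linear (M N P : lmodType k) : linear (@tassoc k M N P).
Proof. exact: tlift_linear (tassoc_bilinear _ _ _). Qed.

Definition trilinear P (F : B -> B -> B -> P) :=
  [/\ forall y z, linear (fun x => F x y z), forall x z, linear (fun y => F x y z)
    & forall x y, linear (fun z => F x y z)].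

Lemma comul_coassoc P (F : B -> B -> B -> P) x : trilinear F ->
  W [:: x] (fun a b => W a (fun a1 a2 => F (pi a1) (pi a2) (pi b))) =
  W [:: x] (fun a b => W b (fun b1 b2 => F (pi a) (pi b1) (pi b2))).
Proof.
case=> h1 h2 h3.
have hb a : bilinear_fun (F a) by split.
pose L := tlift (fun a (t : B \ox B) => tlift (F a) t).
have hL : bilinear_fun (fun a (t : B \ox B) => tlift (F a) t).
  split=> [t|a]; last exact: tlift_linear.
  by apply: sum_linear => -[y z].
have lL : linear L by exact: tlift_linear.
have := congr1 L (comulA D x).
rewrite /tmap [in RHS]/tlift /tsum (linear_bigsum lL) /=.
rewrite [in LHS]/tlift /tsum (linear_bigsum (@tassoc_linear _ _ _)) (linear_bigsum lL) /=.
move=> e; rewrite !W1.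
transitivity (\sum_(i <- (repr (comul D x) : seq (B * B))) L (tassoc (comul D i.1 \tens i.2))).
  apply: eq_bigr => -[a b] _ /=; rewrite W1 /= /tassoc tlift_pure; last exact: tassoc_bilinear.
  rewrite /tlift /tsum (linear_bigsum lL); apply: eq_bigr => -[a1 a2] _ /=.
  by rewrite /L tlift_pure // tlift_pure // !big_seq1.
rewrite e; apply: eq_bigr => -[a b] _ /=; rewrite W1 /L tlift_pure //=.
by apply: eq_bigr => -[b1 b2] _; rewrite !big_seq1.
Qed.

Lemma ml_pi u v : linear (fun x => pi (u ++ x :: v) : B).
Proof.
by move=> a x y; rewrite !big_cat !big_cons /= mulrDl mulrDr -scalerAl -scalerAr.
Qed.

Lemma ml_ctx P (F : seq B -> P) u v : ml F -> ml (fun s => F (u ++ s ++ v)).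
Proof.
move=> h a b c x y.
have e z : u ++ (a ++ z :: b) ++ v = (u ++ a) ++ z :: b ++ v by rewrite -!catA.
by rewrite !e h.
Qed.

Lemma comul_pi P (F : B -> B -> P) v : bilinear_fun F ->
  W [:: pi v] (fun a b => F (pi a) (pi b)) = W v (fun a b => F (pi a) (pi b)).
Proof.
move=> hF.
have E x : W [:: x] (fun a b => F (pi a) (pi b)) = tlift F (comul D x).
  by rewrite W1; apply: eq_bigr => ab _; rewrite !big_seq1.
rewrite E; elim: v F hF {E} => [|x v IH] F hF.
  by rewrite W_nil !big_nil comul1 tlift_pure.
rewrite big_cons comulM W_cons W1 /tmul (linear_bigsum (tlift_linear hF)).
have [h1 h2] := hF.
apply: eq_bigr => -[a b] _ /=.
have hG : bilinear_fun (fun a' b' => F (a * a') (b * b')).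
  split=> [b' c x' y'|a' c x' y'] /=.
    by rewrite mulrDr -scalerAr h1.
  by rewrite mulrDr -scalerAr h2.
transitivity (tlift (fun a' b' => F (a * a') (b * b')) (comul D (pi v))).
  rewrite (linear_bigsum (tlift_linear hF)); apply: eq_bigr => -[a' b'] _ /=.
  by rewrite tlift_pure.
by rewrite IH //; apply: eq_W => a' b' _ _; rewrite !big_cons.
Qed.

Lemma W_counitl P (F : seq B -> P) v : ml F ->
  W v (fun a b => counit D (pi a) *: F b) = F v.
Proof.
elim: v F => [|x v IH] F hF; first by rewrite W_nil big_nil counit1 scale1r.
rewrite W_cons W1.
have hx : linear (fun x => F (x :: v)) by exact: (hF [::] v).
rewrite -{2}[x](comul_counitl D) /tlift /tsum (linear_bigsum hx).
apply: eq_bigr => -[a b] _ /=.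
rewrite (linear_Z hx) -(IH (fun v => F (b :: v))); last first.
  by move=> u w; have := hF (b :: u) w.
rewrite -WZ; apply: eq_W => u w _ _.
by rewrite big_cons counitM scalerA.
Qed.

Lemma W_counitr P (F : seq B -> P) v : ml F ->
  W v (fun a b => counit D (pi b) *: F a) = F v.
Proof.
elim: v F => [|x v IH] F hF; first by rewrite W_nil big_nil counit1 scale1r.
rewrite W_cons W1.
have hx : linear (fun x => F (x :: v)) by exact: (hF [::] v).
rewrite -{2}[x](comul_counitr D) /tlift /tsum (linear_bigsum hx).
apply: eq_bigr => -[a b] _ /=.
rewrite (linear_Z hx) -(IH (fun v => F (a :: v))); last first.
  by move=> u w; have := hF (a :: u) w.
rewrite -WZ; apply: eq_W => u w _ _.
by rewrite big_cons counitM scalerA.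
Qed.

Lemma ml_sum P I (r : seq I) (F : I -> seq B -> P) :
  (forall i, ml (F i)) -> ml (fun s => \sum_(i <- r) F i s).
Proof. by move=> h u v; apply: sum_linear => i; exact: h. Qed.

Lemma ml_pi_in P (F : B -> P) u v : linear F -> ml (fun s => F (pi (u ++ s ++ v))).
Proof.
move=> h; apply: (ml_ctx (F := fun s => F (pi s))) => a b.
exact: (linear_comp (ml_pi a b) h).
Qed.

Definition ml3 P (F : seq B -> seq B -> seq B -> P) :=
  [/\ forall b c, ml (fun a => F a b c), forall a c, ml (fun b => F a b c)
    & forall a b, ml (F a b)].

Lemma W_coassoc P (F : seq B -> seq B -> seq B -> P) s : ml3 F ->
  W s (fun a b => W a (fun a1 a2 => F a1 a2 b)) =
  W s (fun a b => W b (fun b1 b2 => F a b1 b2)).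
Proof.
elim: s F => [|x s IH] F hF; first by rewrite !W_nil.
pose G a1 a2 b := W s (fun u v => W v (fun v1 v2 => F (a1 :: u) (a2 :: v1) (b :: v2))).
have [h1 h2 h3] := hF.
have e1 : W (x :: s) (fun a b => W a (fun a1 a2 => F a1 a2 b)) =
    W [:: x] (fun a b => W a (fun a1 a2 => G (pi a1) (pi a2) (pi b))).
  rewrite W_cons; apply: eq_W => -[|a []] // [|b []] // _ _.
  under eq_W => u v _ _ do rewrite /= W_cons.
  rewrite WC; apply: eq_W => -[|a1 []] // [|a2 []] // _ _.
  rewrite /G !big_seq1 -IH //.
  by split=> y z u v; [have := h1 (a2 :: y) (b :: z) (a1 :: u) v
   | have := h2 (a1 :: y) (b :: z) (a2 :: u) v | have := h3 (a1 :: y) (a2 :: z) (b :: u) v].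
rewrite e1 comul_coassoc; last first.
  by split=> y z c x1 x2; rewrite /G scaler_sumr -big_split; apply: eq_bigr => i _ /=;
   rewrite scaler_sumr -big_split; apply: eq_bigr => j _ /=;
   [exact: (h1 _ _ [::]) | exact: (h2 _ _ [::]) | exact: (h3 _ _ [::])].
rewrite [RHS]W_cons; apply: eq_W => -[|a []] // [|b []] // _ _.
under [RHS]eq_W => u v _ _ do rewrite /= W_cons.
rewrite [RHS]WC; apply: eq_W => -[|a1 []] // [|a2 []] // _ _.
by rewrite /G !big_seq1.
Qed.

(* The first Sweedler components of [v] are multiplied together, the second ones
   are kept as a word. *)
Definition J P v (F : B -> seq B -> P) : P := W v (fun a b => F (pi a) b).

(* Sweedler components of u ++ y :: w, the second word being cut around y''. *)
Definition Jmid P u y w (F : B -> seq B -> B -> seq B -> P) : P :=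
  W u (fun a a' => W w (fun b b' => W [:: y] (fun m n =>
    F (pi (a ++ m ++ b)) a' (pi n) b'))).

Lemma J_cat P u y w (F : B -> seq B -> P) :
  J (u ++ y :: w) F = Jmid u y w (fun z p y' q => F z (p ++ y' :: q)).
Proof.
rewrite /J W_cat; apply: eq_W => a a' _ _; rewrite W_cons WC.
apply: eq_W => b b' _ _; apply: eq_W => m [|n []] // _ _.
by rewrite big_seq1.
Qed.

Definition JJ P u v w (F : B -> seq B -> B -> seq B -> seq B -> P) : P :=
  W u (fun a a' => W w (fun b b' => W v (fun v1 v2 => J v2 (fun y h =>
    F (pi (a ++ v1 ++ b)) a' y b' h)))).

Definition nestable P (F : B -> seq B -> B -> seq B -> seq B -> P) :=
  [/\ forall p y q h, linear (fun z => F z p y q h),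
      forall z p q h, linear (fun y => F z p y q h)
    & forall z p y q, ml (F z p y q)].

Lemma J_nest P u v w (F : B -> seq B -> B -> seq B -> seq B -> P) : nestable F ->
  J v (fun y h => Jmid u y w (fun z p y' q => F z p y' q h)) = JJ u v w F.
Proof.
case=> h1 h2 h3; rewrite /J /Jmid /JJ.
rewrite WC; apply: eq_W => a a' _ _; rewrite WC; apply: eq_W => b b' _ _.
transitivity (W v (fun v' h => W v' (fun v1 v2 => F (pi (a ++ v1 ++ b)) a' (pi v2) b' h))).
  apply: eq_W => v' h _ _.
  pose Fy y y' := F (pi (a ++ y :: b)) a' y' b' h.
  transitivity (W v' (fun v1 v2 => Fy (pi v1) (pi v2))); last first.
    apply: eq_W => v1 v2 _ _; rewrite /Fy; congr (F _ _ _ _ _).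
    by rewrite !big_cat big_cons.
  rewrite -comul_pi; last first.
    split=> [y|y]; last exact: h2.
    exact: (linear_comp (g := fun z => F z a' y b' h) (ml_pi a b) (h1 _ _ _ _)).
  apply: eq_W => -[|p []] // [|q []] // _ _.
  by rewrite /Fy /= !big_seq1.
rewrite W_coassoc //; split=> p q.
- exact: (ml_pi_in (F := fun y => F y a' (pi p) b' q)).
- move=> c d.
  exact: (linear_comp (g := fun y => F (pi (a ++ p ++ b)) a' y b' q)
    (ml_pi c d) (h2 _ _ _ _)).
- exact: h3.
Qed.

End Lists.

(** * Braces *)

Section Signs.
Variable k : comNzRingType.
Local Notation sg n x := (((-1) ^+ n : k) *: x).

Lemma sg_odd (P : lmodType k) m n (x : P) : odd m = odd n -> sg m x = sg n x.
Proof. by move=> h; rewrite -signr_odd h signr_odd. Qed.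

Lemma sg_sg (P : lmodType k) m n (x : P) : sg m (sg n x) = sg (m + n) x.
Proof. by rewrite scalerA exprD. Qed.
End Signs.

Ltac parity := rewrite ?sg_sg; apply: sg_odd; rewrite ?size_cat /=
  ?(oddD, oddM, oddS, size_cat) /=; repeat case: (odd _) => //=.

Section Brace.
Variables (k : comNzRingType) (B : algType k) (D : bialgebra B).
Implicit Types (P Q : lmodType k) (s t u v w : seq B) (x y : B).
Local Notation sg n x := (((-1) ^+ n : k) *: x).
Local Notation J := (J D).
Local Notation W := (W D).
Local Notation JJ := (JJ D).

(* One decomposition of the word s = u ++ v ++ w: the middle part is replaced by the
   product y of its first components, the second ones forming the word g. *)
Definition R P s (G : seq B -> B -> seq B -> seq B -> P) : P :=
  K3 s (fun u v w => sg ((size v).+1 * size w) (J v (fun y g => G u y w g))).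

Definition RMid P s y t (G : seq B -> B -> seq B -> seq B -> B -> seq B -> P) : P :=
  K s (fun a b => K t (fun c d =>
    sg ((size b + size c).+2 * size d) (Jmid D b y c (fun z p y' q => G a z d p y' q)))).

Lemma eq_J P v (F G : B -> seq B -> P) :
  (forall y g, size g = size v -> F y g = G y g) -> J v F = J v G.
Proof. by move=> h; apply: eq_W => *; exact: h. Qed.

Lemma eq_R P s (F G : seq B -> B -> seq B -> seq B -> P) :
  (forall u y w g, (size u + size g + size w)%N = size s -> F u y w g = G u y w g) ->
  R s F = R s G.
Proof.
move=> h; apply: eq_K3 => u v w e; congr (_ *: _); apply: eq_J => y g eg.
by apply: h; rewrite eg -e !size_cat addnA.
Qed.

Lemma JD P v (F G : B -> seq B -> P) :
  J v (fun y g => F y g + G y g) = J v F + J v G.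
Proof. exact: WD. Qed.
Lemma JZ P v a (F : B -> seq B -> P) : J v (fun y g => a *: F y g) = a *: J v F.
Proof. exact: WZ. Qed.
Lemma RD P s (F G : seq B -> B -> seq B -> seq B -> P) :
  R s (fun u y w g => F u y w g + G u y w g) = R s F + R s G.
Proof. by rewrite -K3D; apply: eq_K3 => u v w _; rewrite JD scalerDr. Qed.
Lemma RZ P s a (F : seq B -> B -> seq B -> seq B -> P) :
  R s (fun u y w g => a *: F u y w g) = a *: R s F.
Proof.
by rewrite -K3Z; apply: eq_K3 => u v w _; rewrite JZ !scalerA mulrC.
Qed.
Lemma R_lin P Q (f : P -> Q) (hf : linear f) s (F : seq B -> B -> seq B -> seq B -> P) :
  f (R s F) = R s (fun u y w g => f (F u y w g)).
Proof.
by rewrite (K3_lin hf); apply: eq_K3 => u v w _; rewrite (linear_Z hf) (W_lin D hf).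
Qed.

Lemma JK P v s (F : B -> seq B -> seq B -> seq B -> P) :
  J v (fun y g => K s (fun a b => F y g a b)) = K s (fun a b => J v (fun y g => F y g a b)).
Proof. exact: WK. Qed.
Lemma JK3 P v s (F : B -> seq B -> seq B -> seq B -> seq B -> P) :
  J v (fun y g => K3 s (fun a b c => F y g a b c)) =
  K3 s (fun a b c => J v (fun y g => F y g a b c)).
Proof. exact: WK3. Qed.
Lemma JC P s t (F : B -> seq B -> B -> seq B -> P) :
  J s (fun y u => J t (fun z v => F y u z v)) = J t (fun z v => J s (fun y u => F y u z v)).
Proof. exact: WC. Qed.
Lemma WR P v s (F : seq B -> seq B -> seq B -> B -> seq B -> seq B -> P) :
  W v (fun t g => R s (fun a b c d => F t g a b c d)) =
  R s (fun a b c d => W v (fun t g => F t g a b c d)).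
Proof.
rewrite /R WK3; apply: eq_K3 => a b c _; rewrite WZ; congr (_ *: _); exact: WC.
Qed.

Lemma JR P v s (F : B -> seq B -> seq B -> B -> seq B -> seq B -> P) :
  J v (fun y g => R s (fun a b c d => F y g a b c d)) =
  R s (fun a b c d => J v (fun y g => F y g a b c d)).
Proof. by rewrite /R JK3; apply: eq_K3 => *; rewrite JZ JC. Qed.

Lemma KR P s t (F : seq B -> seq B -> seq B -> B -> seq B -> seq B -> P) :
  K t (fun c d => R s (fun u y w g => F c d u y w g)) =
  R s (fun u y w g => K t (fun c d => F c d u y w g)).
Proof.
rewrite /R /K3 KC; apply: eq_K => u r _; rewrite KC; apply: eq_K => v w _.
by rewrite KZ JK.
Qed.

Lemma RC P s t (F : seq B -> B -> seq B -> seq B -> seq B -> B -> seq B -> seq B -> P) :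
  R s (fun u y w g => R t (fun a z b h => F u y w g a z b h)) =
  R t (fun a z b h => R s (fun u y w g => F u y w g a z b h)).
Proof.
rewrite {1 4}/R /K3 -!KR; apply: eq_K => u r _; rewrite -KR; apply: eq_K => v w _.
by rewrite JR RZ.
Qed.

Lemma RMidZ P s y t a (G : seq B -> B -> seq B -> seq B -> B -> seq B -> P) :
  RMid s y t (fun u z w p y' q => a *: G u z w p y' q) = a *: RMid s y t G.
Proof.
rewrite -KZ; apply: eq_K => u v _; rewrite -KZ; apply: eq_K => w w' _.
rewrite scalerA mulrC -scalerA; congr (_ *: _); rewrite -WZ.
by do 2!(apply: eq_W => ? ? _ _; rewrite -WZ); apply: eq_W.
Qed.

Lemma R_cat P s y t (G : seq B -> B -> seq B -> seq B -> P) :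
  R (s ++ y :: t) G =
  R s (fun u z w g => sg ((size g).+1 * (size t).+1) (G u z (w ++ y :: t) g))
  + RMid s y t (fun a z d p y' q => G a z d (p ++ y' :: q)) + R t (fun u z w g => G (s ++ y :: u) z w g).
Proof.
rewrite /R K3_cat; congr (_ + _ + _).
  apply: eq_K3 => a b c _.
  transitivity (sg ((size b).+1 * size c) (J b (fun z g =>
    sg ((size b).+1 * (size t).+1) (G a z (c ++ y :: t) g)))).
    by rewrite JZ; parity.
  by congr (_ *: _); apply: eq_J => z g ->.
apply: eq_K => a b _; apply: eq_K => c d _.
by rewrite size_cat /= addnS J_cat.
Qed.

Lemma KKr P s (F : seq B -> seq B -> seq B -> seq B -> P) :
  K s (fun a r => K3 r (fun b c d => F a b c d)) =
  K3 s (fun a b r => K r (fun c d => F a b c d)).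
Proof. by []. Qed.

Lemma K3_split1 P s (F : seq B -> seq B -> seq B -> seq B -> seq B -> P) :
  K3 s (fun u v w => K3 u (fun a b c => F a b c v w)) =
  K3 s (fun a b w => K3 w (fun c v d => F a b c v d)).
Proof.
transitivity (K s (fun u r => K u (fun a u' => K u' (fun b c => K r (fun v w => F a b c v w))))).
  by apply: eq_K => u r _; rewrite /K3 (KC r u); apply: eq_K => a u' _; rewrite (KC r u').
rewrite KA; apply: eq_K => a r _.
by rewrite KA.
Qed.

Lemma K3_splitM P s (F : seq B -> seq B -> seq B -> seq B -> seq B -> P) :
  K3 s (fun u v w => K u (fun a b => K w (fun c d => F a b v c d))) =
  K3 s (fun a r d => K3 r (fun b v c => F a b v c d)).
Proof.
transitivity (K s (fun u r => K u (fun a b => K r (fun v w => K w (fun c d => F a b v c d))))).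
  by apply: eq_K => u r _; rewrite (KC r u).
rewrite (KA s (fun a b r => K r (fun v w => K w (fun c d => F a b v c d)))).
apply: eq_K => a r _.
transitivity (K3 r (fun b v w => K w (fun c d => F a b v c d))); first by [].
rewrite -KKr; under [RHS]eq_K => r' d _ do rewrite /K3.
rewrite (KA r (fun b r'' d => K r'' (fun v c => F a b v c d))).
by apply: eq_K => b r' _; rewrite /K3 KA.
Qed.

Lemma R_swap P s (G : seq B -> B -> seq B -> B -> seq B -> seq B -> seq B -> P) :
  R s (fun u y w h => R w (fun u' z w' g => G u y u' z w' g h)) =
  R s (fun u z w g => R u (fun u' y w' h =>
    sg ((size h).+1 * (size g + size w)) (G u' y w' z w g h))).
Proof.
rewrite /R.
pose F u v u' v' w' := sg ((size v).+1 * (size u' + size v' + size w') + (size v').+1 * size w')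
   (J v (fun y h => J v' (fun z g => G u y u' z w' g h))).
transitivity (K3 s (fun u v w => K3 w (fun u' v' w' => F u v u' v' w'))).
  apply: eq_K3 => u v w _; rewrite JK3 -K3Z; apply: eq_K3 => u' v' w' e.
  by rewrite JZ sg_sg /F -e !size_cat addnA.
rewrite -(K3_split1 s F); apply: eq_K3 => u v w _; rewrite JK3 -K3Z.
apply: eq_K3 => u' v' w' _; rewrite /F JC JZ sg_sg.
transitivity (sg ((size v).+1 * size w + (size v').+1 * size w')
  (J v (fun y g => J v' (fun y0 g0 =>
     sg ((size v').+1 * (size v + size w)) (G u' y0 w' y w g g0))))).
  under [in RHS]eq_J => y g _ do rewrite JZ.
  by rewrite JZ; parity.
congr (_ *: _).
by apply: eq_J => y g eg; apply: eq_J => y' g' eg'; rewrite eg eg'.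
Qed.

Lemma W_spl3 P s (F : seq B -> seq B -> seq B -> seq B -> P) :
  W s (fun a b => K3 b (fun p q t => F a p q t)) =
  K3 s (fun s1 s2 s3 => W s1 (fun a1 p => W s2 (fun a2 q => W s3 (fun a3 t =>
    F (a1 ++ a2 ++ a3) p q t)))).
Proof.
rewrite (W_spl2 D s (fun a p r => K r (fun q t => F a p q t))); apply: eq_K => s1 r _.
rewrite -WK; apply: eq_W => a1 p _ _.
by rewrite (W_spl2 D r (fun a q t => F (a1 ++ a) p q t)).
Qed.

Lemma JJ_R P r (F : B -> seq B -> B -> seq B -> seq B -> P) :
  K3 r (fun b v c => sg ((size v).+1 * size c) (JJ b v c F)) =
  J r (fun z t => R t (fun p y q h => F z p y q h)).
Proof.
rewrite [RHS](W_spl3 r (fun z p q t => sg ((size q).+1 * size t)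
  (J q (fun y h => F (\prod_(x <- z) x) p y t h)))); apply: eq_K3 => b v c _.
rewrite /JJ -WZ; apply: eq_W => x1 p _ _.
rewrite [RHS]WC -WZ; apply: eq_W => x3 t _ e3.
rewrite -WZ; apply: eq_W => x2 q _ e2.
by rewrite e3 e2.
Qed.

Lemma R_nestl P s (F : seq B -> B -> seq B -> seq B -> P) :
  (forall a, nestable (fun z p y q h => F a z (p ++ y :: q) h)) ->
  R s (fun u y w h => K u (fun a b => J (b ++ y :: w) (fun z g => F a z g h))) =
  K s (fun a r => J r (fun z t => R t (fun p y q h => F a z (p ++ y :: q) h))).
Proof.
move=> hF; rewrite /R.
pose G a b v w := sg ((size v).+1 * size w) (JJ b v w (fun z p y q h => F a z (p ++ y :: q) h)).
transitivity (K3 s (fun u v w => K u (fun a b => G a b v w))).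
  apply: eq_K3 => u v w _; rewrite JK -KZ; apply: eq_K => a b _.
  rewrite /G -J_nest //; congr (_ *: _); apply: eq_J => y h _; by rewrite J_cat.
transitivity (K s (fun u r => K u (fun a b => K r (fun v w => G a b v w)))).
  by apply: eq_K => u r _; rewrite (KC r u).
rewrite (KA s (fun a b r => K r (fun v w => G a b v w))); apply: eq_K => a r _.
exact: JJ_R.
Qed.

Lemma R_nest P s (G : seq B -> B -> seq B -> seq B -> B -> seq B -> seq B -> P) :
  (forall a d, nestable (fun z p y q h => G a z d p y q h)) ->
  R s (fun u y w h => RMid u y w (fun a z d p y' q => G a z d p y' q h)) =
  R s (fun a z d b => R b (fun p y q h => G a z d p y q h)).
Proof.
move=> hG; rewrite /R /RMid.
pose F a b v c d := sg ((size b + size v + size c).+1 * size d + (size v).+1 * size c)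
   (JJ b v c (fun z p y q h => G a z d p y q h)).
transitivity (K3 s (fun u v w => K u (fun a b => K w (fun c d => F a b v c d)))).
  apply: eq_K3 => u v w _; rewrite JK -KZ; apply: eq_K => a b _.
  rewrite JK -KZ; apply: eq_K => c d e.
  by rewrite JZ J_nest // -e size_cat /F; parity.
rewrite (K3_splitM s F); apply: eq_K3 => a r d _.
transitivity (sg ((size r).+1 * size d) (K3 r (fun b v c => sg ((size v).+1 * size c)
   (JJ b v c (fun z p y q h => G a z d p y q h))))).
  rewrite -K3Z; apply: eq_K3 => b v c e; rewrite /F -e !size_cat; parity.
congr (_ *: _).
exact: JJ_R.
Qed.

(* [c] is the dual pre-Lie product [-]; [b2] and [b3] are the dual braces, which insert
   two or three words into the first one.  The exponents are the Koszul signs for words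
   of degree [size - 1], reduced mod 2. *)
Definition c P s (F : seq B -> seq B -> P) : P := R s (fun u y w g => F (u ++ y :: w) g).

Definition b2 P s (F : seq B -> seq B -> seq B -> P) : P :=
  R s (fun u y w h => c u (fun f g => sg ((size g).+1 * (size w).+1) (F (f ++ y :: w) g h))).

Definition b3 P s (F : seq B -> seq B -> seq B -> seq B -> P) : P :=
  R s (fun u y w e => b2 u (fun f g h =>
    sg ((size g + size h) * (size w).+1) (F (f ++ y :: w) g h e))).

Lemma eq_c P s (F G : seq B -> seq B -> P) :
  (forall f g, (size f + size g = (size s).+1)%N -> F f g = G f g) -> c s F = c s G.
Proof.
move=> h; apply: eq_R => u y w g e; apply: h.
by rewrite -e size_cat /= addnS addSn addnAC.
Qed.

Lemma eq_b2 P s (F G : seq B -> seq B -> seq B -> P) :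
  (forall f g h, (size f + size g + size h = (size s).+2)%N -> F f g h = G f g h) ->
  b2 s F = b2 s G.
Proof.
move=> h; apply: eq_R => u y w g e; apply: eq_c => f i e2; congr (_ *: _); apply: h.
by rewrite size_cat /=; lia.
Qed.

Lemma pre_lie P s (F : seq B -> seq B -> seq B -> P) : ml3 F ->
  c s (fun a h => c a (fun f g => F f g h)) =
  c s (fun f b => c b (fun g h => F f g h)) + b2 s F
  + b2 s (fun f h g => sg ((size g).+1 * (size h).+1) (F f g h)).
Proof.
case=> h1 h2 h3.
transitivity (b2 s F +
  R s (fun u y w h => RMid u y w (fun a z d p y' q => F (a ++ z :: d) (p ++ y' :: q) h)) +
  R s (fun u y w h => R w (fun u' z w' g => F ((u ++ y :: u') ++ z :: w') g h))).
  rewrite -!RD; apply: eq_R => u y w h _; rewrite /c R_cat; congr (_ + _ + _).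
  by apply: eq_R => *; rewrite -catA.
rewrite R_nest; last by move=> a d; split=> *; [exact: h1 | exact: h2 | exact: h3].
rewrite [X in X + _]addrC R_swap; congr (_ + _); apply: eq_R => u z w g _.
by apply: eq_R => u' y w' h _; rewrite -catA; parity.
Qed.

Lemma linear_R (M P : lmodType k) s (G : M -> seq B -> B -> seq B -> seq B -> P) :
  (forall u y w g, linear (fun m => G m u y w g)) ->
  linear (fun m => R s (fun u y w g => G m u y w g)).
Proof.
move=> h a m n; rewrite -RZ -RD; apply: eq_R => u y w g _; exact: h.
Qed.

Lemma linear_mulr (a : B) : linear (fun x => x * a).
Proof. by move=> b x y; rewrite mulrDl scalerAl. Qed.

Lemma linear_scaler (M N : lmodType k) (f : M -> N) a : linear f -> linear (fun m => a *: f m).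
Proof. by move=> h; apply: (linear_comp h); exact: scale_lin. Qed.

Lemma ml_sg P (m : nat -> nat) (F : seq B -> P) : ml F -> ml (fun t => sg (m (size t)) (F t)).
Proof. by move=> h u v a x y; rewrite !size_cat /=; apply: (linear_scaler _ (h u v)). Qed.

Definition ml4 P (F : seq B -> seq B -> seq B -> seq B -> P) :=
  [/\ forall b c d, ml (fun a => F a b c d), forall a c d, ml (fun b => F a b c d),
      forall a b d, ml (fun c => F a b c d) & forall a b c, ml (F a b c)].

Lemma brace_comp P s (F : seq B -> seq B -> seq B -> seq B -> P) : ml4 F ->
  c s (fun a e => b2 a (fun f g h => F f g h e)) =
  b3 s F + b3 s (fun f g e h => sg ((size h).+1 * (size e).+1) (F f g h e))
  + b3 s (fun f e g h => sg ((size g + size h) * (size e).+1) (F f g h e))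
  + b2 s (fun f g b => c b (fun h e => F f g h e))
  + b2 s (fun f b h => c b (fun g e => sg ((size h).+1 * (size e).+1) (F f g h e))).
Proof.
case=> h1 h2 h3 h4.
pose G u z w h e := c u (fun f g => sg ((size g).+1 * (size w).+1) (F (f ++ z :: w) g h e)).
have E : c s (fun a e => b2 a (fun f g h => F f g h e)) =
  R s (fun u y w e => R u (fun u1 z w1 h => sg ((size h).+1 * (size w).+1) (G u1 z (w1 ++ y :: w) h e)))
  + R s (fun u y w e => RMid u y w (fun a z d p y' q => G a z d (p ++ y' :: q) e))
  + R s (fun u y w e => R w (fun u1 z w1 h => G (u ++ y :: u1) z w1 h e)).
  rewrite -!RD; apply: eq_R => u y w e _; rewrite /b2 R_cat //.
rewrite E R_nest; last first.
  move=> a d; split=> [p y q h|z p q h|z p y q u v]; rewrite /G /c;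
    apply: linear_R => *; apply: linear_scaler; [exact: h1 | exact: h3 | exact: h4].
pose b31 := b3 s F; pose b32 := b3 s (fun f g e h => sg ((size h).+1 * (size e).+1) (F f g h e)).
pose b33 := b3 s (fun f e g h => sg ((size g + size h) * (size e).+1) (F f g h e)).
have -> : R s (fun u y w e => R u (fun u1 z w1 h =>
    sg ((size h).+1 * (size w).+1) (G u1 z (w1 ++ y :: w) h e))) = b31.
  apply: eq_R => u y w e _; apply: eq_R => u1 z w1 h _.
  rewrite -RZ; apply: eq_R => u2 z2 w2 g _; rewrite -!catA; parity.
have -> : R s (fun a z d b => R b (fun p y q e => G a z d (p ++ y :: q) e)) =
    b2 s (fun f g b => c b (fun h e => F f g h e)).
  apply: eq_R => u y w b _; rewrite RC; apply: eq_R => u1 z w1 g _.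
  by rewrite -RZ.
have -> : R s (fun u y w e => R w (fun u1 z w1 h => G (u ++ y :: u1) z w1 h e)) =
   b32 + b2 s (fun f b h => c b (fun g e => sg ((size h).+1 * (size e).+1) (F f g h e))) + b33.
  transitivity (R s (fun u y w e => R w (fun u1 z w1 h =>
     R u (fun u2 z2 w2 g => sg ((size g).+1 * (size u1 + size w1).+2)
        (F (u2 ++ z2 :: w2 ++ y :: u1 ++ z :: w1) g h e)))
     ) +
    R s (fun u y w e => R w (fun u1 z w1 h =>
     RMid u y u1 (fun a z2 d p y' q => sg (((size p + size q).+2 * (size w1).+1)%N)
        (F (a ++ z2 :: d ++ z :: w1) (p ++ y' :: q) h e)))) +
    R s (fun u y w e => R w (fun u1 z w1 h =>
     R u1 (fun u2 z2 w2 g => sg ((size g).+1 * (size w1).+1)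
        (F (u ++ y :: u2 ++ z2 :: w2 ++ z :: w1) g h e))))).
    rewrite -!RD; apply: eq_R => u y w e _; rewrite -!RD; apply: eq_R => u1 z w1 h _.
    rewrite /G /c R_cat; congr (_ + _ + _).
    - by apply: eq_R => u2 z2 w2 g _; rewrite -!catA /= -?catA; parity.
    - apply: eq_K => a b _; apply: eq_K => v t _; congr (_ *: _).
      do 3!apply: eq_W => ? ? _ _.
      by rewrite -!catA size_cat /= addnS.
    - by apply: eq_R => u2 z2 w2 g _; rewrite -!catA /= -?catA.
  congr (_ + _ + _).
  - rewrite R_swap; apply: eq_R => u z w h _; apply: eq_R => u1 y w1 e _.
    rewrite -RZ; apply: eq_R => u2 z2 w2 g _; rewrite -!catA /=; parity.
  - rewrite R_swap; apply: eq_R => u z w h _.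
    under eq_R => u' y w' e _ do rewrite -RMidZ.
    pose G' a z2 d p y' q e := sg ((size e).+1 * (size h + size w)) (sg ((size p + size q).+2 *
      (size w).+1) (F (a ++ z2 :: d ++ z :: w) (p ++ y' :: q) h e)).
    rewrite (R_nest u (G := G')); last first.
      rewrite /G' => a d; split=> [p y q e|x p q e|x p y q].
      - by do 2!apply: linear_scaler; exact: h1.
      - by do 2!apply: linear_scaler; exact: h2.
      - apply: (ml_sg (fun n => n.+1 * (size h + size w))%N) => u' v.
        by apply: linear_scaler; exact: h4.
    apply: eq_R => u1 y w1 g _; rewrite -RZ; apply: eq_R => u2 y2 w2 e <-.
    by rewrite /G' -catA /=; parity.
  - rewrite R_swap; apply: eq_R => u z w h _.
    under eq_R => u1 y w1 e _ do rewrite -RZ.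
    rewrite R_swap; apply: eq_R => u1 y w1 g _.
    apply: eq_R => u2 y2 w2 e _.
    by rewrite -!catA /=; parity.
rewrite -/b32 -/b33 -/b31 -!addrA; congr (_ + _).
by rewrite addrC -!addrA; congr (_ + _); rewrite addrC -addrA.
Qed.

Definition RMid2 P u y w y' t (G : seq B -> B -> seq B -> seq B -> B -> seq B -> P) : P :=
  K u (fun a b => K t (fun c d => sg ((size (b ++ y :: w) + size c).+2 * size d)
    (Jmid D (b ++ y :: w) y' c (fun z p y' q => G a z d p y' q)))).

Lemma RMid_cat P u y w y' t (G : seq B -> B -> seq B -> seq B -> B -> seq B -> P) :
  RMid (u ++ y :: w) y' t G =
  RMid2 u y w y' t G + RMid w y' t (fun a => G (u ++ y :: a)).
Proof. exact: K_cat. Qed.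

Lemma comp_brace_inner P s (F : seq B -> seq B -> seq B -> seq B -> P) : ml4 F ->
  R s (fun u y w h => R u (fun u1 y1 w1 g => sg ((size g).+1 * (size w).+1)
    (RMid2 u1 y1 w1 y w (fun a z d p y' q => F (a ++ z :: d) (p ++ y' :: q) g h)))) =
  c s (fun f b => b2 b (fun e g h => F f e g h)).
Proof.
case=> h1 h2 h3 h4.
pose G a z d t y' q h := R t (fun p1 y1 q1 g => sg ((size g).+1 * (size q).+1)
   (F (a ++ z :: d) ((p1 ++ y1 :: q1) ++ y' :: q) g h)).
transitivity (R s (fun a z d b => R b (fun t y q h => G a z d t y q h))); last first.
  by do 2!apply: eq_R => ? ? ? ? _.
rewrite -R_nest; last first.
  by move=> a d; split=> [p y q h|z p q h|z p y q u v]; rewrite /G;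
    apply: linear_R => *; apply: linear_scaler; [exact: h1 | exact: h2 | exact: h4].
apply: eq_R => u y w h _.
transitivity (K w (fun c d => R u (fun u1 y1 w1 g => K u1 (fun a b => J (b ++ y1 :: w1) (fun z t =>
   sg ((size t + size c) * size d + (size g).+1 * (size w).+1)
   (W c (fun c1 c2 => W [:: y] (fun m n => F (a ++ (z * \prod_(x <- m ++ c1) x) :: d)
      (t ++ (\prod_(x <- n) x) :: c2) g h)))))))).
  rewrite KR; apply: eq_R => u1 y1 w1 g _; rewrite /RMid2 KC -KZ; apply: eq_K => a b _.
  rewrite -KZ; apply: eq_K => c d _; rewrite /J /Jmid -!WZ.
  apply: eq_W => b1 b2 _ e2; rewrite sg_sg e2.
  under eq_W => c1 c2 _ _ do under eq_W => m n _ _ do rewrite big_cat.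
  parity.
transitivity (K w (fun c d => K u (fun a r => J r (fun z t => R t (fun p1 y1 q1 g =>
   sg ((size (p1 ++ y1 :: q1) + size c) * size d + (size g).+1 * (size w).+1)
   (W c (fun c1 c2 => W [:: y] (fun m n => F (a ++ (z * \prod_(x <- m ++ c1) x) :: d)
      ((p1 ++ y1 :: q1) ++ (\prod_(x <- n) x) :: c2) g h)))))))).
  apply: eq_K => c d _.
  rewrite (@R_nestl P u (fun a z t g => sg ((size t + size c) * size d + (size g).+1 * (size w).+1)
   (W c (fun c1 c2 => W [:: y] (fun m n => F (a ++ (z * \prod_(x <- m ++ c1) x) :: d)
      (t ++ (\prod_(x <- n) x) :: c2) g h))))) // => a; split.
  - move=> p y' q g; apply: linear_scaler; do 2!apply: sum_linear => ?.
    exact: (linear_comp (linear_mulr _) (h1 _ _ _ _ _)).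
  - move=> z p q g a' m n; rewrite !size_cat /=; move: a' m n; apply: linear_scaler.
    do 2!apply: sum_linear => ?.
    move=> a' m n; rewrite -!catA /=; exact: h2.
  - move=> z p y' q; apply: (ml_sg (fun k => (size (p ++ y' :: q) + size c) * size d + k.+1 * (size w).+1)%N).
    by do 2!apply: ml_sum => ?; exact: h3.
rewrite /RMid KC; apply: eq_K => a r _; apply: eq_K => c d e.
rewrite /J /Jmid -WZ; apply: eq_W => b1 b2 _ eb.
transitivity (sg ((size r + size c).+2 * size d) (R b2 (fun p1 y1 q1 g =>
  W c (fun c1 c2 => W [:: y] (fun m n => sg ((size g).+1 * (size c2).+1)
   (F (a ++ \prod_(x <- b1 ++ m ++ c1) x :: d)
     ((p1 ++ y1 :: q1) ++ (\prod_(x <- n) x) :: c2) g h)))))); last first.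
  congr (_ *: _); rewrite -WR; apply: eq_W => c1 c2 _ _.
  by rewrite -WR.
rewrite -RZ; apply: eq_R => p1 y1 q1 g e1.
rewrite -!WZ; apply: eq_W => c1 c2 _ e2; rewrite -!WZ; apply: eq_W => m n _ _.
rewrite -big_cat /= -e -eb -e1 e2 !size_cat; parity.
Qed.

Lemma comp_brace P s (F : seq B -> seq B -> seq B -> seq B -> P) : ml4 F ->
  b2 s (fun a g h => c a (fun f e => F f e g h)) =
  b3 s F + b3 s (fun f g e h => sg ((size e).+1 * (size g).+1) (F f e g h))
  + b3 s (fun f g h e => sg ((size e).+1 * (size g + size h)) (F f e g h))
  + b2 s (fun f b h => c b (fun e g => F f e g h))
  + b2 s (fun f g b => c b (fun e h => sg ((size e).+1 * (size g).+1) (F f e g h)))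
  + c s (fun f b => b2 b (fun e g h => F f e g h)).
Proof.
move=> hF; rewrite -comp_brace_inner //; case: hF => h1 h2 h3 h4.
transitivity (R s (fun u y w h => R u (fun u1 y1 w1 g => sg ((size g).+1 * (size w).+1) (
   R u1 (fun a z d e => sg ((size e).+1 * (size w1 + size w)) (F (a ++ z :: d ++ y1 :: w1 ++ y :: w) e g h))
   + R w1 (fun a z d e => sg ((size e).+1 * (size w).+1) (F (u1 ++ y1 :: a ++ z :: d ++ y :: w) e g h))
   + R w (fun a z d e => F (u1 ++ y1 :: w1 ++ y :: a ++ z :: d) e g h)
   + RMid u1 y1 w1 (fun a z d p y' q => sg ((size p + size q) * (size w).+1)
       (F (a ++ z :: d ++ y :: w) (p ++ y' :: q) g h))
   + RMid w1 y w (fun a z d p y' q => F (u1 ++ y1 :: a ++ z :: d) (p ++ y' :: q) g h)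
   + RMid2 u1 y1 w1 y w (fun a z d p y' q => F (a ++ z :: d) (p ++ y' :: q) g h))))).
  apply: eq_R => u y w h _; apply: eq_R => u1 y1 w1 g _; congr (_ *: _).
  rewrite /c R_cat R_cat RMid_cat.
  have -> : R u1 (fun u0 z w0 e => sg ((size e).+1 * (size w1).+1) (sg ((size e).+1 * (size w).+1)
      (F (u0 ++ z :: (w0 ++ y1 :: w1) ++ y :: w) e g h))) =
    R u1 (fun a z d e => sg ((size e).+1 * (size w1 + size w)) (F (a ++ z :: d ++ y1 :: w1 ++ y :: w) e g h)).
    by apply: eq_R => a z d e _; rewrite -!catA /=; parity.
  have -> : RMid u1 y1 w1 (fun a z d p y' q => sg ((size (p ++ y' :: q)).+1 * (size w).+1)
      (F (a ++ z :: d ++ y :: w) (p ++ y' :: q) g h)) =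
    RMid u1 y1 w1 (fun a z d p y' q => sg ((size p + size q) * (size w).+1)
       (F (a ++ z :: d ++ y :: w) (p ++ y' :: q) g h)).
    apply: eq_K => *; apply: eq_K => *; congr (_ *: _); do 3!apply: eq_W => ? ? _ _.
    by parity.
  have -> : R w1 (fun u0 z w0 e => sg ((size e).+1 * (size w).+1)
       (F ((u1 ++ y1 :: u0) ++ z :: w0 ++ y :: w) e g h)) =
     R w1 (fun a z d e => sg ((size e).+1 * (size w).+1) (F (u1 ++ y1 :: a ++ z :: d ++ y :: w) e g h)).
    by apply: eq_R => *; rewrite -catA.
  have -> : R w (fun u0 z w0 e => F (((u1 ++ y1 :: w1) ++ y :: u0) ++ z :: w0) e g h) =
     R w (fun a z d e => F (u1 ++ y1 :: w1 ++ y :: a ++ z :: d) e g h).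
    by apply: eq_R => *; rewrite -!catA.
  have -> : RMid w1 y w (fun a z d p y' q => F ((u1 ++ y1 :: a) ++ z :: d) (p ++ y' :: q) g h) =
     RMid w1 y w (fun a z d p y' q => F (u1 ++ y1 :: a ++ z :: d) (p ++ y' :: q) g h).
    by apply: eq_K => *; apply: eq_K => *; congr (_ *: _); do 3!apply: eq_W => *; rewrite -catA.
  by rewrite [LHS](AC (3*2*1) (1*3*6*2*5*4)).
do 5!under eq_R => u y w h _ do (under eq_R => u1 y1 w1 g _ do rewrite scalerDr; rewrite RD).
rewrite !RD; congr (_ + _ + _ + _ + _ + _).
- apply: eq_R => u y w h _; apply: eq_R => u1 y1 w1 g _.
  rewrite -RZ; apply: eq_R => a z d e _; rewrite -!catA /=; parity.
- apply: eq_R => u y w h _; under eq_R => u1 y1 w1 g _ do rewrite -RZ.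
  rewrite R_swap; apply: eq_R => u1 y1 w1 e _; apply: eq_R => a z d g _.
  rewrite -!catA /=; parity.
- transitivity (R s (fun u y w h => R w (fun a z d e => R u (fun u1 y1 w1 g =>
    sg ((size g).+1 * (size a + size e + size d).+1) (F (u1 ++ y1 :: w1 ++ y :: a ++ z :: d) e g h))))).
    apply: eq_R => u y w h _; under eq_R => u1 y1 w1 g _ do rewrite -RZ.
    by rewrite RC; apply: eq_R => a z d e ->.
  rewrite R_swap; apply: eq_R => u y w e _; apply: eq_R => u1 y1 w1 h _.
  rewrite -RZ; apply: eq_R => a z d g _; rewrite -!catA /=; parity.
- apply: eq_R => u y w h _; under eq_R => u1 y1 w1 g _ do rewrite -RMidZ.
  pose G a z d p y' q g := sg ((size g).+1 * (size w).+1) (sg ((size p + size q) * (size w).+1)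
       (F (a ++ z :: d ++ y :: w) (p ++ y' :: q) g h)).
  rewrite (R_nest u (G := G)); last first.
    rewrite /G => a d; split=> [p y' q g|z p q g|z p y' q].
    - by do 2!apply: linear_scaler; exact: h1.
    - by do 2!apply: linear_scaler; exact: h2.
    - apply: (ml_sg (fun n => n.+1 * (size w).+1)%N) => u' v.
      by apply: linear_scaler; exact: h3.
  apply: eq_R => a z d b _; rewrite -RZ; apply: eq_R => p y' q g <-.
  by rewrite /G -catA /=; parity.
- pose G u1 y1 g a z d p y' q h := sg ((size g).+1 * (size h).+1)
    (F (u1 ++ y1 :: a ++ z :: d) (p ++ y' :: q) g h).
  transitivity (R s (fun u1 y1 r g => R r (fun w1 y w h => RMid w1 y w (fun a z d p y' q =>
     G u1 y1 g a z d p y' q h)))).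
    rewrite R_swap; apply: eq_R => u y w h _; apply: eq_R => u1 y1 w1 g _.
    by rewrite /G RMidZ; parity.
  transitivity (R s (fun u1 y1 r g => R r (fun a z d b => R b (fun p y' q h =>
     G u1 y1 g a z d p y' q h)))).
    apply: eq_R => u1 y1 r g _; rewrite (R_nest r (G := G u1 y1 g)) // /G => a d.
    split=> [p y' q h|z p q h|z p y' q].
    - apply: linear_scaler => a' m n; have := h1 (p ++ y' :: q) g h (u1 ++ y1 :: a) d a' m n.
      by rewrite -!catA.
    - by apply: linear_scaler; exact: h2.
    - by apply: (ml_sg (fun n => (size g).+1 * n.+1)%N); exact: h4.
  rewrite R_swap; apply: eq_R => u y w b _; apply: eq_R => u1 y1 w1 g _.
  rewrite -!RZ; apply: eq_R => p y' q h <-.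
  by rewrite /G -catA /=; parity.
Qed.

End Brace.

(** * The differential as a bracket *)

Section Diff.
Variables (k : comNzRingType) (B : algType k) (D : bialgebra B).
Implicit Types (P Q : lmodType k) (s t u v w f g h m : seq B) (x y : B).
Local Notation sg n x := (((-1) ^+ n : k) *: x).
Local Notation J := (J D).
Local Notation W := (W D).
Local Notation R := (R D).
Local Notation c := (c D).
Local Notation b2 := (b2 D).
Local Notation b3 := (b3 D).
Local Notation eps := (counit D).

(* The cochain mu^c, zero off words of length 2. *)
Definition M m : k := if m is [:: x; y] then eps (x * y) else 0.

Arguments M : simpl never.

Lemma M_size P m (z : P) : size m != 2 -> M m *: z = 0.
Proof. by rewrite /M; case: m => [|x [|y [|z' m]]] //= _; rewrite scale0r. Qed.

Lemma ml_M : ml (M : seq B -> k^o).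
Proof.
case=> [|x [|y [|y' u]]] [|z [|z' v]] a b b' /=; rewrite /M ?scaler0 ?addr0 //.
- by rewrite mulrDl -scalerAl linearP.
- by rewrite mulrDr -scalerAr linearP.
Qed.

Lemma M_sg P m i j (z : P) : (size m = 2 -> odd i = odd j) -> M m *: (sg i z) = M m *: (sg j z).
Proof.
case: (altP (size m =P 2)) => [e /(_ e) h|e _]; first by rewrite (sg_odd z h).
by rewrite !M_size.
Qed.

Lemma ml_scale P (F : seq B -> k^o) (z : P) : ml F -> ml (fun m => (F m : k) *: z).
Proof. by move=> h u v a x y; rewrite h scalerDl -scalerA. Qed.

Lemma ml_scaler P (a : k) (F : seq B -> P) : ml F -> ml (fun m => a *: F m).
Proof. by move=> h u v; apply: linear_scaler; exact: h. Qed.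

Lemma K_l0 P s (F : seq B -> seq B -> P) :
  (forall u v, u != [::] -> F u v = 0) -> K s F = F [::] s.
Proof.
move=> h; case: s => [|x s]; first by rewrite K_nil.
by rewrite K_cons /K big1 ?addr0 // => z _; rewrite h.
Qed.

Lemma K_r0 P s (F : seq B -> seq B -> P) :
  (forall u v, v != [::] -> F u v = 0) -> K s F = F s [::].
Proof.
elim: s F => [|x s IH] F h; first by rewrite K_nil.
by rewrite K_cons h // add0r IH // => u v hv; apply: h.
Qed.

Lemma K_rcons P s x (F : seq B -> seq B -> P) :
  K (rcons s x) F = K s (fun u v => F u (rcons v x)) + F (rcons s x) [::].
Proof.
elim: s F => [|y s IH] F; first by rewrite K_cons !K_nil.
by rewrite !K_cons IH addrA.
Qed.

Lemma brace_M P s (F : seq B -> seq B -> P) :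
  (forall g, ml (F^~ g)) -> (forall f, ml (F f)) ->
  b2 s (fun m f g => M m *: F f g) = K s (fun f g => sg (size f).+1 (F f g)).
Proof.
move=> h1 h2; rewrite /b2.
pose E u r := K r (fun v w => sg ((size v).+1 * size w) (J v (fun y h =>
  c u (fun f g => sg ((size g).+1 * (size w).+1) (M (f ++ y :: w) *: F g h))))).
transitivity (K s E); first by [].
apply: eq_K => u r _; rewrite /E K_r0; last first.
  move=> v [//|y w] _; rewrite -[RHS](scaler0 _ ((-1) ^+ ((size v).+1 * size (y :: w)))).
  congr (_ *: _); rewrite /J /W big1 // => z _; rewrite /c /R /K3 /K big1 // => z1 _.
  rewrite big1 // => z2 _; rewrite /J /W big1 ?scaler0 // => z3 _.
  by rewrite M_size ?scaler0 // ?size_cat /= ?size_cat /=; lia.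
rewrite muln0 expr0 scale1r.
transitivity (J r (fun y h => J u (fun z g => sg (size g).+1 (M [:: z; y] *: F g h)))).
  apply: eq_J => y h _; rewrite /c /R /K3 K_l0; last first.
    move=> u1 v1 hu; rewrite /K big1 // => z2 _; rewrite /J /W big1 ?scaler0 // => z3 _.
    by rewrite M_size ?scaler0 // ?size_cat /= ?size_cat /=; case: u1 hu => //= *; lia.
  rewrite K_r0 /= ?muln0 ?expr0 ?scale1r.
    by apply: eq_J => z g _; rewrite muln1.
  move=> u1 v1 hu; rewrite /J /W big1 ?scaler0 // => z3 _.
  by rewrite M_size ?scaler0 // ?size_cat /= ?size_cat /=; case: v1 hu => //= *; lia.
transitivity (W r (fun r1 h => eps (\prod_(x <- r1) x) *:
   W u (fun u1 g => eps (\prod_(x <- u1) x) *: (sg (size g).+1 (F g h))))).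
  apply: eq_W => r1 h _ _; apply: etrans (WZ D u _ _); apply: eq_W => u1 g _ _ /=.
  rewrite /M !scalerA counitM; congr (_ *: _).
  by rewrite mulrC; congr (_ * _); rewrite mulrC.
under eq_W => r1 h _ _ do rewrite (W_counitl D u (F := fun g => sg (size g).+1 (F g h)) (ml_sg S (h1 h))).
by rewrite (W_counitl D r (F := fun h => sg (size u).+1 (F u h)) (ml_scaler _ (h2 u))).
Qed.

Lemma eq_b3 P s (F G : seq B -> seq B -> seq B -> seq B -> P) :
  (forall f g h e, F f g h e = G f g h e) -> b3 s F = b3 s G.
Proof.
by move=> h; apply: eq_R => u y w e _; apply: eq_b2 => f g h' _; rewrite h.
Qed.

Lemma brace3_M P s (F : seq B -> seq B -> seq B -> seq B -> P) :
  b3 s (fun m f g h => M m *: F m f g h) = 0.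
Proof.
rewrite /b3 /R /K3 /K big1 // => z1 _; rewrite big1 // => z2 _; rewrite /J /W big1 ?scaler0 // => z3 _.
rewrite /b2 /c /R /K3 /K big1 // => z4 _; rewrite big1 // => z5 _; rewrite /J /W big1 ?scaler0 // => z6 _.
rewrite /K3 /K big1 // => z7 _; rewrite big1 // => z8 _; rewrite /J /W big1 ?scaler0 // => z9 _.
by rewrite M_size ?scaler0 // ?size_cat /= ?size_cat /=; lia.
Qed.

Lemma sg1 P (z : P) : sg 1 z = - z.
Proof. by rewrite expr1 scaleN1r. Qed.

Lemma sgS P n (z : P) : sg n.+1 z = - sg n z.
Proof. by rewrite exprS mulN1r scaleNr. Qed.

Lemma sgM P m i (z : P) : sg i (M m *: z) = M m *: sg i z.
Proof. by rewrite !scalerA mulrC. Qed.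

Definition E1 P (F : seq B -> P) s : P := if s is x :: t then eps x *: F t else 0.
Definition E2 P (F : seq B -> P) s : P :=
  if s is x :: t then eps (last x t) *: F (belast x t) else 0.

Lemma comp_M P s (F : seq B -> P) : ml F ->
  c s (fun m f => M m *: F f) = E1 F s + sg (size s) (E2 F s).
Proof.
move=> hF.
have hs : forall x, [:: x] != [::] :> seq B by [].
have z0 u v w : size u + size w != 1%N ->
   sg ((size v).+1 * size w) (J v (fun y g => M (u ++ y :: w) *: F g)) = 0.
  move=> e; rewrite /J /W big1 ?scaler0 // => z3 _.
  by rewrite M_size // size_cat /=; lia.
case: s => [|x t].
  by rewrite /c /R /K3 !K_nil z0 //= scaler0 addr0.
rewrite /c /R /K3 K_cons addrC; congr (_ + _).
  rewrite K_l0; last first.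
    by move=> u r hu; rewrite /K big1 // => z _; rewrite z0 //=; case: u hu => //= *; lia.
  rewrite K_r0; last first.
    by move=> u r hu; rewrite z0 //=; case: r hu => //= *; lia.
  rewrite muln0 expr0 scale1r /=.
  rewrite -(W_counitl D t (F := fun f => eps x *: F f)); last exact: ml_scaler.
  by apply: eq_W => u v _ _; rewrite /M /= scalerA counitM mulrC.
rewrite /= -[eps _ *: _](W_counitl D (belast x t) (F := fun f => eps (last x t) *: F f)); last exact: ml_scaler.
rewrite lastI K_rcons (z0 [::] _ [::]) // addr0.
rewrite K_r0; last first.
  by move=> u v hv; apply: (z0 [::]); rewrite /= size_rcons; case: v hv => //= *; lia.
rewrite /= muln1 size_belast; congr (_ *: _); apply: eq_W => u v _ _.
by rewrite /M scalerA counitM mulrC.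
Qed.

Lemma M_assoc P s (z : P) : c s (fun m n => M m *: (M n *: z)) = 0.
Proof.
rewrite (comp_M s (F := fun n => M n *: z)); last exact: ml_scale ml_M.
case: s => [|x [|y [|x' [|y' s]]]]; rewrite /E1 /E2 ?scaler0 ?addr0 //=;
  do ?(rewrite M_size; last by rewrite /= ?size_belast); rewrite ?scaler0 ?addr0 //.
have e (a b d : k) : a * (b * d) + (-1) ^+ 3 * (d * (a * b)) = 0 by ring.
rewrite /M !counitM !scalerA -scalerDl -[RHS](scale0r z) -(e (eps x) (eps y) (eps x')).
by rewrite -mulrA.
Qed.

(* The bar differential, written as the bracket with [M]: all identities involving it
   become instances of the brace identities. *)
Definition Dl P (F : seq B -> P) s : P :=
  c s (fun m f => M m *: F f) + sg (size s).+1 (c s (fun f m => M m *: F f)).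

Lemma cD P s (F G : seq B -> seq B -> P) :
  c s (fun f g => F f g + G f g) = c s F + c s G.
Proof. exact: RD. Qed.
Lemma cZ P s a (F : seq B -> seq B -> P) : c s (fun f g => a *: F f g) = a *: c s F.
Proof. exact: RZ. Qed.
Lemma b2D P s (F G : seq B -> seq B -> seq B -> P) :
  b2 s (fun f g h => F f g h + G f g h) = b2 s F + b2 s G.
Proof.
rewrite -RD; apply: eq_R => u y w h _; rewrite -cD; apply: eq_c => f g _.
exact: scalerDr.
Qed.
Lemma b2Z P s a (F : seq B -> seq B -> seq B -> P) :
  b2 s (fun f g h => a *: F f g h) = a *: b2 s F.
Proof.
rewrite -RZ; apply: eq_R => u y w h _; rewrite -cZ; apply: eq_c => f g _.
by rewrite !scalerA mulrC.
Qed.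
Lemma b3Z P s a (F : seq B -> seq B -> seq B -> seq B -> P) :
  b3 s (fun f g h e => a *: F f g h e) = a *: b3 s F.
Proof.
rewrite -RZ; apply: eq_R => u y w e _; rewrite -b2Z; apply: eq_b2 => f g h _.
by rewrite !scalerA mulrC.
Qed.

Lemma ml3_M P (F : seq B -> seq B -> P) : (forall g, ml (F^~ g)) -> (forall f, ml (F f)) ->
  [/\ ml3 (fun m f g => M m *: F f g), ml3 (fun f m g => M m *: F f g)
    & ml3 (fun f g m => M m *: F f g)].
Proof.
by move=> h1 h2; split; split=> a b; (apply: ml_scale ml_M || (apply: ml_scaler; done)).
Qed.

Lemma Dl_comp P s (F : seq B -> seq B -> P) :
  (forall g, ml (F^~ g)) -> (forall f, ml (F f)) ->
  c s (fun f g => Dl (F^~ g) f) + c s (fun f g => sg (size f).+1 (Dl (F f) g)) =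
  Dl (fun t => c t F) s + K s (fun f g => sg (size f).+1 (F f g))
  + K s (fun g f => sg (size f + size f * size g) (F f g)).
Proof.
move=> h1 h2; have [l1 l2 l3] := ml3_M h1 h2.
pose F1 f g := sg (size f) (F f g); pose F2 f g := sg (size f + size g).+1 (F f g).
have [_ l2' _] : [/\ ml3 (fun m f g => M m *: F1 f g), ml3 (fun f m g => M m *: F1 f g)
    & ml3 (fun f g m => M m *: F1 f g)].
  by apply: ml3_M => a; [exact: (ml_sg id) | exact: ml_scaler].
have [_ _ l3'] : [/\ ml3 (fun m f g => M m *: F2 f g), ml3 (fun f m g => M m *: F2 f g)
    & ml3 (fun f g m => M m *: F2 f g)].
  by apply: ml3_M => a; [exact: (ml_sg (fun n => (n + size a).+1)) | exact: (ml_sg (fun n => (size a + n).+1))].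
pose A1 := c s (fun m b => c b (fun f g => M m *: F f g)).
pose A2 := c s (fun f b => c b (fun m g => M m *: F1 f g)).
pose A3 := b2 s (fun f m g => M m *: F1 f g).
pose A4 := b2 s (fun f g m => M m *: F2 f g).
pose A5 := c s (fun f b => c b (fun g m => M m *: F2 f g)).
have -> : c s (fun f g => Dl (F^~ g) f) = (A1 + b2 s (fun m f g => M m *: F f g)
   + b2 s (fun m g f => M m *: (sg ((size f).+1 * (size g).+1) (F f g)))) + (A2 + A3 + A4).
  rewrite /Dl cD; congr (_ + _).
    rewrite pre_lie //; congr (_ + _ + _).
    by apply: eq_b2 => m g f _; rewrite sgM mulnC.
  transitivity (c s (fun a g => c a (fun f m => M m *: F1 f g))).
    apply: eq_c => a g _; rewrite -cZ; apply: eq_c => f m e; rewrite sgM.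
    apply: M_sg => em; move: e; rewrite em; lia.
  rewrite pre_lie //; congr (_ + _ + _).
  apply: eq_b2 => f g m _; rewrite /F1 /F2 sgM sg_sg; apply: M_sg => ->.
  by rewrite !(oddD, oddM, oddS) /=; case: (odd _); case: (odd _).
have -> : c s (fun f g => sg (size f).+1 (Dl (F f) g)) = - A2 + A5.
  rewrite -scaleN1r -!cZ -cD; apply: eq_c => f b _.
  rewrite /Dl scalerDr -!cZ; congr (_ + _); apply: eq_c => x1 x2 e.
    by rewrite sgM /F1 -[-1]expr1 sgM sg_sg; apply: M_sg.
  rewrite sg_sg sgM /F2; apply: M_sg => em; move: e; rewrite em; lia.
have -> : Dl (fun t => c t F) s = A1 + (A5 + A4 + A3).
  rewrite /Dl; congr (_ + _); first by apply: eq_c => m a _; rewrite -cZ.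
  transitivity (c s (fun a m => c a (fun f g => M m *: F2 f g))).
    rewrite -cZ; apply: eq_c => a m e; rewrite -!cZ; apply: eq_c => f g e2; rewrite sgM.
    apply: M_sg => em; move: e e2; rewrite em; lia.
  rewrite pre_lie //; congr (_ + _ + _).
  apply: eq_b2 => f m g _; rewrite /F1 /F2 sgM sg_sg; apply: M_sg => ->.
  by rewrite !(oddD, oddM, oddS) /=; case: (odd _); case: (odd _).
have -> : b2 s (fun m f g => M m *: F f g) = K s (fun f g => sg (size f).+1 (F f g)).
  by rewrite brace_M.
have -> : b2 s (fun m g f => M m *: (sg ((size f).+1 * (size g).+1) (F f g))) =
   K s (fun g f => sg (size f + size f * size g) (F f g)).
  rewrite (brace_M s (F := fun g f => sg ((size f).+1 * (size g).+1) (F f g))).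
  - apply: eq_K => g f _; rewrite sg_sg; apply: sg_odd.
    by rewrite !(oddD, oddM, oddS) /=; case: (odd _); case: (odd _).
  - by move=> f; apply: (ml_sg (fun n => (size f).+1 * n.+1)%N).
  - by move=> g; apply: (ml_sg (fun n => n.+1 * (size g).+1)%N).
set X := K _ _; set Y := K _ _.
rewrite [LHS](AC (3*3*2) (1*8*6*5*2*3*(4*7))) /= subrr addr0.
by rewrite -!addrA.
Qed.

Lemma Dl_Dl P s (F : seq B -> P) : ml F -> Dl (Dl F) s = 0.
Proof.
move=> hF; pose F1 f := sg (size f).+1 (F f).
have hF1 : ml F1 by exact: (ml_sg S).
have l (G : seq B -> P) (hG : ml G) :
    [/\ ml3 (fun m n f => M m *: (M n *: G f)), ml3 (fun m f n => M m *: (M n *: G f))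
    & ml3 (fun f m n => M m *: (M n *: G f))].
  by split; split=> a b; do ?[exact: ml_scale ml_M | apply: ml_scaler] => //;
    exact: ml_scale ml_M.
pose KF := K s (fun m f => M m *: F f); pose KF' := K s (fun f m => M m *: F f).
have b1 : b2 s (fun m n f => M m *: (M n *: F f)) = - KF.
  rewrite brace_M => [|g|f]; [|exact: ml_scale ml_M | exact: ml_scaler].
  rewrite -scaleN1r -KZ; apply: eq_K => m f _.
  rewrite -[-1]expr1 !sgM; apply: M_sg => ->; lia.
have b4 : b2 s (fun m f n => M m *: (sg ((size f).+1 * (size n).+1) (M n *: F f))) = KF'.
  rewrite (brace_M s (F := fun f n => sg ((size f).+1 * (size n).+1) (M n *: F f))).
  - apply: eq_K => f n _; rewrite sg_sg sgM; rewrite -[in RHS](scale1r (F f)) -[1](expr0 (-1)).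
    by apply: M_sg => ->; rewrite !(oddD, oddM, oddS) /=; case: (odd _).
  - by move=> n; apply: (ml_sg (fun i => i.+1 * (size n).+1)%N); exact: ml_scaler.
  - move=> f; apply: (ml_sg (fun n => (size f).+1 * n.+1)%N).
    exact: ml_scale ml_M.
pose X2 := c s (fun m a => c a (fun f n => M m *: (M n *: F1 f))).
have MC m n (z : P) : M m *: (M n *: z) = M n *: (M m *: z) by rewrite !scalerA mulrC.
have cc0 (G : seq B -> P) : c s (fun a f => c a (fun m n => M m *: (M n *: G f))) = 0.
  rewrite -[RHS](scale0r (c s (fun _ f => G f))) -cZ; apply: eq_c => a f _.
  by rewrite M_assoc scale0r.
have cc0' (G : seq B -> P) : c s (fun f a => c a (fun m n => M m *: (M n *: G f))) = 0.
  rewrite -[RHS](scale0r (c s (fun f _ => G f))) -cZ; apply: eq_c => f a _.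
  by rewrite M_assoc scale0r.
have e1 : c s (fun m a => c a (fun n f => M m *: (M n *: F f))) = KF - KF'.
  have [l1 _ _] := l F hF; have := pre_lie D s l1.
  rewrite cc0 b1 => /eqP; rewrite eq_sym -addrA addr_eq0 => /eqP ->.
  rewrite opprD opprK; congr (_ - _); rewrite -b4; apply: eq_b2 => m f n _.
  by rewrite sgM mulnC.
have sgN (z : P) : -1 *: z = sg 1 z by rewrite expr1.
have -> : Dl (Dl F) s = (KF - KF') - X2 +
    (c s (fun a m => c a (fun n f => M n *: (M m *: F1 f)))
    - c s (fun a m => c a (fun f n => M n *: (M m *: F f)))).
  rewrite {1}/Dl; congr (_ + _).
    rewrite -e1 -scaleN1r -cZ -cD; apply: eq_c => m a _.
    rewrite /Dl scalerDr -!cZ; congr (_ + _); apply: eq_c => f n e.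
    rewrite [RHS]sgN !sgM sg_sg ; congr (_ *: _); apply: M_sg => en; move: e; rewrite en /=; lia.
  rewrite -scaleN1r -!cZ -cD; apply: eq_c => a m e.
  rewrite /Dl !scalerDr -!cZ; congr (_ + _); apply: eq_c => x1 x2 e2.
    rewrite sgM; case: (eqVneq (size m) 2) => em; last by rewrite M_size // [M m *: _]M_size // scaler0.
    rewrite [RHS]MC sgM; congr (_ *: _); apply: M_sg => en; move: e e2; rewrite em en; lia.
  rewrite sgN [in RHS]MC -[in LHS]sgM sg_sg.
  case: (eqVneq (size m) 2) => em; last by rewrite !(M_size _ em) !scaler0.
  by apply: sg_odd; move: e; rewrite em; lia.
have [_ l2 _] := l F1 hF1; have [_ _ l3] := l F hF.
rewrite (pre_lie D s l2) (pre_lie D s l3) cc0'.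
have -> : c s (fun f b => c b (fun g h => M f *: (M h *: F1 g))) = X2 by [].
have -> : b2 s (fun n f m => M n *: (M m *: F1 f)) = KF'.
  rewrite brace_M => [|g|f]; [|exact: ml_scaler | exact: ml_scale ml_M].
  apply: eq_K => f m _; rewrite sgM sg_sg -[in RHS](scale1r (F f)) -[1](expr0 (-1)).
  by apply: M_sg => _; lia.
have -> : b2 s (fun f h g => sg ((size g).+1 * (size h).+1) (M f *: (M h *: F1 g))) = - KF.
  rewrite -b1; apply: eq_b2 => n m f _; rewrite !sgM; congr (_ *: _).
  rewrite sg_sg -[in RHS](scale1r (F f)) -[1](expr0 (-1)); apply: M_sg => ->.
  by rewrite !(oddD, oddM, oddS) /=; case: (odd _).
have -> : b2 s (fun f h g => sg ((size g).+1 * (size h).+1) (M g *: (M h *: F f))) =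
   - b2 s (fun f g h => M g *: (M h *: F f)).
  rewrite -scaleN1r -b2Z; apply: eq_b2 => f m n _.
  case: (eqVneq (size m) 2) => em; last by rewrite !(M_size _ em) !scaler0.
  case: (eqVneq (size n) 2) => en; last by rewrite !(M_size _ en) !scaler0.
  by rewrite MC em en sgN; apply: sg_odd.
rewrite [0 + _ - _](_ : _ = 0); last by rewrite add0r; exact: subrr.
by rewrite subr0 [LHS](AC (3*3) ((3*4)*(2*5)*(1*6))) /= !addNr subrr !addr0.
Qed.

Lemma comp_cons P x s (F : seq B -> seq B -> P) :
  c (x :: s) F = K (x :: s) (fun v w => sg ((size v).+1 * size w) (J v (fun y g => F (y :: w) g)))
  + c s (fun f g => F (x :: f) g).
Proof. exact: K_cons. Qed.

Lemma comp_M_cons P x y t (F : seq B -> P) : ml F ->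
  c (x :: y :: t) (fun f m => M m *: F f) =
  sg (size t) (F (x * y :: t)) + c (y :: t) (fun f m => M m *: F (x :: f)).
Proof.
move=> hF; rewrite comp_cons; congr (_ + _).
have z0 v w : size v != 2 ->
   sg ((size v).+1 * size w) (J v (fun y g => M g *: F (y :: w))) = 0.
  move=> e; rewrite -[RHS](scaler0 _ ((-1) ^+ ((size v).+1 * size w))); congr (_ *: _).
  by rewrite -(scale0r (J v (fun y g => F (y :: w)))) -JZ; apply: eq_J => z g eg; rewrite M_size ?eg ?scale0r.
rewrite !K_cons !z0 // !add0r K_l0; last by move=> [//|z u] v _; rewrite z0.
transitivity (sg (size t) (W [:: x; y] (fun a b => eps (\prod_(x <- b) x) *: F (\prod_(x <- a) x :: t)))).
  rewrite (sg_odd (n := size t)); last by rewrite oddM.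
  congr (_ *: _); apply: eq_W => a [|b [|b' [|]]] // _ _.
  by rewrite /M !big_cons big_nil mulr1.
rewrite (W_counitr D [:: x; y] (F := fun a => F (\prod_(x <- a) x :: t))); last first.
  move=> u v; exact: (linear_comp (ml_pi u v) (hF [::] t)).
by rewrite !big_cons big_nil mulr1.
Qed.

Lemma eq_c_pos P s (F G : seq B -> seq B -> P) :
  (forall f g, (0 < size f)%N -> (size f + size g = (size s).+1)%N -> F f g = G f g) -> c s F = c s G.
Proof.
move=> h; apply: eq_R => u y w g e; apply: h; rewrite size_cat /=; lia.
Qed.

Lemma comp_M_small P s (F : seq B -> P) : (size s < 2)%N -> c s (fun f m => M m *: F f) = 0.
Proof.
move=> h; rewrite -(scale0r (c s (fun f _ => F f))) -cZ; apply: eq_c_pos => f m f0 e.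
by rewrite M_size ?scale0r //; lia.
Qed.

Lemma Dl_nil P (F : seq B -> P) : ml F -> Dl F [::] = 0.
Proof. by move=> hF; rewrite /Dl comp_M // comp_M_small //= !scaler0 !addr0. Qed.

Lemma Dl_1 P x (F : seq B -> P) : ml F -> Dl F [:: x] = 0.
Proof.
by move=> hF; rewrite /Dl comp_M // comp_M_small //= scaler0 addr0 expr1 scaleN1r subrr.
Qed.

Lemma Dl_cons P x y t (F : seq B -> P) : ml F ->
  Dl F (x :: y :: t) = eps x *: F (y :: t) - F (x * y :: t)
    - (Dl (fun s => F (x :: s)) (y :: t) - eps y *: F (x :: t)).
Proof.
move=> hF; have hFx : ml (fun s => F (x :: s)) by move=> u v; exact: (hF (x :: u)).
rewrite /Dl !comp_M // comp_M_cons //= !scalerDr sg_sg.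
set X := c _ _.
have -> : sg ((size t).+3 + size t) (F (x * y :: t)) = - F (x * y :: t).
  by rewrite -sg1; apply: sg_odd; lia.
rewrite sgS (sgS _ X).
set X' := sg (size t).+2 X; set Y := sg _ _; set Z := eps y *: _.
have -> : Z + Y + X' - Z = Y + X' by rewrite addrC -addrA addKr.
by rewrite opprD [LHS](AC (2*2) ((1*3)*(2*4))).
Qed.

Lemma Dl_lin P Q (L : P -> Q) (hL : linear L) s (F : seq B -> P) :
  L (Dl F s) = Dl (fun t => L (F t)) s.
Proof.
rewrite /Dl -[X in X + _]scale1r hL scale1r (linear_Z hL) !(R_lin D hL).
by congr (_ + _ *: _); apply: eq_R => *; rewrite (linear_Z hL).
Qed.

Lemma DlD P s (F G : seq B -> P) : Dl (fun t => F t + G t) s = Dl F s + Dl G s.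
Proof.
rewrite /Dl addrACA -scalerDr -!cD.
by congr (_ + _ *: _); apply: eq_c => *; rewrite scalerDr.
Qed.

Lemma DlZ P s a (F : seq B -> P) : Dl (fun t => a *: F t) s = a *: Dl F s.
Proof. by rewrite -(Dl_lin (scale_lin a)). Qed.

Lemma ml_Kcat P (F : seq B -> seq B -> P) :
  (forall g, ml (F^~ g)) -> (forall f, ml (F f)) -> ml (fun t => K t F).
Proof.
move=> h1 h2 u v a x y; rewrite !K_cat scalerDr addrACA -!KZ -!KD.
by congr (_ + _); apply: eq_K => *; [exact: h2 | exact: h1].
Qed.

Lemma Dl_K P s (F : seq B -> seq B -> P) :
  (forall g, ml (F^~ g)) -> (forall f, ml (F f)) ->
  K s (fun u v => Dl (F^~ v) u) + K s (fun u v => sg (size u) (Dl (F u) v)) =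
  Dl (fun t => K t F) s.
Proof.
elim: s F => [|x [|y t] IH] F h1 h2; have hK := ml_Kcat h1 h2.
- by rewrite !K_nil !Dl_nil // scaler0 addr0.
- by rewrite !(K_cons, K_nil) Dl_nil // !Dl_1 // ?Dl_nil // !scaler0 !addr0.
have h1x : forall g, ml (fun u => F (x :: u) g) by move=> g u v; exact: (h1 g (x :: u)).
have h2x : forall f, ml (F (x :: f)) by [].
have e1 : K (x :: y :: t) (fun u v => Dl (F^~ v) u) =
   eps x *: K t (fun u v => F (y :: u) v) - K t (fun u v => F (x * y :: u) v)
   - (K (y :: t) (fun u v => Dl (fun u => F (x :: u) v) u) - eps y *: K t (fun u v => F (x :: u) v)).
  rewrite !K_cons Dl_nil // Dl_1 // Dl_nil // !add0r.
  rewrite -!KZ -!scaleN1r -!KZ -!KD -KZ -KD; apply: eq_K => u v _.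
  by rewrite Dl_cons // !scaleN1r.
have e2 : K (x :: y :: t) (fun u v => sg (size u) (Dl (F u) v)) =
   Dl (F [::]) (x :: y :: t) - K (y :: t) (fun u v => sg (size u) (Dl (F (x :: u)) v)).
  rewrite K_cons /= expr0 scale1r -[in RHS]scaleN1r -KZ; congr (_ + _).
  by apply: eq_K => u v _; rewrite sgS scaleN1r.
have e3 : Dl (fun s => K (x :: s) F) (y :: t) = Dl (fun s => F [::] (x :: s)) (y :: t) +
   (K (y :: t) (fun u v => Dl (fun u => F (x :: u) v) u)
    + K (y :: t) (fun u v => sg (size u) (Dl (F (x :: u)) v))).
  by rewrite (IH (fun u => F (x :: u))) // -DlD; congr (Dl _ _); apply: funext => s; rewrite K_cons.
rewrite e1 e2 (Dl_cons x y t hK) e3 (Dl_cons x y t (h2 [::])) {e1 e2 e3}.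
set p := K _ (fun u v => Dl (fun u => F (x :: u) v) u).
set r := K _ (fun u v => sg (size u) (Dl (F (x :: u)) v)).
rewrite !K_cons !scalerDr.
rewrite !opprD !opprK.
by rewrite [LHS](AC ((2*2)*((2*2)*1)) (((5*1)*(6*2))*((7*(3*9))*(8*4)))).
Qed.

Lemma linear_W1 P (G : B -> B -> P) (F : seq B -> seq B -> P) : bilinear_fun G ->
  (forall x y, F [:: x] [:: y] = G x y) -> linear (fun x => W [:: x] F).
Proof.
move=> hG e a x y.
have E z : W [:: z] F = tlift G (comul D z) by rewrite W1; apply: eq_bigr.
by rewrite !E linearP; exact: tlift_linear.
Qed.

Lemma ml_c P (F : seq B -> seq B -> P) :
  (forall g, ml (F^~ g)) -> (forall f, ml (F f)) -> ml (fun t => c t F).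
Proof.
move=> h1 h2 u v.
have e x : c (u ++ x :: v) F =
   R u (fun a z d g => sg ((size g).+1 * (size v).+1) (F ((a ++ z :: d) ++ x :: v) g))
   + RMid D u x v (fun a z d p y q => F (a ++ z :: d) (p ++ y :: q))
   + R v (fun a z d g => F (u ++ x :: a ++ z :: d) g).
  rewrite /c R_cat; congr (_ + _ + _); apply: eq_R => *; by rewrite -catA.
have l1 : linear (fun x => R u (fun a z d g =>
    sg ((size g).+1 * (size v).+1) (F ((a ++ z :: d) ++ x :: v) g))).
  by apply: linear_R => a z d g; apply: linear_scaler; exact: h1.
have l3 : linear (fun x => R v (fun a z d g => F (u ++ x :: a ++ z :: d) g)).
  by apply: linear_R => a z d g; exact: h1.
have l2 : linear (fun x => RMid D u x v (fun a z d p y q => F (a ++ z :: d) (p ++ y :: q))).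
  apply: sum_linear => -[a b]; apply: sum_linear => -[d d'] /=; apply: linear_scaler.
  apply: sum_linear => -[a1 a2]; apply: sum_linear => -[b1 b2] /=.
  apply: (@linear_W1 _ (fun x y => F (a ++ \prod_(x <- a1 ++ x :: b1) x :: d') (a2 ++ y :: b2))).
    split=> [y|x]; last exact: h2.
    exact: (linear_comp (ml_pi a1 b1) (h1 _ _ _)).
  by move=> x y; rewrite big_seq1.
by move=> a x y; rewrite !e l1 l2 l3 !scalerDr; rewrite [LHS](AC ((2*2)*2) (((1*3)*5)*((2*4)*6))).
Qed.

Lemma comp_K P s (F : seq B -> seq B -> seq B -> P) :
  c s (fun b f => K b (fun g h => F g h f)) =
  K s (fun a h => c a (fun g f => sg ((size f).+1 * size h) (F g h f)))
  + K s (fun g b => c b (fun h f => F g h f)).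
Proof.
transitivity (R s (fun u y w f => K u (fun a b => F a (b ++ y :: w) f)) +
   R s (fun u y w f => K w (fun a b => F (u ++ y :: a) b f))).
  by rewrite -RD; apply: eq_R => u y w f _; exact: K_cat.
rewrite addrC; congr (_ + _).
  rewrite /c /R.
  transitivity (K3 s (fun u v w => K w (fun a h => sg ((size v).+1 * size (a ++ h))
     (J v (fun y f => F (u ++ y :: a) h f))))).
    by apply: eq_K3 => u v w _; rewrite JK -KZ; apply: eq_K => a h e; rewrite e.
  pose G u v a h := sg ((size v).+1 * size (a ++ h)) (J v (fun y f => F (u ++ y :: a) h f)).
  transitivity (K s (fun u r => K3 r (fun v a h => G u v a h))); first by [].
  transitivity (K s (fun r h => K3 r (fun u v a => G u v a h))).
    rewrite [RHS](KA s (fun u r h => K r (fun v a => G u v a h))); apply: eq_K => u r _.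
    by rewrite (KA r (fun v a h => G u v a h)).
  apply: eq_K => r h _; apply: eq_K3 => u v a _.
  rewrite /G size_cat mulnDr -sg_sg; congr (_ *: _); rewrite -JZ; apply: eq_J => y f e.
  by rewrite e.
pose G g u v w := sg ((size v).+1 * size w) (J v (fun y f => F g (u ++ y :: w) f)).
transitivity (K s (fun u r => K u (fun a b => K r (fun v w => G a b v w)))).
  apply: eq_K => u r _; rewrite (KC u r); apply: eq_K => v w _.
  by rewrite JK -KZ.
by rewrite (KA s (fun a b r => K r (fun v w => G a b v w))).
Qed.

Lemma ml4_M P (F : seq B -> seq B -> seq B -> P) : ml3 F ->
  [/\ ml4 (fun m f g h => M m *: F f g h), ml4 (fun f m g h => M m *: F f g h)
    & ml4 (fun f g h m => M m *: F f g h)].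
Proof.
by case=> h1 h2 h3; split; split=> a b d; (apply: ml_scale ml_M || (apply: ml_scaler; done)).
Qed.

Lemma b2_comp_homotopy P s (F : seq B -> seq B -> seq B -> P) : ml3 F ->
  c s (fun f b => K b (fun g h => F f g h)) - K s (fun a h => c a (fun f g => F f g h))
  - K s (fun g b => c b (fun f h => sg (size g * (size f).+1) (F f g h))) =
  b2 s (fun f g h => sg (size f + size g) (Dl (fun t => F t g h) f))
  + b2 s (fun f g h => sg (size g).+1 (Dl (fun t => F f t h) g))
  - b2 s (fun f g h => Dl (F f g) h)
  + Dl (fun t => b2 t (fun f g h => sg (size f + size g) (F f g h))) s.
Proof.
move=> hF; have [h1 h2 h3] := hF.
pose S (nu : nat -> nat -> nat -> nat) f g h := sg (nu (size f) (size g) (size h)) (F f g h).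
have hS nu : ml3 (S nu).
  split=> a b; [exact: (ml_sg (fun n => nu n (size a) (size b)))
   | exact: (ml_sg (fun n => nu (size a) n (size b)))
   | exact: (ml_sg (fun n => nu (size a) (size b) n))].
pose nf := fun f g h : nat => (f + g)%N.
pose nf1 := fun f g h : nat => (f + g).+1%N.
pose n0 := fun f g h : nat => 0%N.
pose ng := fun f g h : nat => g.
pose ng1 := fun f g h : nat => g.+1.
pose nh := fun f g h : nat => h.
pose N1 := b2 s (fun f b h => c b (fun m g => M m *: S ng f g h)).
pose N2 := b2 s (fun f b h => c b (fun g m => M m *: S n0 f g h)).
pose N3 := b2 s (fun f g b => c b (fun m h => M m *: S n0 f g h)).
pose N4 := b2 s (fun f g b => c b (fun h m => M m *: S nh f g h)).
pose Q1 := b3 s (fun f m g h => M m *: S ng f g h).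
pose Q2 := b3 s (fun f g m h => M m *: S n0 f g h).
pose Q3 := b3 s (fun f g h m => M m *: S nh f g h).
pose S0 := c s (fun m b => b2 b (fun f g h => M m *: S nf f g h)).
pose U0 := c s (fun f b => K b (fun g h => F f g h)).
pose U1 := K s (fun a h => c a (fun f g => F f g h)).
pose U2 := K s (fun g b => c b (fun f h => sg (size g * (size f).+1) (F f g h))).
have T3a : b2 s (fun f g h => sg (size f + size g) (Dl (fun t => F t g h) f)) =
    (- S0 - U1 - U2) + (- Q1 + Q2 - Q3 - N1 + N3 + U0).
  pose nu1 := fun f g h : nat => (f + g).+1%N.
  have [l1 _ _] := ml4_M (hS nu1).
  have [_ l2 _] := ml4_M (hS ng1).
  transitivity (b2 s (fun a g h => c a (fun m f => M m *: S nu1 f g h)) +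
     b2 s (fun a g h => c a (fun f m => M m *: S ng1 f g h))).
    rewrite -b2D; apply: eq_b2 => a g h _; rewrite /Dl scalerDr -!cZ.
    congr (_ + _); apply: eq_c => x1 x2 e; rewrite ?sg_sg sgM /S; apply: M_sg => em;
      rewrite em in e; rewrite /nu1 /ng1; lia.
  rewrite (comp_brace D s l1) (comp_brace D s l2).
  congr (_ + _).
    transitivity (0 + 0 + 0 + - U1 + - U2 + - S0); last first.
      by rewrite !add0r addrC addrA.
    congr (_ + _ + _ + _ + _ + _).
    - exact: brace3_M.
    - rewrite -[RHS](brace3_M s (fun m g f h => sg ((size f).+1 * (size g).+1) (S nu1 f g h))).
      by apply: eq_b3 => m g f h; rewrite sgM.
    - rewrite -[RHS](brace3_M s (fun m g h f => sg ((size f).+1 * (size g + size h)) (S nu1 f g h))).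
      by apply: eq_b3 => m g h f; rewrite sgM.
    - transitivity (b2 s (fun m b h => M m *: c b (fun f g => S nu1 f g h))).
        by apply: eq_b2 => m b h _; rewrite -cZ.
      rewrite brace_M => [|h|b].
      + rewrite -scaleN1r -KZ; apply: eq_K => b h _; rewrite -!cZ; apply: eq_c => f g e.
        by rewrite scaleN1r -sg1 /S sg_sg /nu1; apply: sg_odd; lia.
      + by apply: ml_c => a; [exact: (ml_sg (fun n => (n + size a).+1)) | exact: (ml_sg (fun n => (size a + n).+1))].
      + by move=> u v; apply: linear_R => *; exact: (ml_sg (fun n => _)).
    - transitivity (b2 s (fun m g b => M m *: c b (fun f h => sg ((size f).+1 * (size g).+1) (S nu1 f g h)))).
        apply: eq_b2 => m g b _; rewrite -cZ; apply: eq_c => f h _.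
        by rewrite sgM.
      rewrite (brace_M s (F := fun g b => c b (fun f h => sg ((size f).+1 * (size g).+1) (S nu1 f g h)))) => [|b|g].
      + rewrite -scaleN1r -KZ; apply: eq_K => g b _; rewrite -!cZ; apply: eq_c => f h e.
        by rewrite scaleN1r -sg1 /S !sg_sg /nu1; parity.
      + have [_ q _] := hS nu1; move=> u v; apply: linear_R => u' y w' h.
        exact: (ml_sg (fun n => (size (u' ++ y :: w')).+1 * n.+1)%N (q _ _) u v).
      + have [q _ q'] := hS nu1; apply: ml_c => a; last exact: ml_scaler.
        exact: (ml_sg (fun n => n.+1 * (size g).+1)%N (q _ _)).
    - rewrite -scaleN1r -cZ; apply: eq_c => m b _; rewrite -b2Z; apply: eq_b2 => f g h _.
      by rewrite [RHS]scaleN1r -sg1 sgM /S sg_sg.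
  transitivity (- Q1 + Q2 + - Q3 + - N1 + N3 + U0); last by [].
  congr (_ + _ + _ + _ + _ + _).
  - rewrite -scaleN1r -b3Z; apply: eq_b3 => f m g h.
    by rewrite scaleN1r -sg1 sgM /S sg_sg.
  - apply: eq_b3 => f g m h; rewrite sgM /S sg_sg; apply: M_sg => ->; rewrite /ng1 /n0; lia.
  - rewrite -scaleN1r -b3Z; apply: eq_b3 => f g h m.
    rewrite sgM scaleN1r -sg1 sgM /S !sg_sg; apply: M_sg => ->; rewrite /ng1 /nh; lia.
  - rewrite -scaleN1r -b2Z; apply: eq_b2 => f b h _; rewrite -cZ; apply: eq_c => m g _.
    by rewrite scaleN1r -sg1 sgM /S sg_sg.
  - apply: eq_b2 => f g b _; apply: eq_c => m h _.
    rewrite sgM /S sg_sg; apply: M_sg => ->; rewrite /ng1 /n0; lia.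
  apply: eq_c => f b _; rewrite brace_M => [|h|g].
  - apply: eq_K => g h _; rewrite /S sg_sg -[RHS]scale1r -[1](expr0 (-1)).
    by apply: sg_odd; rewrite /ng1; lia.
  - by have [_ q _] := hS ng1; exact: q.
  - by have [_ _ q] := hS ng1; exact: q.
have T3b : b2 s (fun f g h => sg (size g).+1 (Dl (fun t => F f t h) g)) = N1 + N2.
  rewrite -b2D; apply: eq_b2 => f b h _; rewrite /Dl scalerDr -!cZ.
  congr (_ + _); apply: eq_c => x1 x2 e; rewrite ?sg_sg sgM /S; apply: M_sg => em;
    rewrite em in e; rewrite /ng /n0; lia.
have T3c : b2 s (fun f g h => Dl (F f g) h) = N3 + N4.
  rewrite -b2D; apply: eq_b2 => f g b _; rewrite /Dl -!cZ.
  congr (_ + _); apply: eq_c => x1 x2 e; rewrite ?sgM /S; last apply: M_sg => em;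
    rewrite ?expr0 ?scale1r //.
  rewrite em in e; rewrite /nh; lia.
have T4 : Dl (fun t => b2 t (fun f g h => sg (size f + size g) (F f g h))) s =
    S0 + (Q3 - Q2 + Q1 + N4 - N2).
  have [_ _ l3] := ml4_M (hS nh).
  rewrite /Dl; congr (_ + _).
    apply: eq_c => m b _; rewrite -b2Z; exact: eq_b2.
  transitivity (c s (fun a m => b2 a (fun f g h => M m *: S nh f g h))).
    rewrite -cZ; apply: eq_c => a m e; rewrite -!b2Z; apply: eq_b2 => f g h e2.
    rewrite sgM sg_sg; apply: M_sg => em; rewrite em in e; rewrite /nh; lia.
  rewrite (brace_comp D s l3).
  transitivity (Q3 + - Q2 + Q1 + N4 + - N2); last by [].
  congr (_ + _ + _ + _ + _).
  - rewrite -scaleN1r -b3Z; apply: eq_b3 => f g m h.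
    rewrite sgM scaleN1r -sg1 sgM /S !sg_sg; apply: M_sg => ->; rewrite /n0 /nh; lia.
  - apply: eq_b3 => f m g h.
    rewrite sgM /S !sg_sg; apply: M_sg => ->; rewrite /ng /nh; lia.
  rewrite -scaleN1r -b2Z; apply: eq_b2 => f b h _; rewrite -cZ; apply: eq_c => g m _.
  rewrite sgM scaleN1r -sg1 sgM /S !sg_sg; apply: M_sg => ->; rewrite /n0 /nh; lia.
rewrite T3a T3b T3c T4 -/U0 -/U1 -/U2 opprD.
rewrite [RHS](AC (3*6*2*2*(1*5))
  ((9*2*3)*(1*14)*(4*17)*(5*16)*(6*15)*(7*10)*(8*12)*(11*19)*(13*18))) /=.
by rewrite !addNr !subrr !addr0.
Qed.

End Diff.

(** * The bar complex on elementary tensors *)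

Section TensorLinear.
Variable k : comNzRingType.
Implicit Types M N P Q : lmodType k.

Lemma pure_linl M N (y : N) : linear (fun x : M => x \tens y).
Proof. by case: (@tpure_bilinear k M N) => h _; exact: h. Qed.
Lemma pure_linr M N (x : M) : linear (fun y : N => x \tens y).
Proof. by case: (@tpure_bilinear k M N) => _ h; exact: h. Qed.

Lemma tmap_bilinear M N P Q (f : M -> P) (g : N -> Q) : linear f -> linear g ->
  bilinear_fun (fun x y => f x \tens g y).
Proof.
move=> hf hg; split=> [y|x].
  exact: (linear_comp (g := fun z => z \tens g y) hf (pure_linl _)).
exact: (linear_comp (g := fun z => f x \tens z) hg (pure_linr _)).
Qed.

Lemma tmap_pure M N P Q (f : M -> P) (g : N -> Q) x y : linear f -> linear g ->
  tmap f g (x \tens y) = f x \tens g y.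
Proof. by move=> hf hg; apply: tlift_pure; exact: tmap_bilinear. Qed.

Lemma linear_id M : linear (id : M -> M). Proof. by []. Qed.

Lemma linear_sub M N (f g : M -> N) : linear f -> linear g -> linear (fun x => f x - g x).
Proof. by move=> hf hg a x y; rewrite hf hg opprD addrACA scalerBr. Qed.
Lemma linear_add M N (f g : M -> N) : linear f -> linear g -> linear (fun x => f x + g x).
Proof. by move=> hf hg a x y; rewrite hf hg addrACA scalerDr. Qed.
Lemma linear_zero M N : linear (fun _ : M => 0 : N).
Proof. by move=> a x y; rewrite scaler0 addr0. Qed.
Lemma linear_0 M N (f : M -> N) : linear f -> f 0 = 0.
Proof. by move=> hf; rewrite -(scale0r 0) (linear_Z hf) scale0r. Qed.
Lemma linear_B M N (f : M -> N) x y : linear f -> f (x - y) = f x - f y.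
Proof.
move=> hf; pose f' : {linear M -> N} := HB.pack f (GRing.isLinear.Build _ _ _ _ _ hf).
exact: (raddfB f').
Qed.
Lemma linear_D M N (f : M -> N) x y : linear f -> f (x + y) = f x + f y.
Proof. by move=> hf; have := hf 1 x y; rewrite !scale1r. Qed.

Lemma tswap_linear M N : linear (@tswap k M N).
Proof.
by apply: tlift_linear; split=> [y|x]; [exact: pure_linr | exact: pure_linl].
Qed.
Lemma tswap_pure M N (x : M) (y : N) : tswap (x \tens y) = y \tens x.
Proof. by apply: tlift_pure; split=> [z|z]; [exact: pure_linr | exact: pure_linl]. Qed.

Lemma tassoc_pure M N P (x : M) (y : N) (z : P) :
  tassoc (x \tens y \tens z) = x \tens (y \tens z).
Proof.
rewrite /tassoc tlift_pure; last exact: tassoc_bilinear.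
apply: tlift_pure; split=> [u|u]; first exact: pure_linl.
exact: (linear_comp (pure_linl z) (pure_linr u)).
Qed.

Lemma tassocV_bilinear M N P :
  bilinear_fun (fun (x : M) (t : N \ox P) => tlift (fun y z => x \tens y \tens z) t).
Proof.
split=> [t|x].
  apply: sum_linear => -[y z] /=.
  exact: (linear_comp (pure_linl y) (pure_linl z)).
apply: tlift_linear; split=> [z|y]; last exact: pure_linr.
exact: (linear_comp (pure_linr x) (pure_linl z)).
Qed.
Lemma tassocV_linear M N P : linear (@tassocV k M N P).
Proof. exact: tlift_linear (tassocV_bilinear _ _ _). Qed.
Lemma tassocV_pure M N P (x : M) (y : N) (z : P) :
  tassocV (x \tens (y \tens z)) = x \tens y \tens z.
Proof.
rewrite /tassocV tlift_pure; last exact: tassocV_bilinear.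
apply: tlift_pure; split=> [u|u]; last exact: pure_linr.
exact: (linear_comp (pure_linr x) (pure_linl u)).
Qed.

Lemma flip_rho_linear (V : nat -> lmodType k) p q : linear (@flip_rho k V p q).
Proof. by apply: linear_scaler; exact: tswap_linear. Qed.
Lemma flip_varrho_linear (V : nat -> lmodType k) p q : linear (@flip_varrho k V p q).
Proof. by apply: linear_scaler; exact: tswap_linear. Qed.
Lemma flip_tau_linear (V : nat -> lmodType k) p q : linear (@flip_tau k V p q).
Proof. by apply: linear_scaler; exact: tswap_linear. Qed.

Lemma tensor_ext M N P (f g : M \ox N -> P) : linear f -> linear g ->
  (forall x y, f (x \tens y) = g (x \tens y)) -> forall t, f t = g t.
Proof.
move=> hf hg h t; rewrite [t]tensor_pureE !(linear_bigsum hf) !(linear_bigsum hg).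
by apply: eq_bigr => -[x y] _; exact: h.
Qed.

Lemma gcast_linear (V : nat -> lmodType k) n m : linear (@gcast k V n m).
Proof.
rewrite /gcast; case: eqP => [e|_]; last exact: linear_zero.
by subst m.
Qed.

End TensorLinear.

Section Bridge.
Variables (k : comNzRingType) (B : algType k) (D : bialgebra B).
Implicit Types (P Q : lmodType k) (s t u v w f g h : seq B) (x y : B).
Local Notation sg n x := (((-1) ^+ n : k) *: x).
Local Notation J := (J D).
Local Notation W := (W D).
Local Notation R := (R D).
Local Notation c := (c D).
Local Notation b2 := (b2 D).
Local Notation M := (M D).
Local Notation Dl := (Dl D).
Local Notation eps := (counit D).
Local Notation tpow := (tpow B).

(* The elementary tensor with entries [s]; zero unless [s] has length [n]. *)
Fixpoint cp n s : tpow n :=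
  match n, s with
  | 0, [::] => (1 : k^o)
  | 0, _ :: _ => (0 : k^o)
  | n.+1, [::] => 0
  | n.+1, x :: s' => x \tens cp n s'
  end.

Lemma ml_cp n : ml (cp n).
Proof.
elim: n => [|n IH] [|z u] v //=.
- by move=> a x y; rewrite scaler0 addr0.
- by move=> a x y; rewrite scaler0 addr0.
- exact: pure_linl.
- exact: (linear_comp (IH u v) (pure_linr z)).
Qed.

Lemma cp_size n s : size s != n -> cp n s = 0.
Proof.
elim: n s => [|n IH] [|x s] //= e.
by rewrite IH //; exact: linear_0 (pure_linr x).
Qed.

Fixpoint ulift P n (F : seq B -> P) : tpow n -> P :=
  match n with
  | 0 => fun a : k^o => (a : k) *: F [::]
  | n.+1 => tlift (fun (x : B) (t : tpow n) => ulift (fun s => F (x :: s)) t)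
  end.

Lemma ulift_comb P n a (F G : seq B -> P) (t : tpow n) :
  ulift (n := n) (fun s => a *: F s + G s) t = a *: ulift F t + ulift G t.
Proof.
elim: n F G t => [|n IH] F G t /=; first by rewrite scalerDr !scalerA mulrC.
rewrite /tlift /tsum scaler_sumr -big_split; apply: eq_bigr => -[x t'] _ /=.
exact: IH.
Qed.

Lemma ulift_linear P n (F : seq B -> P) : ml F -> linear (ulift (n := n) F).
Proof.
elim: n F => [|n IH] F hF; first by move=> a b d /=; rewrite scalerDl scalerA.
apply: tlift_linear; split=> [t a x y|x]; last by apply: IH => u v; exact: (hF (x :: u) v).
rewrite -ulift_comb; congr (ulift _ _); apply: funext => s.
exact: (hF [::] s).
Qed.

Lemma ulift_cp P n (F : seq B -> P) s : ml F -> size s = n -> ulift F (cp n s) = F s.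
Proof.
elim: n s F => [|n IH] [|x s] F hF //= e; first by rewrite scale1r.
have hx z : ml (fun s => F (z :: s)) by move=> u v; exact: (hF (z :: u) v).
rewrite tlift_pure ?IH //; first by case: e.
split=> [t a y z|y]; last exact: ulift_linear.
by rewrite -ulift_comb; congr (ulift _ _); apply: funext => s'; exact: (hF [::] s').
Qed.

Lemma tpow_ext P n (f g : tpow n -> P) : linear f -> linear g ->
  (forall s, size s = n -> f (cp n s) = g (cp n s)) -> forall z, f z = g z.
Proof.
elim: n f g => [|n IH] f g hf hg h t.
  have e : t = (t : k) *: (cp 0 [::] : k^o) by rewrite /= [RHS]mulr1.
  by rewrite e !linear_Z // h.
apply: tensor_ext => // x.
apply: IH; [exact: (linear_comp (pure_linr x) hf) | exact: (linear_comp (pure_linr x) hg)|].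
by move=> s e; apply: (h (x :: s)); rewrite /= e.
Qed.

Lemma gcast_cp n m s : size s = n -> gcast m (cp n s) = cp m s.
Proof.
move=> e; rewrite /gcast; case: eqP => [e'|ne]; first by subst m.
by rewrite cp_size //; apply/eqP; rewrite e.
Qed.

Lemma mul_linear (x : B) : linear (fun y => x * y).
Proof. by move=> a y z; rewrite mulrDr scalerAr. Qed.

Lemma decomp1_bilinear q r (L : tpow (q + r) -> tpow r.+1 \ox tpow q) : linear L ->
  bilinear_fun (fun (x : B) (t : tpow (q + r)) =>
      tlift (fun a b => tmap (tmap ( *%R a) id) (fun v : tpow q => b \tens v) (L t)) (comul D x)
      : tpow r.+1 \ox tpow q.+1).
Proof.
move=> hL; split=> [t|x].
  apply: (linear_comp (f := comul D)); first exact: linearP.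
  apply: tlift_linear; split=> [b|a].
    apply: sum_linear => -[u v] /=.
    apply: (linear_comp (g := fun z => z \tens (b \tens v))); last exact: pure_linl.
    apply: sum_linear => -[y w] /=.
    apply: (linear_comp (g := fun z => z \tens w)); last exact: pure_linl.
    exact: linear_mulr.
  apply: sum_linear => -[u v] /=.
  exact: (linear_comp (pure_linl v) (pure_linr _)).
apply: sum_linear => -[a b] /=; apply: (linear_comp hL).
apply: tmap_linear; last exact: pure_linr.
by apply: tmap_linear => //; exact: mul_linear.
Qed.

Lemma decomp1_linear q r : linear (@decomp1 k B D q r).
Proof.
elim: q => [|q IH]; last exact: tlift_linear (decomp1_bilinear IH).
exact: (linear_comp (pure_linr _) (pure_linl _)).
Qed.

Lemma decomp1_cp q r v w : size v = q ->
  @decomp1 k B D q r (cp (q + r) (v ++ w)) = J v (fun y g => cp r.+1 (y :: w) \tens cp q g).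
Proof.
elim: q v => [|q IH] [|x v] //= e; first by rewrite /J W_nil big_nil.
rewrite tlift_pure; last exact: decomp1_bilinear (@decomp1_linear q r).
rewrite IH; last by case: e.
rewrite /J W_cons W1; apply: eq_bigr => -[a b] _ /=.
have h1 : linear (tmap ( *%R a) (id : tpow r -> tpow r)) by apply: tmap_linear => //; exact: mul_linear.
rewrite (W_lin D (tmap_linear h1 (pure_linr b))); apply: eq_W => v1 v2 _ _.
rewrite tmap_pure //; last exact: pure_linr.
by rewrite tmap_pure ?big_cons //; exact: mul_linear.
Qed.

Lemma decomp0_bilinear i q r (L : tpow (i + (q + r)) -> tpow (i + r.+1) \ox tpow q) : linear L ->
  bilinear_fun (fun (x : B) (t : tpow (i + (q + r))) =>
      tmap (fun u : tpow (i + r.+1) => x \tens u) id (L t) : tpow (i + r.+1).+1 \ox tpow q).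
Proof.
move=> hL; split=> [t|x].
  apply: sum_linear => -[u v] /=.
  exact: (linear_comp (pure_linl u) (pure_linl v)).
by apply: (linear_comp hL); apply: tmap_linear => //; exact: pure_linr.
Qed.

Lemma decomp0_linear i q r : linear (@decomp0 k B D i q r).
Proof.
elim: i => [|i IH]; first exact: (@decomp1_linear q r).
exact: tlift_linear (decomp0_bilinear IH).
Qed.

Lemma decomp0_cp i q r u v w : size u = i -> size v = q ->
  @decomp0 k B D i q r (cp (i + (q + r)) (u ++ v ++ w)) =
  J v (fun y g => cp (i + r.+1) (u ++ y :: w) \tens cp q g).
Proof.
elim: i u => [|i IH] [|x u] //= e ev; first exact: decomp1_cp.
rewrite tlift_pure; last exact: decomp0_bilinear (@decomp0_linear i q r).
rewrite IH //; last by case: e.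
rewrite (W_lin D (tmap_linear (pure_linr x) (@linear_id _ _))); apply: eq_W => v1 v2 _ _.
by rewrite tmap_pure //; exact: pure_linr.
Qed.

Lemma decomp_linear n p q i : linear (@decomp k B D n p q i).
Proof.
apply: (linear_comp (f := fun x : tpow n => @decomp0 k B D i.-1 q (p - i) (gcast _ x))).
  by apply: (linear_comp (@gcast_linear _ _ _ _)); exact: decomp0_linear.
by apply: tmap_linear => //; exact: gcast_linear.
Qed.

Lemma decomp_cp n p q i u v w : size (u ++ v ++ w) = n -> (i = (size u).+1)%N ->
  size v = q -> decomp D p q i (cp n (u ++ v ++ w)) =
  J v (fun y g => cp p (u ++ y :: w) \tens cp q g).
Proof.
move=> e -> <-; rewrite /decomp /= gcast_cp // -?e; set r := (p - _)%N.
case: (eqVneq (size w) r) => ew; last first.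
  rewrite cp_size; last by rewrite !size_cat; lia.
  rewrite (linear_0 (@decomp0_linear _ _ _)) (linear_0 (tmap_linear _ _)) //; last exact: gcast_linear.
  rewrite /J /W big1 // => z _; rewrite cp_size; first exact: linear_0 (pure_linl _).
  by rewrite size_cat /=; apply/eqP => h; move: ew; rewrite /r -h; lia.
rewrite decomp0_cp // (W_lin D (tmap_linear (@gcast_linear _ _ _ _) (@linear_id _ _))).
apply: eq_W => v1 v2 _ _; rewrite tmap_pure //; last exact: gcast_linear.
by rewrite gcast_cp // size_cat /= ew.
Qed.

Lemma decomp_deg n p q i (z : tpow n) : (p + q)%N != n.+1 -> (0 < i <= p)%N -> decomp D p q i z = 0.
Proof.
move=> e hi; rewrite /decomp (_ : gcast _ z = 0); last first.
  by rewrite /gcast; case: eqP => // e'; exfalso; move: e; lia.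
by rewrite (linear_0 (@decomp0_linear _ _ _)); apply: linear_0; apply: tmap_linear => //; exact: gcast_linear.
Qed.

Lemma K_iota P s (F : seq B -> seq B -> P) :
  K s F = \sum_(0 <= i < (size s).+1) F (take i s) (drop i s).
Proof.
elim: s F => [|x s IH] F; first by rewrite K_nil big_nat1.
by rewrite K_cons big_nat_recl //= IH.
Qed.

Lemma K_pick P s q (F : seq B -> seq B -> P) :
  (forall u v, size u != q -> F u v = 0) ->
  K s F = if (q <= size s)%N then F (take q s) (drop q s) else 0.
Proof.
elim: s q F => [|x s IH] [|q] F h.
- by rewrite K_nil.
- by rewrite K_nil h.
- by rewrite K_l0 // => -[|y u] v // _; rewrite h.
by rewrite K_cons h // add0r (IH q) // => u v hu; apply: h.
Qed.

Arguments cp : simpl never.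

Lemma circ_cp n p q s : size s = n ->
  bar_circ D p q (cp n s) = c s (fun f g => cp p f \tens cp q g).
Proof.
move=> en; have z0 f g : (size f != p) || (size g != q) -> cp p f \tens cp q g = 0.
  case/orP => e; first by rewrite (cp_size e); exact: linear_0 (pure_linl _).
  by rewrite (cp_size e); exact: linear_0 (pure_linr _).
have c0 (F : seq B -> seq B -> tpow p \ox tpow q) :
    (forall f g, (0 < size f)%N -> (size f + size g = (size s).+1)%N -> F f g = 0) -> c s F = 0.
  by move=> h; rewrite (eq_c_pos D (G := fun f g => 0 *: F f g)) ?cZ ?scale0r // => f g ? ?; rewrite h // scaler0.
case: (eqVneq (p + q)%N n.+1) => e; last first.
  rewrite c0; last first.
    move=> f g _ e2; rewrite z0 //; apply/norP => -[/negbNE/eqP e3 /negbNE/eqP e4].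
    by move: e; rewrite -e3 -e4 e2 en eqxx.
  rewrite /bar_circ big_nat big1 // => i hi; rewrite decomp_deg ?scaler0 //.
case: p => [|p] in z0 c0 e *.
  rewrite c0 /bar_circ ?big_geq // => f g f0 _; rewrite z0 //; case: f f0 => //.
rewrite /bar_circ big_add1 /= /c /R /K3 K_iota en.
pose G i := sg (q.+1 * (p - i)) (J (take q (drop i s))
   (fun y g => cp p.+1 (take i s ++ y :: drop (i + q) s) \tens cp q g)).
transitivity (\sum_(0 <= i < p.+1) G i).
  apply: eq_big_nat => i hi; rewrite subSS /G; congr (_ *: _).
  have sv : size (take q (drop i s)) = q by rewrite size_takel // size_drop; lia.
  have es : s = take i s ++ take q (drop i s) ++ drop (i + q) s.
    by rewrite addnC -drop_drop !cat_take_drop.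
  have su : size (take i s) = i by rewrite size_takel //; lia.
  by rewrite [X in cp n X]es decomp_cp -?es //; rewrite su.
transitivity (\sum_(0 <= i < n.+1) if (i < p.+1)%N then G i else 0).
  by rewrite -big_mkcond /= [LHS](big_nat_widen _ _ n.+1) //; lia.
apply: eq_big_nat => i hi; rewrite (@K_pick _ _ q); last first.
  move=> v w hv; rewrite -[RHS](scaler0 _ ((-1) ^+ ((size v).+1 * size w))); congr (_ *: _).
  rewrite -[RHS](scale0r (J v (fun _ _ => 0))) -JZ; apply: eq_J => y g eg.
  by rewrite z0 ?scaler0 // eg hv orbT.
rewrite size_drop en (_ : (q <= n - i)%N = (i < p.+1)%N); last by lia.
case: ifP => // hi'; rewrite /G drop_drop [(q + i)%N]addnC; congr (_ *: _).
by rewrite size_takel ?size_drop en; [congr (_ ^+ (_ * _)); lia | lia].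
Qed.

Lemma mu_bilinear x : bilinear_fun (fun (y : B) (a : k^o) => a * eps (x * y) : k^o).
Proof.
split=> [a|y] d u v /=; last by rewrite mulrDl scalerAl.
by rewrite mulrDr -scalerAr linearP mulrDr -scalerAr.
Qed.

Lemma mu_bilinear2 :
  bilinear_fun (fun (x : B) (t : tpow 1) => tlift (fun (y : B) (a : k^o) => a * eps (x * y) : k^o) t).
Proof.
split=> [t|x]; last exact: tlift_linear (mu_bilinear x).
apply: sum_linear => -[y a] /= d u v.
by rewrite mulrDl -scalerAl linearP mulrDr -scalerAr.
Qed.

Lemma mu_linear : linear (mu_c D).
Proof. exact: tlift_linear mu_bilinear2. Qed.

Lemma mu_cp x y : mu_c D (cp 2 [:: x; y]) = eps (x * y).
Proof.
rewrite -[cp 2 _]/(x \tens (y \tens (1 : k^o) : tpow 1)) /mu_c.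
rewrite tlift_pure; last exact: mu_bilinear2.
rewrite tlift_pure; last exact: mu_bilinear.
by rewrite mul1r.
Qed.

Definition cup_inner p (y : tpow p.+1) : tpow p :=
  tlift (fun (u : tpow 2) (v : tpow p) => (mu_c D u : k) *: v) (decomp D 2 p 1 y).

Lemma cup_inner_bilinear p : bilinear_fun (fun (u : tpow 2) (v : tpow p) => (mu_c D u : k) *: v).
Proof.
split=> [v|u]; last exact: scale_lin.
by move=> a x y; rewrite mu_linear scalerDl -scalerA.
Qed.

Lemma cup_inner_linear p : linear (@cup_inner p).
Proof.
apply: (linear_comp (@decomp_linear _ _ _ _)); exact: tlift_linear (@cup_inner_bilinear p).
Qed.

Lemma cup_inner_cp p u y : size u = p -> cup_inner (cp p.+1 (rcons u y)) = eps y *: cp p u.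
Proof.
move=> e; rewrite /cup_inner -cats1 -[u ++ _]/([::] ++ u ++ [:: y]) decomp_cp /= ?size_cat ?e ?addn1 //.
rewrite (W_lin D (tlift_linear (@cup_inner_bilinear p))).
transitivity (W u (fun a b => eps (\prod_(x <- a) x) *: (eps y *: cp p b))).
  apply: eq_W => a b _ _; rewrite tlift_pure; last exact: cup_inner_bilinear.
  by rewrite mu_cp counitM scalerA.
by rewrite (W_counitl D u (F := fun b => eps y *: cp p b)) //; apply: ml_scaler; exact: ml_cp.
Qed.

Lemma cup_cp n p q s : size s = n ->
  bar_cup D p q (cp n s) = K s (fun f g => cp p f \tens cp q g).
Proof.
move=> en; rewrite (@K_pick _ _ p); last first.
  by move=> f g hf; rewrite cp_size //; exact: linear_0 (pure_linl _).
have tl : linear (tmap (@cup_inner p) (id : tpow q -> tpow q)).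
  by apply: tmap_linear => //; exact: cup_inner_linear.
rewrite /bar_cup -/(tmap (@cup_inner p) id _).
case: (eqVneq (p + q)%N n) => e; last first.
  rewrite decomp_deg; [|by rewrite addSn eqSS | by rewrite /= leqnn].
  rewrite (linear_0 tl); case: ifP => // hp; rewrite [cp q _]cp_size.
    by rewrite (linear_0 (pure_linr _)).
  by rewrite size_drop en; lia.
have -> : (p <= size s)%N by lia.
have e1 : size (take p s) = p by rewrite size_takel //; lia.
rewrite -{1}(cat_take_drop p s) -[drop p s]cats0 decomp_cp; last first.
- by rewrite size_drop; lia.
- by rewrite e1.
- by rewrite cats0 cat_take_drop.
rewrite (W_lin D tl) cats0.
transitivity (W (drop p s) (fun a b => (eps (\prod_(x <- a) x) : k) *: (cp p (take p s) \tens cp q b))).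
  apply: eq_W => a b _ _; rewrite tmap_pure //; last exact: cup_inner_linear.
  rewrite cats1 cup_inner_cp //.
  exact: (linear_Z (f := fun z : tpow p => z \tens cp q b) (pure_linl _)).
rewrite (W_counitl D _ (F := fun b => cp p (take p s) \tens cp q b)) // => u v.
exact: (linear_comp (@ml_cp q u v) (pure_linr _)).
Qed.

Lemma Dl_size P n (F : seq B -> P) s :
  (forall t, size t != n -> F t = 0) -> size s != n.+1 -> Dl F s = 0.
Proof.
move=> h e.
have z (G : seq B -> seq B -> P) :
    (forall f g, (0 < size f)%N -> (size f + size g = (size s).+1)%N -> G f g = 0) -> c s G = 0.
  by move=> hG; rewrite (eq_c_pos D (G := fun f g => 0 *: G f g)) ?cZ ?scale0r // => f g ? ?; rewrite hG // scaler0.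
rewrite /Dl !z ?scaler0 ?addr0 //.
- move=> f m _ em; case: (eqVneq (size m) 2) => [em2|em2]; last by rewrite M_size.
  by rewrite h ?scaler0 //; apply/eqP => ef; move: e; rewrite em2 in em; lia.
- move=> m f _ em; case: (eqVneq (size m) 2) => [em2|em2]; last by rewrite M_size.
  by rewrite h ?scaler0 //; apply/eqP => ef; move: e; rewrite em2 in em; lia.
Qed.

Lemma eq_Dl P (F G : seq B -> P) s :
  (forall t, (size t).+1 = size s -> F t = G t) -> Dl F s = Dl G s.
Proof.
move=> h; rewrite /Dl; congr (_ + _ *: _); apply: eq_c => x1 x2 e.
- case: (eqVneq (size x1) 2) => em; last by rewrite !(M_size D _ em).
  by rewrite h //; lia.
- case: (eqVneq (size x2) 2) => em; last by rewrite !(M_size D _ em).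
  by rewrite h //; lia.
Qed.

Lemma face0_cons n x s : face D 0 (cp n.+1 (x :: s)) = eps x *: cp n s.
Proof.
have -> : cp n.+1 (x :: s) = x \tens cp n s by [].
have b : bilinear_fun (fun (x : B) (t : tpow n) => (eps x : k) *: t).
  by split=> [t|y]; [move=> a y z; rewrite linearP scalerDl -scalerA | exact: scale_lin].
by case: n b => [|n] b; rewrite /= tlift_pure.
Qed.

Lemma face1_cons n x y s : face D 1 (cp n.+2 (x :: y :: s)) = cp n.+1 (x * y :: s).
Proof.
have -> : cp n.+2 (x :: y :: s) = x \tens (y \tens cp n s : tpow n.+1) by [].
have bil (x' : B) : bilinear_fun (fun (y : B) (t : tpow n) => (x' * y) \tens t).
  split=> [t|y']; last exact: pure_linr.
  exact: (linear_comp (mul_linear x') (pure_linl t)).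
rewrite /= /merge2 tlift_pure; first by rewrite tlift_pure.
split=> [t|x']; last exact: tlift_linear (bil x').
by apply: sum_linear => -[y' t'] /=; exact: (linear_comp (linear_mulr y') (pure_linl t')).
Qed.

Lemma faceS_cons n i x s :
  face D i.+2 (cp n.+2 (x :: s)) = x \tens face D i.+1 (cp n.+1 s).
Proof.
have -> : cp n.+2 (x :: s) = x \tens cp n.+1 s by [].
rewrite /= tlift_pure //; split=> [t|y]; first exact: pure_linl.
exact: (linear_comp (@face_linear _ _ D n i.+1) (pure_linr y)).
Qed.

Lemma diff_cp n s : bar_diff D n (cp n.+1 s) = Dl (cp n) s.
Proof.
case: (eqVneq (size s) n.+1) => e; last first.
  rewrite cp_size // raddf0.
  by rewrite (Dl_size (n := n)) //; exact: cp_size.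
rewrite /bar_diff /=; elim: n s e => [|n IH] [|x [|y s]] // e.
  rewrite Dl_1; last exact: ml_cp.
  rewrite /bar_fun !big_ord_recl big_ord0 /= addr0 expr0 scale1r expr1 scaleN1r.
  exact: subrr.
rewrite Dl_cons; last exact: ml_cp.
have := IH (y :: s); rewrite /bar_fun => /(_ _) IH'.
rewrite big_ord_recl big_ord_recl face0_cons expr0 scale1r.
rewrite -[face D _ _]/(face D 1 _) face1_cons expr1 scaleN1r.
rewrite addrA; congr (_ + _).
rewrite -(Dl_lin D (pure_linr x)) -IH'; last by case: e => /= ->.
rewrite [in RHS]big_ord_recl face0_cons expr0 scale1r (linear_D _ _ (pure_linr x)).
rewrite (linear_Z (f := fun z : tpow n => x \tens z) (pure_linr x)) -[cp n.+1 (x :: s)]/(x \tens cp n s).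
rewrite addrAC subrr add0r (linear_bigsum (pure_linr x)) -sumrN; apply: eq_bigr => i _.
rewrite -[nat_of_ord (lift ord0 (lift ord0 i))]/(i.+2) -[nat_of_ord (lift ord0 i)]/(i.+1).
rewrite faceS_cons (linear_Z (f := fun z : tpow n => x \tens z) (pure_linr x)).
by rewrite [in LHS]exprS mulN1r scaleNr.
Qed.

End Bridge.

Section UpTo.
Variables (k : comNzRingType) (B : algType k) (D : bialgebra B).
Implicit Types (P Q : lmodType k) (s t u v w f g h : seq B) (x y : B).
Local Notation sg n x := (((-1) ^+ n : k) *: x).
Local Notation J := (J D).
Local Notation W := (W D).
Local Notation R := (R D).
Local Notation c := (c D).
Local Notation b2 := (b2 D).
Local Notation M := (M D).
Local Notation Dl := (Dl D).
Local Notation eps := (counit D).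
Local Notation tpow := (tpow B).
Local Notation cp := (@cp k B).
Local Notation d := (bar_diff D).
Local Notation cup n p q := (@bar_cup k B D n p q).
Local Notation br n p q := (@bar_br k B D n p q).
Local Notation circ n p q := (@bar_circ k B D n p q).

Lemma ml_b2 P (F : seq B -> seq B -> seq B -> P) : ml3 F -> ml (fun t => b2 t F).
Proof.
case=> h1 h2 h3 u v.
pose G w z t h := c w (fun f g => sg ((size g).+1 * (size t).+1) (F (f ++ z :: t) g h)).
have e x : b2 (u ++ x :: v) F =
   R u (fun a z d h => sg ((size h).+1 * (size v).+1) (G a z (d ++ x :: v) h))
   + RMid D u x v (fun a z d p y q => G a z d (p ++ y :: q))
   + R v (fun a z d h => G (u ++ x :: a) z d h).
  by rewrite /b2 R_cat.
have l1 : linear (fun x => R u (fun a z d h =>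
    sg ((size h).+1 * (size v).+1) (G a z (d ++ x :: v) h))).
  apply: linear_R => a z d' h; apply: linear_scaler; apply: linear_R => a' z' d'' g.
  move=> a0 x y; rewrite !size_cat /=; move: a0 x y; apply: linear_scaler => a0 x y.
  have := h1 g h ((a' ++ z' :: d'') ++ z :: d') v a0 x y.
  by rewrite -!catA /=.
have l3 : linear (fun x => R v (fun a z d h => G (u ++ x :: a) z d h)).
  apply: linear_R => a z d' h; apply: ml_c => [g|f].
    apply: ml_scaler => u' v' a0 x y.
    by have := h1 g h u' (v' ++ z :: d') a0 x y; rewrite -!catA.
  by apply: (ml_sg (fun n => n.+1 * (size d').+1)%N).
have l2 : linear (fun x => RMid D u x v (fun a z d p y q => G a z d (p ++ y :: q))).
  apply: sum_linear => -[a b]; apply: sum_linear => -[e1 d'] /=; apply: linear_scaler.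
  apply: sum_linear => -[a1 a2]; apply: sum_linear => -[b1 b2] /=.
  apply: (@linear_W1 _ _ D _ (fun x y => G a (\prod_(x <- a1 ++ x :: b1) x) d' (a2 ++ y :: b2))).
    split=> [y|x]; last first.
      by apply: linear_R => *; apply: linear_scaler; exact: h3.
    apply: (linear_comp (g := fun z => G a z d' (a2 ++ y :: b2)) (ml_pi a1 b1)).
    by apply: linear_R => *; apply: linear_scaler; exact: h1.
  by move=> x y; rewrite big_seq1.
by move=> a x y; rewrite !e l1 l2 l3 !scalerDr; rewrite [LHS](AC ((2*2)*2) (((1*3)*5)*((2*4)*6))).
Qed.

Lemma circ_linear n p q : linear (circ n p q).
Proof. by apply: sum_linear => i; apply: linear_scaler; exact: decomp_linear. Qed.

Lemma cup_linear n p q : linear (cup n p q).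
Proof.
apply: (linear_comp (@decomp_linear k B D n p.+1 q p.+1)).
by apply: tmap_linear => //; exact: (@cup_inner_linear k B D p).
Qed.

Lemma br_linear n p q : linear (br n p q).
Proof.
apply: linear_sub; first exact: circ_linear.
by apply: (linear_comp (@circ_linear n q p)); exact: flip_rho_linear.
Qed.

Lemma circ_deg n p q (z : tpow n) : (p + q)%N <> n.+1 -> circ n p q z = 0.
Proof.
move=> /eqP e; rewrite /bar_circ big_nat big1 // => i hi; rewrite decomp_deg ?scaler0 //.
Qed.

Lemma cup_deg n p q (z : tpow n) : (p + q)%N <> n -> cup n p q z = 0.
Proof.
move=> e; rewrite /bar_cup decomp_deg ?leqnn //; last by rewrite addSn eqSS; apply/eqP.
by apply: linear_0; apply: tmap_linear => //; exact: (@cup_inner_linear k B D p).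
Qed.

Lemma br_deg n p q (z : tpow n) : (p + q)%N <> n.+1 -> br n p q z = 0.
Proof.
move=> e; rewrite /bar_br !circ_deg //; last by rewrite addnC.
by rewrite (linear_0 (@flip_rho_linear _ _ _ _)) subr0.
Qed.

Definition T2 p q f g : tpow p \ox tpow q := cp p f \tens cp q g.
Definition T3 p q r f g h : tpow p \ox tpow q \ox tpow r := cp p f \tens cp q g \tens cp r h.

Lemma T2_size p q f g : (size f != p) || (size g != q) -> T2 p q f g = 0.
Proof.
case/orP => e; rewrite /T2 (cp_size e); first exact: linear_0 (pure_linl _).
exact: linear_0 (pure_linr _).
Qed.

Lemma T3_size p q r f g h : [|| size f != p, size g != q | size h != r] -> T3 p q r f g h = 0.
Proof.
rewrite orbA => /orP[e|e]; last by rewrite /T3 (cp_size e); exact: linear_0 (pure_linr _).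
by rewrite /T3 -/(T2 p q f g) T2_size //; exact: linear_0 (pure_linl _).
Qed.

Lemma T2_sg p q f g i j : (size f = p -> size g = q -> odd i = odd j) ->
  sg i (T2 p q f g) = sg j (T2 p q f g).
Proof.
case: (boolP ((size f != p) || (size g != q))) => [e _|/norP[]].
  by rewrite T2_size // !scaler0.
by rewrite !negbK => /eqP e1 /eqP e2 h; apply: sg_odd; exact: h.
Qed.

Lemma T3_sg p q r f g h i j : (size f = p -> size g = q -> size h = r -> odd i = odd j) ->
  sg i (T3 p q r f g h) = sg j (T3 p q r f g h).
Proof.
case: (boolP ([|| size f != p, size g != q | size h != r])) => [e _|/norP[e1 /norP[]]].
  by rewrite T3_size // !scaler0.
move: e1; rewrite !negbK => /eqP e1 /eqP e2 /eqP e3 hh; apply: sg_odd; exact: hh.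
Qed.

Lemma T2_ml p q : (forall g, ml (T2 p q ^~ g)) /\ (forall f, ml (T2 p q f)).
Proof.
split=> [g|f] u v; first exact: (linear_comp (@ml_cp k B p u v) (pure_linl _)).
exact: (linear_comp (@ml_cp k B q u v) (pure_linr _)).
Qed.

Lemma T3_ml p q r : ml3 (T3 p q r).
Proof.
have [h1 h2] := T2_ml p q.
split=> [g h|f h|f g] u v.
- exact: (linear_comp (h1 g u v) (pure_linl _)).
- exact: (linear_comp (h2 f u v) (pure_linl _)).
- exact: (linear_comp (@ml_cp k B r u v) (pure_linr _)).
Qed.

Lemma c_zero P s (F : seq B -> seq B -> P) :
  (forall f g, (0 < size f)%N -> (size f + size g = (size s).+1)%N -> F f g = 0) -> c s F = 0.
Proof.
move=> h; rewrite -(scale0r (c s (fun _ _ => 0))) -cZ; apply: eq_c_pos => f g h1 h2.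
by rewrite h // scaler0.
Qed.

Lemma circ_cpE n p q s : (p + q = n.+1)%N \/ ((p + q).-1 = n)%N -> circ n p q (cp n s) = c s (T2 p q).
Proof.
move=> e; case: (eqVneq (size s) n) => es; first exact: circ_cp.
rewrite cp_size // (linear_0 (@circ_linear _ _ _)) c_zero // => f g f0 e2.
apply: T2_size; apply/norP => -[/negbNE/eqP e3 /negbNE/eqP e4].
move/eqP: es; case: e; rewrite -e3 -e4; lia.
Qed.

Lemma cup_cpE n p q s : (p + q = n)%N -> cup n p q (cp n s) = K s (T2 p q).
Proof.
move=> e; case: (eqVneq (size s) n) => es; first exact: cup_cp.
rewrite cp_size // (linear_0 (@cup_linear _ _ _)) (eq_K (G := fun f g => 0 *: T2 p q f g)) ?KZ ?scale0r //.
move=> f g e2; rewrite scale0r T2_size //; apply/norP => -[/negbNE/eqP e3 /negbNE/eqP e4].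
by move/eqP: es; rewrite -e2 size_cat; lia.
Qed.

Lemma br_of_circ n p q s : circ n p q (cp n s) = c s (T2 p q) -> circ n q p (cp n s) = c s (T2 q p) ->
  br n p q (cp n s) = c s (T2 p q) - sg (q.+1 * p.+1) (c s (fun g f => T2 p q f g)).
Proof.
move=> e1 e2; rewrite /bar_br e1 e2 /flip_rho (R_lin D (@tswap_linear _ _ _)).
by congr (_ - _ *: _); apply: eq_R => *; rewrite tswap_pure.
Qed.

Lemma br_cp n p q s : size s = n ->
  br n p q (cp n s) = c s (T2 p q) - sg (q.+1 * p.+1) (c s (fun g f => T2 p q f g)).
Proof. by move=> e; apply: br_of_circ; exact: circ_cp. Qed.

Lemma br_cpE p q s :
  br (p + q).-1 p q (cp (p + q).-1 s) =
  c s (T2 p q) - sg (q.+1 * p.+1) (c s (fun g f => T2 p q f g)).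
Proof. by apply: br_of_circ; apply: circ_cpE; right => //; rewrite addnC. Qed.

Lemma bdry_cp P n (L : tpow n.-1 -> P) (G : seq B -> P) s : linear L -> ml G ->
  (forall t, size t = n.-1 -> L (cp n.-1 t) = G t) -> size s = n ->
  L (bdry d n (cp n s)) = Dl G s.
Proof.
case: n L => [|n] L hL hG h e.
  by case: s e => // _; rewrite Dl_nil //= (linear_0 hL).
rewrite /bdry diff_cp (Dl_lin D hL); apply: eq_Dl => t et; apply: h.
by move: et; rewrite e => -[].
Qed.

Lemma bar_diff2 n (z : tpow n.+2) : d n (d n.+1 z) = 0.
Proof.
move: z; apply: (tpow_ext (f := fun z => d n (d n.+1 z)) (g := fun _ => 0)).
- by apply: linear_comp; exact: linearP.
- exact: linear_zero.
move=> s _; rewrite diff_cp (Dl_lin D (L := d n)); last exact: linearP.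
rewrite (_ : (fun t => _) = Dl (cp n)); first by apply: Dl_Dl; exact: ml_cp.
by apply: funext => t; exact: diff_cp.
Qed.

Lemma bdry_linear n : linear (bdry d n).
Proof. exact: linearP. Qed.

Lemma diff_T2l p q f g : tmap (d p) id (T2 p.+1 q f g) = Dl (fun t => T2 p q t g) f.
Proof.
rewrite /T2 tmap_pure ?diff_cp //; last exact: linearP.
by rewrite (Dl_lin D (L := fun z : tpow p => z \tens cp q g) (pure_linl _)).
Qed.

Lemma diff_T2r p q f g : tmap id (d q) (T2 p q.+1 f g) = Dl (T2 p q f) g.
Proof.
rewrite /T2 tmap_pure ?diff_cp //; last exact: linearP.
by rewrite (Dl_lin D (L := fun z : tpow q => cp p f \tens z) (pure_linr _)).
Qed.

Lemma tmap_dl_linear p q : linear (tmap (d p) (id : tpow q -> tpow q)).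
Proof. by apply: tmap_linear => //; exact: linearP. Qed.
Lemma tmap_dr_linear p q : linear (tmap (id : tpow p -> tpow p) (d q)).
Proof. by apply: tmap_linear => //; exact: linearP. Qed.

Lemma Dl_T2_sg p q f g i j : (size f = p -> odd i = odd j) ->
  sg i (Dl (T2 p q f) g) = sg j (Dl (T2 p q f) g).
Proof.
case: (eqVneq (size f) p) => e h; first by apply: sg_odd; exact: h.
suff -> : T2 p q f = fun _ => 0 *: 0.
  by rewrite DlZ !scale0r !scaler0.
by apply: funext => t; rewrite T2_size ?e // scaler0.
Qed.

(* Hence the circle cooperation is a null homotopy of the cocommutator. *)
Lemma circ_homotopy n p q (z : tpow n) :
  tens_diff d 1 (fun p q => circ n p q z) p q =
  circ n.-1 p q (bdry d n z) + sg p.+1 (cocommutator (bar_cup D) p q z).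
Proof.
move: z; apply: (tpow_ext (f := fun z => tens_diff d 1 (fun p q => circ n p q z) p q)
  (g := fun z => circ n.-1 p q (bdry d n z) + sg p.+1 (cocommutator (bar_cup D) p q z))).
- apply: linear_add.
    by apply: (linear_comp (@circ_linear n p.+1 q)); exact: tmap_dl_linear.
  apply: linear_scaler.
  by apply: (linear_comp (@circ_linear n p q.+1)); exact: tmap_dr_linear.
- apply: linear_add.
    by apply: (linear_comp (@bdry_linear n)); exact: circ_linear.
  apply: linear_scaler; apply: linear_sub; first exact: cup_linear.
  by apply: (linear_comp (@cup_linear n q p)); exact: flip_tau_linear.
move=> s es; have [h1 h2] := T2_ml p q.
rewrite (bdry_cp (G := fun t => c t (T2 p q)) (@circ_linear _ _ _)) //; last 2 first.
- exact: ml_c.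
- by move=> t et; exact: circ_cp.
rewrite /tens_diff !circ_cp // (R_lin D (@tmap_dl_linear _ _)) (R_lin D (@tmap_dr_linear _ _)).
rewrite /cocommutator !cup_cp // /flip_tau (K_lin (@tswap_linear _ _ _)).
have := Dl_comp D s h1 h2.
rewrite scalerBr addrA [sg p.+1 (sg _ _)]sg_sg.
move=> e; transitivity (c s (fun f g => Dl (fun t => T2 p q t g) f) +
    c s (fun f g => sg (size f).+1 (Dl (T2 p q f) g))).
  congr (_ + _); first by apply: eq_R => *; exact: diff_T2l.
  rewrite -RZ; apply: eq_R => *; rewrite -/(T2 p q.+1 _ _) diff_T2r; apply: Dl_T2_sg => ->.
  lia.
rewrite e; congr (_ + _ + _).
  by rewrite -KZ; apply: eq_K => f g _; apply: T2_sg => -> _.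
rewrite -sg1 sg_sg -KZ; apply: eq_K => g f _; rewrite tswap_pure; apply: T2_sg => -> ->.
by lia.
Qed.

Lemma cup_chain n p q (z : tpow n) :
  tens_diff d 0 (fun p q => cup n p q z) p q = cup n.-1 p q (bdry d n z).
Proof.
move: z; apply: (tpow_ext (f := fun z => tens_diff d 0 (fun p q => cup n p q z) p q)
  (g := fun z => cup n.-1 p q (bdry d n z))).
- apply: linear_add.
    by apply: (linear_comp (@cup_linear n p.+1 q)); exact: tmap_dl_linear.
  apply: linear_scaler.
  by apply: (linear_comp (@cup_linear n p q.+1)); exact: tmap_dr_linear.
- by apply: (linear_comp (@bdry_linear n)); exact: cup_linear.
move=> s es; have [h1 h2] := T2_ml p q.
rewrite (bdry_cp (G := fun t => K t (T2 p q)) (@cup_linear _ _ _)) //; last 2 first.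
- exact: ml_Kcat.
- by move=> t et; exact: cup_cp.
rewrite /tens_diff !cup_cp // (K_lin (@tmap_dl_linear _ _)) (K_lin (@tmap_dr_linear _ _)).
rewrite -(Dl_K D s h1 h2); congr (_ + _).
  by apply: eq_K => *; exact: diff_T2l.
rewrite -KZ; apply: eq_K => *; rewrite -/(T2 p q.+1 _ _) diff_T2r; apply: Dl_T2_sg => ->.
by rewrite addn0.
Qed.

Lemma cup_coassoc n p q r (z : tpow n) : coassociator (bar_cup D) p q r z = 0.
Proof.
have l1 a b : linear (tmap (cup a p q) (id : tpow b -> tpow b)).
  by apply: tmap_linear => //; exact: cup_linear.
have l2 a b : linear (fun z => tassocV (tmap (id : tpow b -> tpow b) (cup a q r) z)).
  apply: linear_comp (@tassocV_linear _ _ _ _); apply: tmap_linear => //; exact: cup_linear.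
move: z; apply: (tpow_ext (f := fun z => coassociator (bar_cup D) p q r z) (g := fun _ => 0)).
- apply: linear_sub; first exact: (linear_comp (@cup_linear _ _ _) (l1 _ _)).
  exact: (linear_comp (@cup_linear _ _ _) (l2 _ _)).
- exact: linear_zero.
move=> s es; apply/eqP; rewrite subr_eq0; apply/eqP.
rewrite !cup_cp // (K_lin (l1 _ _)) (K_lin (l2 _ _)).
transitivity (K s (fun a h => K a (fun f g => T3 p q r f g h))).
  apply: eq_K => a h _; rewrite tmap_pure //; last exact: cup_linear.
  by rewrite cup_cpE // (K_lin (@pure_linl _ _ _ _)).
rewrite KA; apply: eq_K => f b _; rewrite tmap_pure //; last exact: cup_linear.
rewrite cup_cpE // (K_lin (@pure_linr _ _ _ _)) (K_lin (@tassocV_linear _ _ _ _)).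
by apply: eq_K => g h _; rewrite tassocV_pure.
Qed.

Lemma cup_cocomm n (z : tpow n) : bdry d n z = 0 ->
  exists w0 : forall p q, tpow p \ox tpow q,
    forall p q, cocommutator (bar_cup D) p q z = tens_diff d 0 w0 p q.
Proof.
move=> hz; exists (fun p q => sg p (circ n p q z)) => p q.
have := circ_homotopy p q z; rewrite hz (linear_0 (@circ_linear _ _ _)) add0r => e.
transitivity (sg p.+1 (tens_diff d 1 (fun p q => circ n p q z) p q)).
  rewrite e sg_sg -[LHS]scale1r -[1](expr0 (-1)); apply: sg_odd; lia.
rewrite /tens_diff (linear_Z (@tmap_dl_linear _ _)) (linear_Z (@tmap_dr_linear _ _)).
by rewrite scalerDr !sg_sg; congr (_ + _); apply: sg_odd; lia.
Qed.

Lemma tswapK p q (z : tpow p \ox tpow q) : tswap (tswap z) = z.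
Proof.
move: z; apply: (tensor_ext (f := fun z => tswap (tswap z)) (g := id)) => //.
  by apply: linear_comp; exact: tswap_linear.
by move=> x y; rewrite !tswap_pure.
Qed.

Lemma tswap_dl p q (z : tpow q \ox tpow p.+1) :
  tmap (d p) id (tswap z) = tswap (tmap id (d p) z).
Proof.
move: z; apply: tensor_ext; [exact: linear_comp (@tswap_linear _ _ _) (@tmap_dl_linear _ _)
  | exact: linear_comp (@tmap_dr_linear _ _) (@tswap_linear _ _ _) |].
by move=> x y; rewrite tswap_pure !tmap_pure ?tswap_pure //; exact: linearP.
Qed.

Lemma tswap_dr p q (z : tpow q.+1 \ox tpow p) :
  tmap id (d q) (tswap z) = tswap (tmap (d q) id z).
Proof.
move: z; apply: tensor_ext; [exact: linear_comp (@tswap_linear _ _ _) (@tmap_dr_linear _ _)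
  | exact: linear_comp (@tmap_dl_linear _ _) (@tswap_linear _ _ _) |].
by move=> x y; rewrite tswap_pure !tmap_pure ?tswap_pure //; exact: linearP.
Qed.

Lemma br_chain n p q (z : tpow n) :
  tens_diff d 1 (fun p q => br n p q z) p q = br n.-1 p q (bdry d n z).
Proof.
have := circ_homotopy p q z; have := circ_homotopy q p z.
rewrite /bar_br /tens_diff /flip_rho /cocommutator /flip_tau => e2 e1.
rewrite !(linear_B _ _ (@tmap_dl_linear _ _)) !(linear_B _ _ (@tmap_dr_linear _ _)).
rewrite !(linear_Z (@tmap_dl_linear _ _)) !(linear_Z (@tmap_dr_linear _ _)).
rewrite tswap_dl tswap_dr scalerBr addrACA -opprD e1.
have {}e2 := congr1 (fun a : tpow q \ox tpow p => sg (q.+1 * p.+1) (tswap a)) e2.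
have l : linear (@tswap k (tpow q) (tpow p)) by exact: tswap_linear.
rewrite !(linear_D _ _ l) !(linear_Z l) !(linear_B _ _ l) !(linear_Z l) tswapK in e2.
rewrite !scalerDr !scalerN !sg_sg in e2; rewrite !(scalerDr, scalerN, sg_sg).
have -> : sg (q.+1 * p.+2) (tswap (tmap id (d p) (circ n q p.+1 z))) +
   sg (p + 1 + q.+2 * p.+1) (tswap (tmap (d q) id (circ n q.+1 p z))) =
   sg (q.+1 * p.+1) (tswap (circ n.-1 q p (bdry d n z)))
   + (sg (q.+1 * p.+1 + q.+1) (tswap (cup n q p z)) - sg (q.+1 * p.+1 + q.+1 + p * q) (cup n p q z)).
  rewrite -e2 addrC; congr (_ + _); apply: sg_odd; lia.
set X := cup n p q z; set Y := tswap (cup n q p z).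
have -> : sg (p.+1 + q * p) Y = - sg (q.+1 * p.+1 + q.+1) Y.
  by rewrite -sg1 sg_sg; apply: sg_odd; lia.
have -> : sg (q.+1 * p.+1 + q.+1 + p * q) X = - sg p.+1 X.
  by rewrite -sg1 sg_sg; apply: sg_odd; lia.
rewrite !opprK !opprD [LHS](AC ((1*2)*(1*2)) ((1*4)*(2*6)*(3*5))) /=.
by rewrite !subrr !addr0.
Qed.

Lemma anti_pre_lie P s e (F : seq B -> seq B -> seq B -> P) : ml3 F ->
  (forall f g h, sg ((size g).+1 * (size h).+1) (F f g h) = sg e (F f g h)) ->
  c s (fun a h => c a (fun f g => F f g h)) - c s (fun f b => c b (fun g h => F f g h)) =
  sg e (c s (fun a g => c a (fun f h => F f g h)) - c s (fun f b => c b (fun h g => F f g h))).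
Proof.
move=> hF he; have hF' : ml3 (fun f h g => F f g h) by case: hF.
rewrite (pre_lie D s hF) (pre_lie D s hF').
pose b := b2 s F; pose b' := b2 s (fun f h g => F f g h).
have -> : b2 s (fun f h g => sg ((size g).+1 * (size h).+1) (F f g h)) = sg e b'.
  by rewrite -b2Z; apply: eq_b2 => *; exact: he.
have -> : b2 s (fun f g h => sg ((size h).+1 * (size g).+1) (F f g h)) = sg e b.
  by rewrite -b2Z; apply: eq_b2 => *; rewrite mulnC; exact: he.
have h (x0 y0 z0 : P) : x0 + y0 + z0 - x0 = y0 + z0 by rewrite addrC !addrA addNr add0r.
rewrite !h -/b -/b' scalerDr sg_sg addrC; congr (_ + _).
by rewrite -[LHS]scale1r -[1](expr0 (-1)); apply: sg_odd; lia.
Qed.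

Lemma rho12_linear p q r : linear (@rho12 k tpow p q r).
Proof. by apply: tmap_linear => //; exact: flip_rho_linear. Qed.
Lemma rho23_linear p q r : linear (@rho23 k tpow p q r).
Proof.
exact: (linear_comp (linear_comp (@tassoc_linear _ _ _ _)
  (tmap_linear (@linear_id _ _) (@flip_rho_linear _ _ _ _))) (@tassocV_linear _ _ _ _)).
Qed.

Lemma rho12_T3 p q r f g h : rho12 (T3 p q r f g h) = sg (p.+1 * q.+1) (T3 q p r g f h).
Proof.
rewrite /rho12 tmap_pure //; last exact: flip_rho_linear.
rewrite /flip_rho tswap_pure.
exact: (linear_Z (f := fun z : tpow q \ox tpow p => z \tens cp r h) (pure_linl _)).
Qed.

Lemma rho23_T3 p q r f g h : rho23 (T3 p q r f g h) = sg (q.+1 * r.+1) (T3 p r q f h g).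
Proof.
rewrite /rho23 tassoc_pure tmap_pure //; last exact: flip_rho_linear.
rewrite /flip_rho tswap_pure.
rewrite (linear_Z (f := fun z : tpow r \ox tpow q => cp p f \tens z) (pure_linr _)).
by rewrite (linear_Z (@tassocV_linear _ _ _ _)) tassocV_pure.
Qed.

Definition br2 n a b0 c0 (z : tpow n) : tpow a \ox tpow b0 \ox tpow c0 :=
  tmap (br (a + b0)%N.-1 a b0) id (br n (a + b0)%N.-1 c0 z).

Lemma tmap_br_linear a b0 m e : linear (tmap (br m a b0) (id : tpow e -> tpow e)).
Proof. by apply: tmap_linear => //; exact: br_linear. Qed.

Lemma br2_linear n a b0 c0 : linear (@br2 n a b0 c0).
Proof. exact: (linear_comp (@br_linear n _ _) (@tmap_br_linear _ _ _ _)). Qed.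

Lemma br2_cp n p q r s : size s = n ->
  br2 p q r (cp n s) =
  c s (fun a h => c a (fun f g => T3 p q r f g h))
  - sg (q.+1 * p.+1) (c s (fun a h => c a (fun g f => T3 p q r f g h)))
  - sg (r.+1 * (p + q)) (c s (fun h a => c a (fun f g => T3 p q r f g h)))
  + sg (r.+1 * (p + q) + q.+1 * p.+1) (c s (fun h a => c a (fun g f => T3 p q r f g h))).
Proof.
move=> es; have e a h : tmap (br (p + q).-1 p q) id (T2 (p + q).-1 r a h) =
   c a (fun f g => T3 p q r f g h) - sg (q.+1 * p.+1) (c a (fun g f => T3 p q r f g h)).
  rewrite tmap_pure //; last exact: br_linear.
  rewrite br_cpE (linear_B _ _ (@pure_linl _ _ _ _)).
  rewrite (linear_Z (f := fun z : tpow p \ox tpow q => z \tens cp r h) (pure_linl _)).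
  by rewrite !(R_lin D (@pure_linl _ _ _ _)).
rewrite /br2 br_cp // (linear_B _ _ (@tmap_br_linear _ _ _ _)) (linear_Z (@tmap_br_linear _ _ _ _)).
rewrite !(R_lin D (@tmap_br_linear _ _ _ _)) -[RHS]addrA [X in _ = _ + X]addrC -[X in _ = _ + X]opprB; congr (_ - _).
  rewrite -scaleN1r -!cZ -cD; apply: eq_R => u y w h _; by rewrite -/(T2 _ r _ _) e ?scaleN1r.
have e' h a : sg (r.+1 * (p + q).-1.+1) (c a (fun f g => T3 p q r f g h) - sg (q.+1 * p.+1) (c a (fun g f => T3 p q r f g h)))
  = sg (r.+1 * (p + q)) (c a (fun f g => T3 p q r f g h)) - sg (r.+1 * (p + q) + q.+1 * p.+1) (c a (fun g f => T3 p q r f g h)).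
  case: (posnP (p + q)) => pq.
    have z1 : c a (fun f g => T3 p q r f g h) = 0.
      by apply: c_zero => f g f0 _; rewrite T3_size //; lia.
    have z2 : c a (fun g f => T3 p q r f g h) = 0.
      by apply: c_zero => g f g0 _; rewrite T3_size //; lia.
    by rewrite z1 z2 !scaler0 !subr0 scaler0.
  by rewrite prednK // scalerBr sg_sg.
rewrite -scaleN1r -!cZ -cD -RZ; apply: eq_R => u y w h' _.
by rewrite e e' scaleN1r.
Qed.

Lemma br_cojacobi n p q r (z : tpow n) : cojacobiator (bar_br D) p q r z = 0.
Proof.
have lr a b0 e : linear (fun z : tpow a \ox tpow b0 \ox tpow e => rho23 (rho12 z)).
  exact: linear_comp (@rho12_linear _ _ _) (@rho23_linear _ _ _).
have lr' a b0 e : linear (fun z : tpow a \ox tpow b0 \ox tpow e => rho12 (rho23 z)).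
  exact: linear_comp (@rho23_linear _ _ _) (@rho12_linear _ _ _).
rewrite /cojacobiator -/(br2 _ _ _ _) -/(br2 _ _ _ _) -/(br2 _ _ _ _).
move: z; apply: (tpow_ext (f := fun z => br2 p q r z + rho23 (rho12 (br2 r p q z))
   + rho12 (rho23 (br2 q r p z))) (g := fun _ => 0)).
- apply: linear_add; first apply: linear_add; first exact: br2_linear.
    exact: linear_comp (@br2_linear _ _ _ _) (lr _ _ _).
  exact: linear_comp (@br2_linear _ _ _ _) (lr' _ _ _).
- exact: linear_zero.
move=> s es; rewrite !br2_cp //.
have cc (P Q : lmodType k) (L : P -> Q) (hL : linear L) (F : seq B -> seq B -> seq B -> P) :
    L (c s (fun a h => c a (fun f g => F f g h))) = c s (fun a h => c a (fun f g => L (F f g h))).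
  by rewrite (R_lin D hL); apply: eq_R => *; rewrite (R_lin D hL).
have cc' (P Q : lmodType k) (L : P -> Q) (hL : linear L) (F : seq B -> seq B -> seq B -> P) :
    L (c s (fun f b => c b (fun g h => F f g h))) = c s (fun f b => c b (fun g h => L (F f g h))).
  by rewrite (R_lin D hL); apply: eq_R => *; rewrite (R_lin D hL).
rewrite !(linear_D _ _ (lr _ _ _), linear_B _ _ (lr _ _ _), linear_Z (lr _ _ _)).
rewrite !(linear_D _ _ (lr' _ _ _), linear_B _ _ (lr' _ _ _), linear_Z (lr' _ _ _)).
rewrite !(cc _ _ _ (lr r p q)) !(cc' _ _ _ (lr r p q)) !(cc _ _ _ (lr' q r p)) !(cc' _ _ _ (lr' q r p)).
have eA f g h : rho23 (rho12 (T3 r p q h f g)) = sg (r.+1 * q.+1 + r.+1 * p.+1) (T3 p q r f g h).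
  by rewrite rho12_T3 (linear_Z (@rho23_linear _ _ _)) rho23_T3 sg_sg addnC.
have eB f g h : rho12 (rho23 (T3 q r p g h f)) = sg (r.+1 * p.+1 + q.+1 * p.+1) (T3 p q r f g h).
  by rewrite rho23_T3 (linear_Z (@rho12_linear _ _ _)) rho12_T3 sg_sg.
have cs m (F : seq B -> seq B -> seq B -> tpow p \ox tpow q \ox tpow r) :
    c s (fun a h => c a (fun f g => sg m (F f g h))) = sg m (c s (fun a h => c a (fun f g => F f g h))).
  by rewrite -cZ; apply: eq_c => *; rewrite cZ.
have cs' m (F : seq B -> seq B -> seq B -> tpow p \ox tpow q \ox tpow r) :
    c s (fun f b => c b (fun g h => sg m (F f g h))) = sg m (c s (fun f b => c b (fun g h => F f g h))).
  by rewrite -cZ; apply: eq_c => *; rewrite cZ.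
have t3 := T3_ml p q r.
pose l1 := c s (fun a h => c a (fun f g => T3 p q r f g h)).
pose l2 := c s (fun a h => c a (fun g f => T3 p q r f g h)).
pose l3 := c s (fun a g => c a (fun h f => T3 p q r f g h)).
pose l4 := c s (fun a g => c a (fun f h => T3 p q r f g h)).
pose l5 := c s (fun a f => c a (fun g h => T3 p q r f g h)).
pose l6 := c s (fun a f => c a (fun h g => T3 p q r f g h)).
pose r1 := c s (fun f b => c b (fun g h => T3 p q r f g h)).
pose r2 := c s (fun f b => c b (fun h g => T3 p q r f g h)).
pose r3 := c s (fun g b => c b (fun f h => T3 p q r f g h)).
pose r4 := c s (fun g b => c b (fun h f => T3 p q r f g h)).
pose r5 := c s (fun h b => c b (fun f g => T3 p q r f g h)).
pose r6 := c s (fun h b => c b (fun g f => T3 p q r f g h)).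
have e1 : l1 - r1 = sg (q.+1 * r.+1) (l4 - r2).
  by apply: anti_pre_lie => // f g h; apply: T3_sg => _ -> ->.
have e2 : l2 - r3 = sg (p.+1 * r.+1) (l5 - r4).
  apply: (@anti_pre_lie _ s _ (fun g f h => T3 p q r f g h)); first by case: t3.
  by move=> g f h; apply: T3_sg => -> _ ->.
have e3 : l3 - r5 = sg (p.+1 * q.+1) (l6 - r6).
  apply: (@anti_pre_lie _ s _ (fun h f g => T3 p q r f g h)); first by case: t3.
  by move=> h f g; apply: T3_sg => -> -> _.
have -> : c s (fun a h => c a (fun f g => rho23 (rho12 (T3 r p q f g h)))) =
    sg (r.+1 * q.+1 + r.+1 * p.+1) l3.
  by rewrite -cs; apply: eq_c => a g _; apply: eq_c => h f _; exact: eA.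
have -> : c s (fun a h => c a (fun f g => rho23 (rho12 (T3 r p q g f h)))) =
    sg (r.+1 * q.+1 + r.+1 * p.+1) l4.
  by rewrite -cs; apply: eq_c => a g _; apply: eq_c => h f _; exact: eA.
have -> : c s (fun f b => c b (fun g h => rho23 (rho12 (T3 r p q g h f)))) =
    sg (r.+1 * q.+1 + r.+1 * p.+1) r4.
  by rewrite -cs'; apply: eq_c => a g _; apply: eq_c => h f _; exact: eA.
have -> : c s (fun f b => c b (fun g h => rho23 (rho12 (T3 r p q h g f)))) =
    sg (r.+1 * q.+1 + r.+1 * p.+1) r3.
  by rewrite -cs'; apply: eq_c => a g _; apply: eq_c => h f _; exact: eA.
have -> : c s (fun a h => c a (fun f g => rho12 (rho23 (T3 q r p f g h)))) =
    sg (r.+1 * p.+1 + q.+1 * p.+1) l5.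
  by rewrite -cs; apply: eq_c => a f _; apply: eq_c => g h _; exact: eB.
have -> : c s (fun a h => c a (fun f g => rho12 (rho23 (T3 q r p g f h)))) =
    sg (r.+1 * p.+1 + q.+1 * p.+1) l6.
  by rewrite -cs; apply: eq_c => a f _; apply: eq_c => g h _; exact: eB.
have -> : c s (fun f b => c b (fun g h => rho12 (rho23 (T3 q r p g h f)))) =
    sg (r.+1 * p.+1 + q.+1 * p.+1) r1.
  by rewrite -cs'; apply: eq_c => f a _; apply: eq_c => g h _; exact: eB.
have -> : c s (fun f b => c b (fun g h => rho12 (rho23 (T3 q r p h g f)))) =
    sg (r.+1 * p.+1 + q.+1 * p.+1) r2.
  by rewrite -cs'; apply: eq_c => f a _; apply: eq_c => g h _; exact: eB.
rewrite -/l1 -/l2 -/r5 -/r6.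
move: e1 e2 e3; move: l1 l2 l3 l4 l5 l6 r1 r2 r3 r4 r5 r6 => l1 l2 l3 l4 l5 l6 r1 r2 r3 r4 r5 r6.
move=> /(canRL (subrK _)) -> /(canRL (subrK _)) -> /(canRL (subrK _)) ->.
have sgb m (z : tpow p \ox tpow q \ox tpow r) : sg m z = if odd m then - z else z.
  by rewrite -signr_odd; case: (odd m); rewrite ?expr0 ?scale1r // expr1 scaleN1r.
rewrite !sgb !scaleN1r !(oddD, oddM, oddS) /=.
case: (odd p); case: (odd q); case: (odd r) => /=; rewrite !(opprD, opprK) [LHS](AC (3*3*1*1*6*4)
  ((1*12)*(2*18)*(3*17)*(4*15)*(5*13)*(6*14)*(7*11)*(8*10)*(9*16))) /=;
  by rewrite ?(subrr, addNr, addr0).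
Qed.

Lemma br_lie_cobracket : is_lie_cobracket (bar_br D).
Proof.
split=> [n p q|n p q z e|n z|n p q r z].
- exact: br_linear.
- exact: br_deg.
- by exists (fun p q => circ n p q z).
- exact: br_cojacobi.
Qed.

Definition brace_lift n p q r : tpow n -> tpow p \ox tpow q \ox tpow r :=
  ulift (n := n) (fun s => b2 s (T3 p q r)).

Lemma brace_lift_linear n p q r : linear (@brace_lift n p q r).
Proof. by apply: ulift_linear; apply: ml_b2; exact: T3_ml. Qed.

Lemma brace_lift_cp n p q r s : size s = n -> brace_lift p q r (cp n s) = b2 s (T3 p q r).
Proof. by move=> e; apply: ulift_cp => //; apply: ml_b2; exact: T3_ml. Qed.

Lemma b2_lin P Q (L : P -> Q) (hL : linear L) s (F : seq B -> seq B -> seq B -> P) :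
  L (b2 s F) = b2 s (fun f g h => L (F f g h)).
Proof.
rewrite (R_lin D hL); apply: eq_R => u y w h _; rewrite (R_lin D hL); apply: eq_R => *.
exact: linear_Z.
Qed.

Lemma diff_T3_1 p q r f g h :
  tmap (tmap (d p) id) id (T3 p.+1 q r f g h) = Dl (fun t => T3 p q r t g h) f.
Proof.
rewrite /T3 tmap_pure //; last exact: tmap_dl_linear.
rewrite -/(T2 p.+1 q f g) diff_T2l.
by rewrite (Dl_lin D (L := fun z : tpow p \ox tpow q => z \tens cp r h) (pure_linl _)).
Qed.

Lemma diff_T3_2 p q r f g h :
  tmap (tmap id (d q)) id (T3 p q.+1 r f g h) = Dl (fun t => T3 p q r f t h) g.
Proof.
rewrite /T3 tmap_pure //; last exact: tmap_dr_linear.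
rewrite -/(T2 p q.+1 f g) diff_T2r.
by rewrite (Dl_lin D (L := fun z : tpow p \ox tpow q => z \tens cp r h) (pure_linl _)).
Qed.

Lemma diff_T3_3 p q r f g h :
  tmap id (d r) (T3 p q r.+1 f g h) = Dl (T3 p q r f g) h.
Proof.
rewrite /T3 tmap_pure ?diff_cp //; last exact: linearP.
by rewrite (Dl_lin D (L := fun z : tpow r => (cp p f \tens cp q g) \tens z) (pure_linr _)).
Qed.

Lemma coleibniz_homotopy n p q r (z : tpow n) :
  coleibnizator (bar_cup D) (bar_br D) p q r z =
  tens3_diff d 1 (fun p q r => sg (p + q) (brace_lift p q r z)) p q r
  + sg (p + q) (brace_lift p q r (bdry d n z)).
Proof.
have lc a b e : linear (fun z => tassocV (tmap (id : tpow b -> tpow b) (cup a q e) z)).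
  by apply: linear_comp (@tassocV_linear _ _ _ _); apply: tmap_linear => //; exact: cup_linear.
have lb a e : linear (fun z => tassocV (tmap (id : tpow a -> tpow a) (br e p r) z)).
  by apply: linear_comp (@tassocV_linear _ _ _ _); apply: tmap_linear => //; exact: br_linear.
have lv a b : linear (tmap (@flip_varrho k tpow a b) (id : tpow r -> tpow r)).
  by apply: tmap_linear => //; exact: flip_varrho_linear.
have l1 a b e : linear (tmap (tmap (d a) (id : tpow b -> tpow b)) (id : tpow e -> tpow e)).
  by apply: tmap_linear => //; exact: tmap_dl_linear.
have l2 a b e : linear (tmap (tmap (id : tpow a -> tpow a) (d b)) (id : tpow e -> tpow e)).
  by apply: tmap_linear => //; exact: tmap_dr_linear.
have l3 e : linear (tmap (id : tpow p \ox tpow q -> tpow p \ox tpow q) (d e)).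
  by apply: tmap_linear => //; exact: linearP.
move: z; apply: (tpow_ext (f := fun z => coleibnizator (bar_cup D) (bar_br D) p q r z)
  (g := fun z => tens3_diff d 1 (fun p q r => sg (p + q) (brace_lift p q r z)) p q r
  + sg (p + q) (brace_lift p q r (bdry d n z)))).
- apply: linear_sub; first exact: (linear_comp (@br_linear _ _ _) (lc _ _ _)).
  apply: linear_add; first exact: (linear_comp (@cup_linear _ _ _) (@tmap_br_linear _ _ _ _)).
  exact: (linear_comp (@cup_linear _ _ _) (linear_comp (lb q _) (lv q p))).
- apply: linear_add; last first.
    by apply: linear_scaler; exact: (linear_comp (@bdry_linear _) (@brace_lift_linear _ _ _ _)).
  apply: linear_add; first apply: linear_add.
  + by apply: (linear_comp _ (l1 _ _ _)); apply: linear_scaler; exact: brace_lift_linear.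
  + by apply: linear_scaler; apply: (linear_comp _ (l2 _ _ _)); apply: linear_scaler; exact: brace_lift_linear.
  + by apply: linear_scaler; apply: (linear_comp _ (l3 _)); apply: linear_scaler; exact: brace_lift_linear.
move=> s es; have t3 := T3_ml p q r.
have mb := ml_b2 t3.
rewrite (bdry_cp (G := fun t => b2 t (T3 p q r)) (@brace_lift_linear _ _ _ _)) //; last first.
  by move=> t et; exact: brace_lift_cp.
have E := b2_comp_homotopy D s t3.
transitivity (c s (fun f b => K b (fun g h => T3 p q r f g h)) -
   K s (fun a h => c a (fun f g => T3 p q r f g h)) -
   K s (fun g b => c b (fun f h => sg (size g * (size f).+1) (T3 p q r f g h)))); last first.
  rewrite E /tens3_diff !brace_lift_cp //; congr (_ + _ + _ + _).
  - rewrite (linear_Z (l1 p q r)) (b2_lin (l1 p q r)) -b2Z; apply: eq_b2 => f g h _.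
    rewrite -diff_T3_1 -!(linear_Z (l1 p q r)); congr (tmap _ _ _).
    by apply: T3_sg => -> -> _.
  - rewrite (linear_Z (l2 p q r)) (b2_lin (l2 p q r)) -!b2Z; apply: eq_b2 => f g h _.
    rewrite -diff_T3_2 -!(linear_Z (l2 p q r)) sg_sg; congr (tmap _ _ _).
    by apply: T3_sg => _ -> _; lia.
  - rewrite (linear_Z (l3 r)) (b2_lin (l3 r)) -!b2Z -scaleN1r -b2Z; apply: eq_b2 => f g h _.
    rewrite -diff_T3_3 scaleN1r -sg1 -!(linear_Z (l3 r)) sg_sg; congr (tmap _ _ _).
    by apply: sg_odd; lia.
  rewrite -DlZ; congr (Dl _ _); apply: funext => t; rewrite -b2Z; apply: eq_b2 => f g h _.
  by apply: T3_sg => -> -> _.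
have -> : coleibnizator (bar_cup D) (bar_br D) p q r (cp n s) =
   (c s (fun f b => K b (fun g h => T3 p q r f g h))
    - sg ((q + r).+1 * p.+1) (c s (fun b f => K b (fun g h => T3 p q r f g h))))
   - ((K s (fun a h => c a (fun f g => T3 p q r f g h))
       - sg (q.+1 * p.+1) (K s (fun a h => c a (fun g f => T3 p q r f g h))))
    + (K s (fun g b => c b (fun f h => sg (q * p.+1) (T3 p q r f g h)))
       - sg (r.+1 * p.+1) (K s (fun g b => c b (fun h f => sg (q * p.+1) (T3 p q r f g h)))))).
  rewrite /coleibnizator br_cp // !cup_cp //.
  rewrite (linear_B _ _ (lc (q + r)%N p r)) (linear_Z (lc (q + r)%N p r)) !(R_lin D (lc (q + r)%N p r)).
  rewrite (K_lin (@tmap_br_linear _ _ _ _)).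
  rewrite (K_lin (linear_comp (lb q _) (lv q p))).
  have eA f b0 : tassocV (tmap id (cup (q + r)%N q r) (T2 p (q + r) f b0)) = K b0 (fun g h => T3 p q r f g h).
    rewrite tmap_pure //; last exact: cup_linear.
    rewrite cup_cpE // (K_lin (@pure_linr _ _ _ _)) (K_lin (@tassocV_linear _ _ _ _)).
    by apply: eq_K => g h _; rewrite tassocV_pure.
  congr (_ - _ *: _ - (_ + _)).
  - by apply: eq_R => *; exact: eA.
  - by apply: eq_R => *; exact: eA.
  - rewrite -scaleN1r -!KZ -KD; apply: eq_K => a h _; rewrite tmap_pure //; last exact: br_linear.
    rewrite br_cpE (linear_B _ _ (@pure_linl _ _ _ _)).
    rewrite (linear_Z (f := fun z : tpow p \ox tpow q => z \tens cp r h) (pure_linl _)).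
    by rewrite !(R_lin D (@pure_linl _ _ _ _)) scaleN1r.
  rewrite -scaleN1r -!KZ -KD; apply: eq_K => g b _; rewrite tmap_pure //; last exact: br_linear.
  rewrite br_cpE (linear_B _ _ (@pure_linr _ _ _ _)).
  rewrite (linear_Z (f := fun z : tpow p \ox tpow r => cp q g \tens z) (pure_linr _)).
  rewrite !(R_lin D (@pure_linr _ _ _ _)).
  have l4 := linear_comp (@tassocV_linear k (tpow q) (tpow p) (tpow r)) (lv q p).
  have eB f h : tmap (@flip_varrho k tpow q p) id (tassocV (cp q g \tens T2 p r f h)) =
     sg (q * p.+1) (T3 p q r f g h).
    rewrite tassocV_pure tmap_pure //; last exact: flip_varrho_linear.
    rewrite /flip_varrho tswap_pure.
    exact: (linear_Z (f := fun z : tpow p \ox tpow q => z \tens cp r h) (pure_linl _)).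
  rewrite (linear_B _ _ l4) (linear_Z l4) !(R_lin D l4) scaleN1r.
  by congr (_ - _ *: _); apply: eq_R => *; exact: eB.
rewrite (comp_K D s (fun g h f => T3 p q r f g h)) scalerDr.
have -> : sg ((q + r).+1 * p.+1) (K s (fun a h => c a (fun g f =>
     sg ((size f).+1 * size h) (T3 p q r f g h)))) =
   sg (q.+1 * p.+1) (K s (fun a h => c a (fun g f => T3 p q r f g h))).
  rewrite -!KZ; apply: eq_K => a h _; rewrite -!cZ; apply: eq_c => g f _; rewrite sg_sg.
  by apply: T3_sg => -> _ ->; lia.
have -> : sg ((q + r).+1 * p.+1) (K s (fun g b => c b (fun h f => T3 p q r f g h))) =
   sg (r.+1 * p.+1) (K s (fun g b => c b (fun h f => sg (q * p.+1) (T3 p q r f g h)))).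
  rewrite -!KZ; apply: eq_K => g b _; rewrite -!cZ; apply: eq_c => h f _; rewrite sg_sg.
  by apply: sg_odd; lia.
have -> : K s (fun g b => c b (fun f h => sg (q * p.+1) (T3 p q r f g h))) =
  K s (fun g b => c b (fun f h => sg (size g * (size f).+1) (T3 p q r f g h))).
  by apply: eq_K => g b _; apply: eq_c => f h _; apply: T3_sg => -> -> _.
rewrite !(opprD, opprK) [LHS](AC ((1*2)*(2*2)) ((1*4*6)*(2*5)*(3*7))) /=.
by rewrite !addNr !addr0.
Qed.

Lemma coleibniz_up_to_boundary n (z : tpow n) : bdry d n z = 0 ->
  exists w0 : forall p q r, tpow p \ox tpow q \ox tpow r, forall p q r,
    coleibnizator (bar_cup D) (bar_br D) p q r z = tens3_diff d 1 w0 p q r.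
Proof.
move=> hz; exists (fun p q r => sg (p + q) (brace_lift p q r z)) => p q r.
by rewrite coleibniz_homotopy hz (linear_0 (@brace_lift_linear _ _ _ _)) scaler0 addr0.
Qed.

Theorem bar_gerstenhaber_up_to_boundaries :
  is_gerstenhaber_coalgebra_up_to_boundaries (bar_diff D) (bar_cup D) (bar_br D).
Proof.
split.
- exact: bar_diff2.
- exact: cup_linear.
- exact: cup_deg.
- exact: cup_chain.
- exact: cup_coassoc.
- exact: cup_cocomm.
- exact: br_lie_cobracket.
- exact: br_chain.
- exact: coleibniz_up_to_boundary.
Qed.

End UpTo.

(** * Naturality of the axioms *)

Section TensorMaps.
Variable k : comNzRingType.
Implicit Types M N P Q : lmodType k.

Lemma tmapM M N M' N' P Q (f' : M -> M') (g' : N -> N') (f : M' -> P) (g : N' -> Q) t :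
  linear f -> linear g ->
  tmap f g (tmap f' g' t) = tmap (fun x => f (f' x)) (fun y => g (g' y)) t.
Proof.
move=> hf hg; rewrite -[tmap f' g' t]/(\sum_(x <- (repr t : seq (M * N))) f' x.1 \tens g' x.2).
rewrite (linear_bigsum (tmap_linear hf hg)).
by apply: eq_bigr => -[x y] _ /=; exact: tmap_pure.
Qed.

Lemma eq_tmap M N P Q (f f' : M -> P) (g g' : N -> Q) t :
  (forall x, f x = f' x) -> (forall y, g y = g' y) -> tmap f g t = tmap f' g' t.
Proof. by move=> hf hg; apply: eq_bigr => -[x y] _ /=; rewrite hf hg. Qed.

Lemma tmap0l M N P Q (f : M -> P) (g : N -> Q) t : (forall x, f x = 0) -> tmap f g t = 0.
Proof. by move=> h; apply: big1 => -[x y] _ /=; rewrite h; exact: linear_0 (pure_linl _). Qed.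
Lemma tmap0r M N P Q (f : M -> P) (g : N -> Q) t : (forall x, g x = 0) -> tmap f g t = 0.
Proof. by move=> h; apply: big1 => -[x y] _ /=; rewrite h; exact: linear_0 (pure_linr _). Qed.

Lemma tmapDl M N P Q (f f' : M -> P) (g : N -> Q) t :
  tmap (fun x => f x + f' x) g t = tmap f g t + tmap f' g t.
Proof.
by rewrite -big_split; apply: eq_bigr => -[x y] _ /=; exact: linear_D (pure_linl _).
Qed.
Lemma tmapBl M N P Q (f f' : M -> P) (g : N -> Q) t :
  tmap (fun x => f x - f' x) g t = tmap f g t - tmap f' g t.
Proof.
by rewrite -sumrB; apply: eq_bigr => -[x y] _ /=; exact: linear_B (pure_linl _).
Qed.
Lemma tmapDr M N P Q (f : M -> P) (g g' : N -> Q) t :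
  tmap f (fun x => g x + g' x) t = tmap f g t + tmap f g' t.
Proof.
by rewrite -big_split; apply: eq_bigr => -[x y] _ /=; exact: linear_D (pure_linr _).
Qed.
Lemma tmapBr M N P Q (f : M -> P) (g g' : N -> Q) t :
  tmap f (fun x => g x - g' x) t = tmap f g t - tmap f g' t.
Proof.
by rewrite -sumrB; apply: eq_bigr => -[x y] _ /=; exact: linear_B (pure_linr _).
Qed.

Lemma tmap_id M N (t : M \ox N) : tmap id id t = t.
Proof. by rewrite [RHS]tensor_pureE. Qed.

Lemma tswap_tmap M N P Q (f : M -> P) (g : N -> Q) t : linear f -> linear g ->
  tswap (tmap f g t) = tmap g f (tswap t).
Proof.
move=> hf hg; move: t; apply: tensor_ext.
- exact: linear_comp (tmap_linear hf hg) (@tswap_linear _ _ _).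
- exact: linear_comp (@tswap_linear _ _ _) (tmap_linear hg hf).
by move=> x y; rewrite tmap_pure // !tswap_pure tmap_pure.
Qed.

Lemma tensor3_ext M N P Q (f g : M \ox N \ox P -> Q) : linear f -> linear g ->
  (forall x y z, f (x \tens y \tens z) = g (x \tens y \tens z)) -> forall t, f t = g t.
Proof.
move=> hf hg h; apply: tensor_ext => // t z; move: t; apply: tensor_ext => [||x y] //.
  exact: linear_comp (pure_linl z) hf.
exact: linear_comp (pure_linl z) hg.
Qed.

Lemma tensor3_ext' M N P Q (f g : M \ox (N \ox P) -> Q) : linear f -> linear g ->
  (forall x y z, f (x \tens (y \tens z)) = g (x \tens (y \tens z))) -> forall t, f t = g t.
Proof.
move=> hf hg h; apply: tensor_ext => // x t; move: t; apply: tensor_ext => [||y z] //.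
  exact: linear_comp (pure_linr x) hf.
exact: linear_comp (pure_linr x) hg.
Qed.

Lemma tassoc_tmap M N P M' N' P' (f : M -> M') (g : N -> N') (h : P -> P') t :
  linear f -> linear g -> linear h ->
  tassoc (tmap (tmap f g) h t) = tmap f (tmap g h) (tassoc t).
Proof.
move=> hf hg hh; have l1 := tmap_linear hf hg; have l2 := tmap_linear hg hh.
move: t; apply: tensor3_ext.
- exact: linear_comp (tmap_linear l1 hh) (@tassoc_linear _ _ _ _).
- exact: linear_comp (@tassoc_linear _ _ _ _) (tmap_linear hf l2).
by move=> x y z; rewrite !tmap_pure // !tassoc_pure !tmap_pure.
Qed.

Lemma tassocV_tmap M N P M' N' P' (f : M -> M') (g : N -> N') (h : P -> P') t :
  linear f -> linear g -> linear h ->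
  tassocV (tmap f (tmap g h) t) = tmap (tmap f g) h (tassocV t).
Proof.
move=> hf hg hh; have l1 := tmap_linear hf hg; have l2 := tmap_linear hg hh.
move: t; apply: tensor3_ext'.
- exact: linear_comp (tmap_linear hf l2) (@tassocV_linear _ _ _ _).
- exact: linear_comp (@tassocV_linear _ _ _ _) (tmap_linear l1 hh).
by move=> x y z; rewrite !tmap_pure // !tassocV_pure !tmap_pure.
Qed.
End TensorMaps.

Section Naturality.
Variables (k : comNzRingType) (V W : nat -> lmodType k) (rho : forall n, V n -> W n).
Hypothesis rho_lin : forall n, linear (@rho n).

Definition rho2 p q : V p \ox V q -> W p \ox W q := tmap (@rho p) (@rho q).
Definition rho3 p q r : V p \ox V q \ox V r -> W p \ox W q \ox W r := tmap (@rho2 p q) (@rho r).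

Lemma rho2_lin p q : linear (@rho2 p q).
Proof. exact: tmap_linear. Qed.
Lemma rho3_lin p q r : linear (@rho3 p q r).
Proof. by apply: tmap_linear => //; exact: rho2_lin. Qed.

Lemma flip_rho_nat p q t : flip_rho (@rho2 p q t) = rho2 (flip_rho t).
Proof. by rewrite /flip_rho tswap_tmap // (linear_Z (@rho2_lin _ _)). Qed.
Lemma flip_tau_nat p q t : flip_tau (@rho2 p q t) = rho2 (flip_tau t).
Proof. by rewrite /flip_tau tswap_tmap // (linear_Z (@rho2_lin _ _)). Qed.
Lemma flip_varrho_nat p q t : flip_varrho (@rho2 p q t) = rho2 (flip_varrho t).
Proof. by rewrite /flip_varrho tswap_tmap // (linear_Z (@rho2_lin _ _)). Qed.

Lemma varrho12_nat p q r t :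
  tmap (@flip_varrho k W p q) id (@rho3 p q r t) = rho3 (tmap (@flip_varrho k V p q) id t).
Proof.
rewrite /rho3 !tmapM //; [|exact: rho2_lin | exact: flip_varrho_linear].
by apply: eq_tmap => // x; rewrite flip_varrho_nat.
Qed.
Lemma rho12_nat p q r t : rho12 (@rho3 p q r t) = rho3 (rho12 t).
Proof.
rewrite /rho12 /rho3 !tmapM //; [|exact: rho2_lin | exact: flip_rho_linear].
by apply: eq_tmap => // x; rewrite flip_rho_nat.
Qed.
Lemma rho23_nat p q r t : rho23 (@rho3 p q r t) = rho3 (rho23 t).
Proof.
rewrite /rho23 /rho3 /rho2 tassoc_tmap // -tassocV_tmap // !tmapM //; last 2 first.
- exact: (@rho2_lin _ _).
- exact: flip_rho_linear.
by congr tassocV; apply: eq_tmap => // x; rewrite flip_rho_nat.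
Qed.

Section OnElement.
Variables (n : nat) (z : V n).

(* The second and third conditions allow [F] to be compatible with [f] only on the
   factors that occur in the image of [z]: on homology, [F] is not a chain-level map. *)
Definition agrees (f : coop V) (F : coop W) :=
  forall p q, F n p q (rho z) = rho2 (f n p q z).
Definition agrees_l (f g : coop V) (F : coop W) := forall a p q e,
  tmap (F a p q) id (rho2 (g n a e z)) = rho3 (tmap (f a p q) id (g n a e z)).
Definition agrees_r (f g : coop V) (F : coop W) := forall a p q e,
  tassocV (tmap id (F a p q) (rho2 (g n e a z))) =
  rho3 (tassocV (tmap id (f a p q) (g n e a z))).

Lemma coassociator_nat (f : coop V) (F : coop W) p q r :
  agrees f F -> agrees_l f f F -> agrees_r f f F ->
  coassociator F p q r (rho z) = rho3 (coassociator f p q r z).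
Proof. by move=> h hl hr; rewrite /coassociator !h hl hr (linear_B _ _ (@rho3_lin _ _ _)). Qed.

Lemma cocommutator_nat (f : coop V) (F : coop W) p q :
  agrees f F -> cocommutator F p q (rho z) = rho2 (cocommutator f p q z).
Proof. by move=> h; rewrite /cocommutator !h flip_tau_nat (linear_B _ _ (@rho2_lin _ _)). Qed.

Lemma cojacobiator_nat (f : coop V) (F : coop W) p q r :
  agrees f F -> agrees_l f f F ->
  cojacobiator F p q r (rho z) = rho3 (cojacobiator f p q r z).
Proof.
move=> h hl; rewrite /cojacobiator !h !hl !rho12_nat !rho23_nat rho12_nat.
by rewrite !(linear_D _ _ (@rho3_lin _ _ _)).
Qed.

Lemma coleibnizator_nat (f g : coop V) (F G : coop W) p q r :
  agrees f F -> agrees g G -> agrees_r f g F -> agrees_l g f G -> agrees_r g f G ->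
  coleibnizator F G p q r (rho z) = rho3 (coleibnizator f g p q r z).
Proof.
move=> hf hg h1 h2 h3; rewrite /coleibnizator !hf !hg h1 h2 h3 varrho12_nat.
by rewrite (linear_B _ _ (@rho3_lin _ _ _)) (linear_D _ _ (@rho3_lin _ _ _)).
Qed.
End OnElement.
End Naturality.

Section Transport.
Variables (k : comNzRingType) (V W : nat -> lmodType k) (rho : forall n, V n -> W n).
Hypothesis rho_lin : forall n, linear (@rho n).
Variable sigma : forall n, W n -> V n.
Hypothesis rhoK : forall n, cancel (@rho n) (@sigma n).
Hypothesis sigmaK : forall n, cancel (@sigma n) (@rho n).
Arguments sigma {n}.
Arguments rho {n}.

Lemma sigma_lin n : linear (@sigma n).
Proof. by move=> a x y; apply: (can_inj (@rhoK n)); rewrite rho_lin !sigmaK. Qed.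

Definition transport (f : coop V) : coop W := fun n p q x => tmap rho rho (f n p q (sigma x)).

Lemma transportE f n p q x : transport f p q (@rho n x) = tmap rho rho (f n p q x).
Proof. by rewrite /transport rhoK. Qed.

Lemma transport_linear f : (forall n p q, linear (f n p q)) ->
  forall n p q, linear (@transport f n p q).
Proof.
move=> h n p q.
exact: (linear_comp (linear_comp (@sigma_lin n) (h n p q)) (tmap_linear (@rho_lin p) (@rho_lin q))).
Qed.

Lemma transport_l f g n z : (forall n p q, linear (f n p q)) ->
  agrees_l (@rho) (n := n) z f g (transport f).
Proof.
move=> h a p q e; rewrite /rho3 /rho2 !tmapM //; last exact: transport_linear.
  by apply: eq_tmap => // x; exact: transportE.
exact: tmap_linear.
Qed.

Lemma transport_r f g n z : (forall n p q, linear (f n p q)) ->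
  agrees_r (@rho) (n := n) z f g (transport f).
Proof.
move=> h a p q e; rewrite /rho3 /rho2 -tassocV_tmap // !tmapM //; last exact: transport_linear.
  by congr tassocV; apply: eq_tmap => // x; exact: transportE.
exact: tmap_linear.
Qed.

Lemma transport_agrees f n z : agrees (@rho) (n := n) z f (transport f).
Proof. by move=> p q; exact: transportE. Qed.

Lemma transport_gerstenhaber f g : is_gerstenhaber_coalgebra f g ->
  is_gerstenhaber_coalgebra (transport f) (transport g).
Proof.
case=> -[f1 f2 f3 f4] [g1 g2 g3 g4] hl.
have r2 p q := linear_0 (@rho2_lin _ _ _ (@rho) rho_lin p q).
have r3 p q r := linear_0 (@rho3_lin _ _ _ (@rho) rho_lin p q r).
split; first split.
- exact: transport_linear.
- by move=> n p q x e; rewrite /transport f2 //; exact: r2.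
- move=> n p q r x; rewrite -(sigmaK x) (@coassociator_nat _ _ _ (@rho) rho_lin n (sigma x) f) ?f3 ?r3 //.
  + exact: transport_agrees.
  + exact: transport_l.
  + exact: transport_r.
- by move=> n p q x; rewrite -(sigmaK x) (@cocommutator_nat _ _ _ (@rho) rho_lin n (sigma x) f) ?f4 ?r2 //; exact: transport_agrees.
- split.
  + exact: transport_linear.
  + by move=> n p q x e; rewrite /transport g2 //; exact: r2.
  + move=> n x; have [w hw] := g3 n (sigma x); exists (fun p q => rho2 (@rho) (w p q)) => p q e.
    rewrite -{1}(sigmaK x) transportE hw // flip_rho_nat //.
    exact: (linear_B _ _ (@rho2_lin _ _ _ (@rho) rho_lin p q)).
  + move=> n p q r x; rewrite -(sigmaK x) (@cojacobiator_nat _ _ _ (@rho) rho_lin n (sigma x) g) ?g4 ?r3 //.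
      exact: transport_agrees.
    exact: transport_l.
move=> n p q r x; rewrite -(sigmaK x) (@coleibnizator_nat _ _ _ (@rho) rho_lin n (sigma x) f g) ?hl ?r3 //.
- exact: transport_agrees.
- exact: transport_agrees.
- exact: transport_r.
- exact: transport_l.
- exact: transport_r.
Qed.

Lemma transport_counit f (eps : V 0 -> k^o) : is_counit f eps ->
  is_counit (transport f) (fun x => eps (sigma x)).
Proof.
case=> el h1 h2; have es := linear_comp (@sigma_lin 0) el.
split=> // n x.
- rewrite -[RHS](sigmaK x) -[in RHS](h1 n (sigma x)) (linear_bigsum (@rho_lin n)) /transport.
  rewrite {1}/tmap (linear_bigsum (tlift_linear _)); last first.
    by split=> [y|a]; [move=> b u v; rewrite es scalerDl -scalerA | exact: scale_lin].
  apply: eq_bigr => -[a y] _ /=; rewrite tlift_pure; last first.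
    by split=> [y'|a']; [move=> b u v; rewrite es scalerDl -scalerA | exact: scale_lin].
  by rewrite rhoK (linear_Z (@rho_lin n)).
rewrite -[RHS](sigmaK x) -[in RHS](h2 n (sigma x)) (linear_bigsum (@rho_lin n)) /transport.
rewrite {1}/tmap (linear_bigsum (tlift_linear _)); last first.
  by split=> [y|a]; [exact: scale_lin | move=> b u v; rewrite es scalerDl -scalerA].
apply: eq_bigr => -[y a] _ /=; rewrite tlift_pure; last first.
  by split=> [y'|a']; [exact: scale_lin | move=> b u v; rewrite es scalerDl -scalerA].
by rewrite rhoK (linear_Z (@rho_lin n)).
Qed.
End Transport.

Lemma linear_N (k : comNzRingType) (M N : lmodType k) (f : M -> N) x : linear f -> f (- x) = - f x.
Proof. by move=> h; rewrite -[- x]sub0r (linear_B _ _ h) (linear_0 h) sub0r. Qed.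

Lemma linear_fun (k : comNzRingType) (M N : lmodType k) (f : {linear M -> N}) : linear f.
Proof. exact: linearP. Qed.

(** * Homology of a split complex *)

Section Cycles.
Variables (k : comNzRingType) (V : nat -> lmodType k) (d : forall n, {linear V n.+1 -> V n}).

Lemma kval_linear n : linear (@kval k _ _ (bdry d n)).
Proof. by []. Qed.

Lemma cycleP n (z : cycles d n) : bdry d n (kval z) = 0.
Proof. by have /eqP := kvalP z. Qed.

Lemma cycle_in n (x : V n) : bdry d n x = 0 -> x \in ker_pred (bdry d n).
Proof. by move=> h; apply/eqP. Qed.

Definition mkcycle n (x : V n) (h : bdry d n x = 0) : cycles d n := Ker (cycle_in h).

Lemma hproj_linear n : linear (@hproj k V d n).
Proof. exact: qpi_linear. Qed.

Lemma hproj_surj n (h : homology d n) : exists z, hproj z = h.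
Proof. by exists (repr h); exact: qrepr. Qed.

Lemma hproj_eq n (z t : cycles d n) y : kval z - kval t = d n y -> hproj z = hproj t.
Proof. by move=> e; apply/qpiP/qspan_gen; exists y. Qed.
End Cycles.

Section SplitHomology.
Variables (k : comNzRingType) (V : nat -> lmodType k) (d : forall n, {linear V n.+1 -> V n}).
Hypothesis dd : forall n x, d n (d n.+1 x) = 0.
Variable s : forall n, {linear V n -> V n.+1}.
Hypothesis dsd : forall n (x : V n.+1), d n (s n (d n x)) = d n x.
Local Notation H := (homology d).

(* The splitting [s], with a source of degree [n - 1]; zero for [n = 0]. *)
Definition sbdry n : V n.-1 -> V n :=
  match n with 0 => fun=> 0 | m.+1 => s m end.

Lemma sbdry_linear n : linear (@sbdry n).
Proof. by case: n => [|n]; [exact: linear_zero | exact: linearP]. Qed.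

Lemma bdry_d n x : bdry d n (d n x) = 0.
Proof. by case: n x => [|n] x; [|exact: dd]. Qed.

Lemma proj_cycle n x : bdry d n (x - sbdry (bdry d n x)) = 0.
Proof. by case: n x => [|n] x //; rewrite linearB /= dsd subrr. Qed.

Lemma proj_linear n : linear (fun x : V n => x - sbdry (bdry d n x)).
Proof. exact: (linear_sub (@linear_id _ _) (linear_comp (linear_fun (bdry d n)) (@sbdry_linear n))). Qed.

Definition hcls n (x : V n) : H n := hproj (mkcycle (proj_cycle x)).

Lemma hcls_linear n : linear (@hcls n).
Proof.
move=> a x y; rewrite /hcls -(@hproj_linear _ _ d); congr hproj; apply: val_inj .
exact: (@proj_linear n).
Qed.

Lemma hcls_kval n (z : cycles d n) : hcls (kval z) = hproj z.
Proof.
congr hproj; apply: val_inj; rewrite /= cycleP (linear_0 (@sbdry_linear n)).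
exact: subr0.
Qed.

Lemma hcls_d n y : hcls (d n y) = 0.
Proof.
rewrite -(linear_0 (@hproj_linear _ _ d n)); apply: (@hproj_eq _ _ _ _ _ _ y) => /=.
by rewrite bdry_d (linear_0 (@sbdry_linear n)) !subr0.
Qed.

Definition nf n (z : cycles d n) : V n := kval z - d n (s n (kval z)).
Lemma nf_linear n : linear (@nf n).
Proof.
exact: (linear_sub (@kval_linear _ _ d n) (linear_comp (linear_comp (@kval_linear _ _ d n) (linear_fun (s n))) (linear_fun (d n)))).
Qed.
HB.instance Definition _ n := GRing.isLinear.Build k (cycles d n) (V n) *:%R (@nf n) (@nf_linear n).

Definition hlift n : H n -> V n := qlift (@nf n).

Lemma nf_bdry n (z : cycles d n) : (exists y, d n y = kval z) -> nf z = 0.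
Proof. by case=> y e; rewrite /nf -e dsd subrr. Qed.

Lemma lift_linear n : linear (@hlift n).
Proof. exact: (qlift_linear (@nf_bdry n)). Qed.

Lemma lift_hproj n (z : cycles d n) : hlift (hproj z) = kval z - d n (s n (kval z)).
Proof. exact: (qlift_pi (@nf_bdry n)). Qed.

Lemma lift_cycle n (h : H n) : bdry d n (hlift h) = 0.
Proof. by have [z <-] := hproj_surj h; rewrite lift_hproj linearB /= cycleP bdry_d subrr. Qed.

Lemma hcls_lift n (h : H n) : hcls (hlift h) = h.
Proof.
have [z <-] := hproj_surj h.
by rewrite lift_hproj (linear_B _ _ (@hcls_linear n)) hcls_d hcls_kval subr0.
Qed.

Definition htpy n (x : V n) : V n.+1 := s n (x - sbdry (bdry d n x)).
Lemma htpy_linear n : linear (@htpy n).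
Proof. exact: linear_comp (@proj_linear n) (linear_fun (s n)). Qed.

Lemma lift_hcls n (x : V n) : hlift (hcls x) = x - (d n (htpy x) + sbdry (bdry d n x)).
Proof. by rewrite /hcls lift_hproj /= opprD addrA -addrAC. Qed.

Lemma lift_hclsE n (x : V n) : x = hlift (hcls x) + (d n (htpy x) + sbdry (bdry d n x)).
Proof. by rewrite lift_hcls subrK. Qed.

Lemma lift_hcls_lin n : linear (fun x : V n => hlift (hcls x)).
Proof. exact: linear_comp (@hcls_linear n) (@lift_linear n). Qed.

Lemma htpy_d n (x : V n.+1) : htpy (d n x) = s n (d n x).
Proof. by rewrite /htpy bdry_d (linear_0 (@sbdry_linear n)) subr0. Qed.

Local Notation cls2 := (rho2 (@hcls)).
Local Notation cls3 := (rho3 (@hcls)).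
Local Notation cls2_linear := (rho2_lin (@hcls_linear)).
Local Notation cls3_linear := (rho3_lin (@hcls_linear)).

Lemma cls2_dl p q t : cls2 (tmap (d p) (id : V q -> V q) t) = 0.
Proof. by rewrite /rho2 (tmapM _ _ _ (@hcls_linear p) (@hcls_linear q)) tmap0l // => x; exact: hcls_d. Qed.
Lemma cls2_dr p q t : cls2 (tmap (id : V p -> V p) (d q) t) = 0.
Proof. by rewrite /rho2 (tmapM _ _ _ (@hcls_linear p) (@hcls_linear q)) tmap0r // => x; exact: hcls_d. Qed.

Lemma cls2_tens_diff e (w : forall p q, V p \ox V q) p q : cls2 (tens_diff d e w p q) = 0.
Proof.
rewrite /tens_diff (linear_D _ _ (@cls2_linear p q)) (linear_Z (@cls2_linear p q)).
by rewrite cls2_dl cls2_dr scaler0 addr0.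
Qed.

Lemma cls3_tens_diff e (w : forall p q r, V p \ox V q \ox V r) p q r :
  cls3 (tens3_diff d e w p q r) = 0.
Proof.
rewrite /tens3_diff !(linear_D _ _ (@cls3_linear p q r)) !(linear_Z (@cls3_linear p q r)).
rewrite /rho3 !(tmapM _ _ _ (@cls2_linear p q) (@hcls_linear r)).
rewrite tmap0l; last exact: cls2_dl.
rewrite tmap0l; last exact: cls2_dr.
by rewrite tmap0r ?scaler0 ?addr0 // => x; exact: hcls_d.
Qed.

Section Closed.
Variables (e : nat) (F : forall p q, V p \ox V q).
Hypothesis F_closed : forall p q, tens_diff d e F p q = 0.

Lemma closed_dl p q : tmap (d p) id (F p.+1 q) = - ((-1) ^+ (p + e) *: tmap id (d q) (F p q.+1)).
Proof. by apply/eqP; rewrite -addr_eq0; apply/eqP; exact: F_closed. Qed.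

Lemma closed_dr p q : tmap id (d q) (F p q.+1) = - ((-1) ^+ (p + e) *: tmap (d p) id (F p.+1 q)).
Proof.
by rewrite closed_dl scalerN opprK scalerA -exprD addnn -mul2n mulnC exprM sqrr_sign scale1r.
Qed.

Lemma closed_sbdryl (P Q : lmodType k) p q (L : V p -> P) (T : V q -> Q) : linear L -> linear T ->
  (forall x, T (d q x) = 0) -> tmap (fun x => L (sbdry (bdry d p x))) T (F p q) = 0.
Proof.
move=> hL hT h; have L0 := linear_0 hL; case: p L hL L0 => [|p] L hL L0 /=; first exact: tmap0l.
rewrite -[LHS](tmapM (d p) id (f := fun x => L (s p x)) _) //; last first.
  exact: linear_comp (linear_fun (s p)) hL.
have hLs : linear (fun x => L (s p x)).
  exact: linear_comp (linear_fun (s p)) hL.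
rewrite closed_dl (linear_N _ (tmap_linear hLs hT)) (linear_Z (tmap_linear hLs hT)).
by rewrite tmapM // tmap0r // scaler0 oppr0.
Qed.

Lemma closed_sbdryr (P Q : lmodType k) p q (L : V p -> P) (T : V q -> Q) : linear L -> linear T ->
  (forall x, L (d p x) = 0) -> tmap L (fun x => T (sbdry (bdry d q x))) (F p q) = 0.
Proof.
move=> hL hT h; have T0 := linear_0 hT; case: q T hT T0 => [|q] T hT T0 /=; first exact: tmap0r.
have hTs : linear (fun x => T (s q x)) := linear_comp (linear_fun (s q)) hT.
rewrite -[LHS](tmapM id (d q) (f := L) (g := fun x => T (s q x)) _) //.
rewrite closed_dr (linear_N _ (tmap_linear hL hTs)) (linear_Z (tmap_linear hL hTs)).
by rewrite tmapM // tmap0l // scaler0 oppr0.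
Qed.

Definition kuenneth_htpy p q : V p \ox V q :=
  match p with 0 => fun=> 0 | p'.+1 => fun q => tmap (@htpy p') id (F p' q) end q
  + match q with 0 => 0 | q'.+1 =>
      (-1) ^+ (p + e) *: tmap (fun x => hlift (hcls x)) (@htpy q') (F p q') end.

(* A closed tensor differs from its projection to the chosen cycles by a boundary. *)
Lemma kuenneth_htpyE p q :
  F p q = tmap (fun x => hlift (hcls x)) (fun x => hlift (hcls x)) (F p q)
          + tens_diff d e kuenneth_htpy p q.
Proof.
have tl a b (f : V a -> V a) : linear f -> linear (tmap f (id : V b -> V b)).
  by move=> h; exact: tmap_linear.
have dH a : linear (fun x : V a => d a (htpy x)).
  exact: linear_comp (@htpy_linear a) (linear_fun (d a)).
have E1 : tmap (d p) id (kuenneth_htpy p.+1 q) = tmap (fun x => d p (htpy x)) id (F p q).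
  rewrite /kuenneth_htpy (linear_D _ _ (tmap_linear (linear_fun (d p)) (@linear_id _ _))).
  rewrite (tmapM _ _ _ (linear_fun (d p)) (@linear_id _ _)).
  case: q => [|q]; first by rewrite (linear_0 (tmap_linear (linear_fun (d p)) (@linear_id _ _))) addr0.
  rewrite (linear_Z (tmap_linear (linear_fun (d p)) (@linear_id _ _))).
  rewrite (tmapM _ _ _ (linear_fun (d p)) (@linear_id _ _)) [X in _ + _ *: X]tmap0l ?scaler0 ?addr0 // => x.
  exact: (lift_cycle (n := p.+1)).
have ld := tmap_linear (@linear_id _ (V p)) (linear_fun (d q)).
have E2 : (-1) ^+ (p + e) *: tmap id (d q) (kuenneth_htpy p q.+1) =
    tmap (fun x => sbdry (bdry d p x)) id (F p q)
    + tmap (fun x => hlift (hcls x)) (fun x => d q (htpy x)) (F p q).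
  rewrite /kuenneth_htpy (linear_D _ _ ld) scalerDr; congr (_ + _); last first.
    rewrite (linear_Z ld) scalerA -exprD addnn -mul2n mulnC exprM sqrr_sign scale1r.
    by rewrite (tmapM _ _ _ (@linear_id _ _) (linear_fun (d q))).
  case: p {tl dH E1} ld => [|p] ld; first by rewrite (linear_0 ld) scaler0 [RHS]tmap0l.
  rewrite (tmapM _ _ _ (@linear_id _ _) (linear_fun (d q))).
  transitivity (tmap (@htpy p) id (tmap (d p) id (F p.+1 q))).
    rewrite closed_dl (linear_N _ (tmap_linear (@htpy_linear p) (@linear_id _ _))).
    rewrite (linear_Z (tmap_linear (@htpy_linear p) (@linear_id _ _))).
    rewrite (tmapM _ _ _ (@htpy_linear p) (@linear_id _ _)).
    by rewrite addSn exprS mulN1r scaleNr.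
  rewrite (tmapM _ _ _ (@htpy_linear p) (@linear_id _ _)).
  by apply: eq_tmap => // x; rewrite htpy_d.
rewrite /tens_diff E1 E2.
have E3 : tmap (fun x => hlift (hcls x)) (fun x => sbdry (bdry d q x)) (F p q) = 0.
  apply: (closed_sbdryr (@lift_hcls_lin p) (@linear_id _ _)) => x.
  by rewrite hcls_d (linear_0 (@lift_linear p)).
rewrite -{1}[F p q]tmap_id.
rewrite [LHS](eq_tmap (f' := fun x => hlift (hcls x) + (d p (htpy x) + sbdry (bdry d p x))) (g' := id)) //; last first.
  by move=> x; rewrite -lift_hclsE.
rewrite (tmapDl (fun x => hlift (hcls x))) (tmapDl (fun x => d p (htpy x))).
rewrite [X in X + _](eq_tmap (f' := fun x => hlift (hcls x)) (g' := fun x => hlift (hcls x) + (d q (htpy x) + sbdry (bdry d q x)))) //; last first.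
  by move=> x; rewrite -lift_hclsE.
by rewrite (tmapDr _ (fun x => hlift (hcls x))) (tmapDr _ (fun x => d q (htpy x))) E3 addr0 -!addrA; congr (_ + _); rewrite addrC -addrA.
Qed.
End Closed.

Section InducedOperation.
Variable e : nat.
Unset Implicit Arguments.
Variable f : coop V.
Set Implicit Arguments.
Hypothesis f_lin : forall n p q, linear (f n p q).
Hypothesis f_chain : forall n p q (x : V n),
  tens_diff d e (fun p q => f n p q x) p q = f n.-1 p q (bdry d n x).

Lemma f_closed n (z : V n) : bdry d n z = 0 ->
  forall p q, tens_diff d e (fun p q => f n p q z) p q = 0.
Proof. by move=> h p q; rewrite f_chain h (linear_0 (@f_lin _ _ _)). Qed.

Definition hop : coop H := fun n p q h => cls2 (f n p q (hlift h)).

Lemma hop_linear n p q : linear (@hop n p q).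
Proof. exact: (linear_comp (linear_comp (@lift_linear n) (@f_lin n p q)) (@cls2_linear p q)). Qed.

Lemma cls_f_d n p q y : cls2 (f n p q (d n y)) = 0.
Proof. by rewrite -(f_chain p q (y : V n.+1)) cls2_tens_diff. Qed.

Lemma hop_cls n p q (x : V n) :
  hop p q (hcls x) = cls2 (f n p q x) - cls2 (f n p q (sbdry (bdry d n x))).
Proof.
rewrite /hop lift_hcls (linear_B _ _ (@f_lin n p q)) (linear_D _ _ (@f_lin n p q)).
by rewrite (linear_B _ _ (@cls2_linear p q)) (linear_D _ _ (@cls2_linear p q)) cls_f_d add0r.
Qed.

Lemma hop_agrees n (z : V n) : bdry d n z = 0 -> agrees (@hcls) z f hop.
Proof.
move=> h p q; rewrite hop_cls h (linear_0 (@sbdry_linear n)) (linear_0 (@f_lin n p q)).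
by rewrite (linear_0 (@cls2_linear p q)) subr0.
Qed.

Lemma hop_agrees_l e' (g : coop V) n (z : V n) :
  (forall p q, tens_diff d e' (fun p q => g n p q z) p q = 0) ->
  agrees_l (@hcls) z f g hop.
Proof.
move=> hg a p q b; rewrite /rho3 [rho2 _ (g _ _ _ _)]/rho2.
rewrite (tmapM _ _ _ (@hop_linear a p q) (@linear_id _ _)) (tmapM _ _ _ (@cls2_linear p q) (@hcls_linear b)).
rewrite (eq_tmap (f' := fun x => cls2 (f a p q x) - cls2 (f a p q (sbdry (bdry d a x)))) (g' := @hcls b)) //; last first.
  by move=> x; exact: hop_cls.
rewrite tmapBl (closed_sbdryl hg (linear_comp (@f_lin a p q) (@cls2_linear p q)) (@hcls_linear b) (@hcls_d b)).
exact: subr0.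
Qed.

Lemma hop_agrees_r e' (g : coop V) n (z : V n) :
  (forall p q, tens_diff d e' (fun p q => g n p q z) p q = 0) ->
  agrees_r (@hcls) z f g hop.
Proof.
move=> hg a p q b; rewrite /rho3 /rho2 -tassocV_tmap; try exact: (@hcls_linear _); congr tassocV.
rewrite (tmapM _ _ _ (@linear_id _ _) (@hop_linear a p q)) (tmapM _ _ _ (@hcls_linear b) (@cls2_linear p q)).
rewrite (eq_tmap (f' := @hcls b) (g' := fun x => cls2 (f a p q x) - cls2 (f a p q (sbdry (bdry d a x))))) //; last first.
  by move=> x; exact: hop_cls.
rewrite tmapBr (closed_sbdryr hg (@hcls_linear b) (linear_comp (@f_lin a p q) (@cls2_linear p q)) (@hcls_d b)).
exact: subr0.
Qed.

Lemma hop_induced : induces e f hop.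
Proof.
move=> n z; have hz := f_closed (cycleP z).
pose c p (x : V p) : cycles d p := mkcycle (lift_cycle (hcls x)).
have cl p : linear (@c p).
  by move=> a x y; apply: val_inj; exact: (@lift_hcls_lin p).
exists (fun p q => tmap (@c p) (@c q) (f n p q (kval z))), (kuenneth_htpy e (fun p q => f n p q (kval z))) => p q.
split.
  rewrite (tmapM _ _ _ (@kval_linear _ _ d p) (@kval_linear _ _ d q)) {1}(kuenneth_htpyE hz p q).
  by [].
rewrite (tmapM _ _ _ (@hproj_linear _ _ d p) (@hproj_linear _ _ d q)) -hcls_kval (hop_agrees (cycleP z)).
by apply: eq_tmap => x; rewrite -hcls_kval hcls_lift.
Qed.

Lemma induced_unique g : induces e f g -> forall n p q h, g n p q h = hop p q h.
Proof.
move=> hg n p q h; have [z <-] := hproj_surj h; have [y [w /(_ p q) [e1 ->]]] := hg n z.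
rewrite -hcls_kval (hop_agrees (cycleP z)) e1 (linear_D _ _ (@cls2_linear p q)) cls2_tens_diff addr0.
rewrite /rho2 (tmapM _ _ _ (@hcls_linear p) (@hcls_linear q)).
by apply: eq_tmap => x; rewrite hcls_kval.
Qed.

Lemma hop_counit (eps : V 0 -> k^o) : is_counit f eps -> (forall y, eps (d 0 y) = 0) ->
  is_counit hop (fun h => eps (hlift h)).
Proof.
case=> el h1 h2 ed; have es := linear_comp (@lift_linear 0) el.
have ec x : eps (hlift (hcls x)) = eps x.
  rewrite lift_hcls (linear_B _ _ el) (linear_D _ _ el) ed add0r /= (linear_0 el).
  exact: subr0.
have b1 (M : lmodType k) : bilinear_fun (fun (a : H 0) (y : M) => (eps (hlift a) : k) *: y).
  by split=> [y|a]; [move=> b u v; rewrite es scalerDl -scalerA | exact: scale_lin].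
have b2 (M : lmodType k) : bilinear_fun (fun (y : M) (a : H 0) => (eps (hlift a) : k) *: y).
  by split=> [y|a]; [exact: scale_lin | move=> b u v; rewrite es scalerDl -scalerA].
split=> // n h.
- rewrite -[in RHS](hcls_lift h) -[in RHS](h1 n (hlift h)) (linear_bigsum (@hcls_linear n)) /hop.
  rewrite /rho2 {1}/tmap (linear_bigsum (tlift_linear (b1 _))).
  apply: eq_bigr => -[a y] _ /=; rewrite tlift_pure; last exact: b1.
  by rewrite ec (linear_Z (@hcls_linear n)).
rewrite -[in RHS](hcls_lift h) -[in RHS](h2 n (hlift h)) (linear_bigsum (@hcls_linear n)) /hop.
rewrite /rho2 {1}/tmap (linear_bigsum (tlift_linear (b2 _))).
apply: eq_bigr => -[y a] _ /=; rewrite tlift_pure; last exact: b2.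
by rewrite ec (linear_Z (@hcls_linear n)).
Qed.
End InducedOperation.

Lemma hop_gerstenhaber cup br : is_gerstenhaber_coalgebra_up_to_boundaries d cup br ->
  is_gerstenhaber_coalgebra (hop cup) (hop br).
Proof.
case=> _ cl cdeg cch cass ccom [bl bdeg bim bjac] bch lei.
have c0 p q := linear_0 (@cls2_linear p q); have c3 p q r := linear_0 (@cls3_linear p q r).
have cc n (h : H n) := f_closed cl cch (lift_cycle h).
have bc n (h : H n) := f_closed bl bch (lift_cycle h).
split; first split.
- exact: hop_linear.
- by move=> n p q h hn; rewrite /hop cdeg ?c0.
- move=> n p q r h; rewrite -(hcls_lift h) (coassociator_nat (@hcls_linear) (f := cup)).
  + by rewrite cass; exact: c3.
  + exact (hop_agrees cl cch (lift_cycle h)).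
  + exact (hop_agrees_l cl cch (cc n h)).
  + exact (hop_agrees_r cl cch (cc n h)).
- move=> n p q h; rewrite -(hcls_lift h) (cocommutator_nat (@hcls_linear) (f := cup)).
    by have [w ->] := ccom n (hlift h) (lift_cycle h); exact: cls2_tens_diff.
  exact (hop_agrees cl cch (lift_cycle h)).
- split.
  + exact: hop_linear.
  + by move=> n p q h hn; rewrite /hop bdeg ?c0.
  + move=> n h; have [w hw] := bim n (hlift h); exists (fun p q => cls2 (w p q)) => p q hn.
    by rewrite /hop hw // (flip_rho_nat (@hcls_linear)) (linear_B _ _ (@cls2_linear p q)).
  + move=> n p q r h; rewrite -(hcls_lift h) (cojacobiator_nat (@hcls_linear) (f := br)).
    * by rewrite bjac; exact: c3.
    * exact (hop_agrees bl bch (lift_cycle h)).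
    * exact (hop_agrees_l bl bch (bc n h)).
move=> n p q r h; rewrite -(hcls_lift h) (coleibnizator_nat (@hcls_linear) (f := cup) (g := br)).
- by have [w ->] := lei n (hlift h) (lift_cycle h); exact: cls3_tens_diff.
- exact (hop_agrees cl cch (lift_cycle h)).
- exact (hop_agrees bl bch (lift_cycle h)).
- exact (hop_agrees_r cl cch (bc n h)).
- exact (hop_agrees_l bl bch (cc n h)).
- exact (hop_agrees_r bl bch (cc n h)).
Qed.
End SplitHomology.

Section BarHomology.
Variables (k : comNzRingType) (B : algType k) (D : bialgebra B).
Local Notation tpow := (tpow B).
Local Notation cp := (@cp k B).
Local Notation d := (bar_diff D).

Lemma bar_diff0 z : d 0 z = 0.
Proof.
rewrite [LHS](_ : _ = bar_fun D z) // /bar_fun !big_ord_recl big_ord0 /= addr0.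
by rewrite expr1 scaleN1r scale1r subrr.
Qed.

Lemma bar_counit : is_counit (bar_cup D) (id : tpow 0 -> k^o).
Proof.
have b1 (M : lmodType k) : bilinear_fun (fun (a : k^o) (y : M) => (a : k) *: y).
  by split=> [y|a]; [move=> b u v; rewrite scalerDl scalerA | exact: scale_lin].
have b2 (M : lmodType k) : bilinear_fun (fun (y : M) (a : k^o) => (a : k) *: y).
  by split=> [y|a]; [exact: scale_lin | move=> b u v; rewrite scalerDl scalerA].
split=> // n z.
- move: z; apply: tpow_ext; [exact: (linear_comp (@cup_linear _ _ D n 0 n) (tlift_linear (b1 _)))|by []|].
  move=> s hs; rewrite cup_cpE // (K_lin (tlift_linear (b1 _))) K_l0 => [|[|x u] v] //.
    by rewrite /T2 tlift_pure; [exact: scale1r | exact: b1].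
  move=> _; rewrite /T2 tlift_pure; [exact: scale0r | exact: b1].
move: z; apply: tpow_ext; [exact: (linear_comp (@cup_linear _ _ D n n 0) (tlift_linear (b2 _)))|by []|].
move=> s hs; rewrite cup_cpE ?addn0 // (K_lin (tlift_linear (b2 _))) K_r0 => [|u [|x v]] //.
  by rewrite /T2 tlift_pure; [exact: scale1r | exact: b2].
move=> _; rewrite /T2 tlift_pure; [exact: scale0r | exact: b2].
Qed.

Lemma bar_homology_gerstenhaber : split_complex d ->
  exists (cup br : coop (bar_homology D)) (eps : bar_homology D 0 -> k^o),
    [/\ induces 0 (bar_cup D) cup, induces 1 (bar_br D) br,
        forall z : cycles d 0, eps (hproj z) = kval z,
        forall cup' br' : coop (bar_homology D),
          induces 0 (bar_cup D) cup' -> induces 1 (bar_br D) br' ->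
          forall n p q x, cup' n p q x = cup n p q x /\ br' n p q x = br n p q x
      & is_gerstenhaber_coalgebra cup br /\ is_counit cup eps].
Proof.
have hB := bar_gerstenhaber_up_to_boundaries D.
case: (hB) => dd cl _ cc _ _ [bl _ _ _] bc _ [s hs].
exists (hop hs (bar_cup D)), (hop hs (bar_br D)), (fun h => hlift s h); split.
- exact: hop_induced.
- exact: hop_induced.
- by move=> z; rewrite (lift_hproj hs) bar_diff0 subr0.
- move=> cup' br' h1 h2 n p q h; split.
    exact: (induced_unique dd hs cl cc h1).
  exact: (induced_unique dd hs bl bc h2).
split; first exact: hop_gerstenhaber.
exact: (hop_counit dd hs bar_counit bar_diff0).
Qed.

End BarHomology.

(** * Projective modules and splittings *)

Section Pullback.
Variables (R : nzRingType) (M N P : lmodType R) (g : {linear M -> N}) (f : {linear P -> N}).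

Definition pullback_pred : {pred (M * P)%type} := [pred x | g x.1 == f x.2].
Lemma pullback_submod : submod_closed pullback_pred.
Proof.
split=> [|a x y]; first by rewrite inE !raddf0.
by rewrite !inE /= !linearP => /eqP-> /eqP->.
Qed.
HB.instance Definition _ := GRing.isSubmodClosed.Build R _ pullback_pred pullback_submod.
Record pullback : Type := Pullback { pbval : (M * P)%type; pbvalP : pbval \in pullback_pred }.
HB.instance Definition _ := [isSub for pbval].
HB.instance Definition _ := [Choice of pullback by <:].
HB.instance Definition _ := [SubChoice_isSubLmodule of pullback by <:].

Definition pbsnd (x : pullback) : P := (pbval x).2.
Lemma pbsnd_linear : linear pbsnd. Proof. by []. Qed.
HB.instance Definition _ := GRing.isLinear.Build R pullback P *:%R pbsnd pbsnd_linear.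
Definition pbfst (x : pullback) : M := (pbval x).1.
Lemma pbfst_linear : linear pbfst. Proof. by []. Qed.
HB.instance Definition _ := GRing.isLinear.Build R pullback M *:%R pbfst pbfst_linear.

Lemma projective_lift : projective P -> (forall x, exists y, g y = f x) ->
  exists h : {linear P -> M}, forall x, g (h x) = f x.
Proof.
move=> hP hfg.
have [y|h hh] := hP pullback P pbsnd idfun.
  have [x e] := hfg y; have p : (x, y) \in pullback_pred by rewrite inE /= e.
  by exists (Pullback p).
exists (pbfst \o h) => x; have /eqP e := pbvalP (h x).
by rewrite [LHS]e; congr (f _); exact: hh.
Qed.
End Pullback.

Section FieldProjective.
Variable k : comNzRingType.
Local Open Scope classical_set_scope.

Lemma field_projective : is_field k -> forall P : lmodType k, projective P.
Proof.
move=> kf P M N g f gs.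
pose good (G : set (P * M)) := [/\ forall a x y, G x -> G y -> G (a *: x + y),
  forall m, G (0, m) -> m = 0 & forall x, G x -> g x.2 = f x.1].
have chain (F : set (set (P * M))) : F `<=` good -> total_on F subset -> good (\bigcup_(X in F) X).
  move=> Fg Ft; split.
  - move=> a x y [X FX Xx] [Y FY Yy].
    have [XY|YX] := Ft _ _ FX FY.
      by have [h _ _] := Fg _ FY; exists Y => //; apply: h => //; exact: XY.
    by have [h _ _] := Fg _ FX; exists X => //; apply: h => //; exact: YX.
  - by move=> m [X FX Xm]; have [_ h _] := Fg _ FX; exact: h.
  - by move=> x [X FX Xx]; have [_ _ h] := Fg _ FX; exact: h.
have [G [[Gl G0 Gg] Gmax]] := Zorn_bigcup chain.
have GB x y : G x -> G y -> G (x - y).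
  by move=> hx hy; rewrite addrC -scaleN1r; exact: Gl.
have Gfun p m m' : G (p, m) -> G (p, m') -> m = m'.
  move=> h1 h2; apply/eqP; rewrite -subr_eq0; apply/eqP/G0.
  have := GB _ _ h1 h2; rewrite (_ : _ - _ = (0, m - m')) //.
  by apply: injective_projections => //=; exact: subrr.
have Gtot p : exists m, G (p, m).
  apply: contrapT => np.
  have Gz : G 0.
    apply: contrapT => nz; apply: (Gmax (G `|` [set 0])); last first.
      split.
      - move=> a x y [hx|->] [hy|->]; rewrite ?scaler0 ?addr0 ?add0r.
        + by left; exact: Gl.
        + by case: nz; have := GB _ _ hx hx; rewrite subrr.
        + by left.
        + by right.
      - by move=> m [/G0 //|[]].
      - by move=> x [/Gg //|->] /=; rewrite !raddf0.
    split; first by left.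
    by move=> /(_ 0 (or_intror erefl)).
  have [m gm] := gs (f p).
  apply: (Gmax [set x | exists y a, G y /\ x = y + a *: (p, m)]).
    split; first by move=> x Gx; exists x, 0; rewrite scale0r addr0.
    move=> /(_ (p, m)) h; apply: np; exists m; apply: h.
    by exists 0, 1; rewrite scale1r add0r.
  split.
  - move=> a x y [x' [b [hx ->]]] [y' [c [hy ->]]]; exists (a *: x' + y'), (a * b + c).
    by split; [exact: Gl | rewrite scalerDr scalerDl scalerA addrACA].
  - move=> m' [[p1 m1] [a [h e]]]; case: (eqVneq a 0) e => [->|a0] e.
      by apply: G0; rewrite e scale0r addr0.
    have [b ba] := kf a a0; case: np; exists (- (b *: m1)).
    have e1 : 0 = p1 + a *: p by move/(congr1 fst): e.
    have -> : (p, - (b *: m1)) = - b *: (p1, m1) + 0.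
      rewrite addr0; apply: injective_projections => /=; last by rewrite scaleNr.
      have /eqP := esym e1; rewrite addrC addr_eq0 => /eqP e2.
      by rewrite scaleNr -scalerN -e2 scalerA ba scale1r.
    exact: Gl.
  - move=> x [y [a [h ->]]]; by rewrite /= !raddfD /= !linearZ /= gm (Gg _ h).
have [h hh] := choice Gtot.
have hl : linear h.
  move=> a x y; apply: (Gfun (a *: x + y)) (hh _) _.
  exact: (Gl a (x, h x) (y, h y)).
exists (HB.pack h (GRing.isLinear.Build _ _ _ _ _ hl) : {linear P -> M}) => x /=.
exact: (Gg (x, h x)).
Qed.
End FieldProjective.

Section ProjectiveTensor.
Variable k : comNzRingType.
Implicit Types M N P T : lmodType k.

(* [Hom T M] is the kernel of [lin_defect] in the module of all functions. *)
Definition lin_defect T M (f : T -> M) : (k * T * T)%type -> M :=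
  fun x => f (x.1.1 *: x.1.2 + x.2) - (x.1.1 *: f x.1.2 + f x.2).
Lemma lin_defect_linear T M : linear (@lin_defect T M).
Proof.
move=> a f g; apply: funext => -[[b x] y].
rewrite [LHS](_ : _ = (a *: f (b *: x + y) + g (b *: x + y))
  - (b *: (a *: f x + g x) + (a *: f y + g y))) // [RHS](_ : _ = a *: lin_defect f (b, x, y) + lin_defect g (b, x, y)) //.
rewrite /lin_defect /= scalerBr !scalerDr !scalerA (mulrC b a) !opprD.
by rewrite [in RHS]addrACA -!opprD; congr (_ - _); rewrite addrACA.
Qed.
HB.instance Definition _ T M :=
  GRing.isLinear.Build k (T -> M) (k * T * T -> M) *:%R (@lin_defect T M) (@lin_defect_linear T M).

Definition Hom T M : lmodType k := ker (@lin_defect T M).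

Lemma Hom_linear T M (h : Hom T M) : linear (kval h).
Proof.
move=> a x y; have /eqP e := kvalP h; apply/eqP; rewrite -subr_eq0; apply/eqP.
exact: (congr1 (fun F => F (a, x, y)) e).
Qed.

Lemma Hom_mk T M (f : T -> M) : linear f -> f \in ker_pred (@lin_defect T M).
Proof. by move=> h; apply/eqP/funext => -[[a x] y]; rewrite /= /lin_defect h subrr. Qed.

(* [Hom(P \ox T, -)] is [Hom(P, Hom(T, -))]. *)
Lemma projective_tensor P T : projective P -> projective T -> projective (P \ox T)%type.
Proof.
move=> hP hT M N g f gs; have fl : linear f := linearP f.
pose G (h : Hom T M) : Hom T N := Ker (Hom_mk (linear_comp (Hom_linear h) (linear_fun g))).
have Gl : linear G by move=> a x y; apply: val_inj; apply: funext => t; exact: linearP.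
pose F (x : P) : Hom T N := Ker (Hom_mk (linear_comp (pure_linr x) fl)).
have Fl : linear F.
  by move=> a x y; apply: val_inj; apply: funext => t; exact: (linear_comp (pure_linl t) fl).
have [h|H hH] := hP _ _ (HB.pack G (GRing.isLinear.Build _ _ _ _ _ Gl) : {linear Hom T M -> Hom T N})
   (HB.pack F (GRing.isLinear.Build _ _ _ _ _ Fl) : {linear P -> Hom T N}).
  pose h' : {linear T -> N} := HB.pack (kval h) (GRing.isLinear.Build _ _ _ _ _ (Hom_linear h)).
  have [u hu] := hT _ _ g h' gs.
  exists (Ker (Hom_mk (linear_fun u))); apply: val_inj; apply: funext => t; exact: hu.
have bH : bilinear_fun (fun x t => kval (H x) t).
  split=> [t a x y|x]; last exact: Hom_linear.
  by rewrite linearP.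
exists (HB.pack (tlift (fun x t => kval (H x) t)) (GRing.isLinear.Build _ _ _ _ _ (tlift_linear bH)) : {linear P \ox T -> M}).
apply: tensor_ext => [||x t].
- exact: (linear_comp (tlift_linear bH) (linear_fun g)).
- exact: fl.
rewrite /= tlift_pure //.
exact: (congr1 (fun w => kval w t) (hH x)).
Qed.

Lemma projective_base : projective (k^o : lmodType k).
Proof.
move=> M N g f gs; have [m gm] := gs (f 1).
have hl : linear (fun a : k^o => (a : k) *: m).
  by move=> a x y; rewrite scalerDl scalerA.
exists (HB.pack (fun a : k^o => (a : k) *: m) (GRing.isLinear.Build _ _ _ _ _ hl) : {linear k^o -> M}) => x /=.
by rewrite linearZ /= gm -linearZ /= [_ *: _]mulr1.
Qed.

Lemma projective_tpow (B : algType k) n : projective (B : lmodType k) -> projective (tpow B n).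
Proof. by move=> hB; elim: n => [|n IH]; [exact: projective_base | exact: projective_tensor]. Qed.
End ProjectiveTensor.

Section ProjectiveSplit.
Variables (k : comNzRingType) (V : nat -> lmodType k) (d : forall n, {linear V n.+1 -> V n}).
Hypothesis dd : forall n x, d n (d n.+1 x) = 0.
Local Notation H := (homology d).

Lemma hproj_eq0 n (z : cycles d n) : hproj z = 0 -> exists y, d n y = kval z.
Proof.
rewrite -(linear_0 (@hproj_linear _ _ d n)) => /qpiP; rewrite subr0.
elim=> [z' //| |a z1 z2 _ [y1 e1] _ [y2 e2]]; first by exists 0; rewrite linear0.
by exists (a *: y1 + y2); rewrite linearP e1 e2.
Qed.

Definition cycle_projection n (pi : {linear V n -> V n}) :=
  (forall x, bdry d n (pi x) = 0) /\ (forall x, bdry d n x = 0 -> pi x = x).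

Hypothesis (Vp : forall n, projective (V n)) (Hp : forall n, projective (H n)).

(* Projecting V_n to the cycles and then subtracting a section of the projective module
   H_n gives a projection onto the boundaries, which lifts along [d] as V_n is projective. *)
Lemma split_step n : (exists pi, @cycle_projection n pi) ->
  exists s : {linear V n -> V n.+1}, forall x, d n (s (d n x)) = d n x.
Proof.
case=> pi [p1 p2].
pose hpr : {linear cycles d n -> H n} := HB.pack (@hproj _ _ d n) (GRing.isLinear.Build _ _ _ _ _ (@hproj_linear _ _ d n)).
have [|sg hsg] := Hp (g := hpr) idfun; first exact: hproj_surj.
pose c (x : V n) : cycles d n := mkcycle (p1 x).
have cl : linear c by move=> a x y; apply: val_inj; exact: linearP.
pose b (x : V n) := kval (c x - sg (hproj (c x))).
have bl : linear b.
  have l2 := linear_comp (linear_comp cl (@hproj_linear _ _ d n)) (linear_fun sg).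
  exact: (linear_comp (linear_sub cl l2) (@kval_linear _ _ d n)).
pose b' : {linear V n -> V n} := HB.pack b (GRing.isLinear.Build _ _ _ _ _ bl).
have [|s hs] := @projective_lift _ _ _ _ (d n) b' (@Vp n).
  move=> x; apply: hproj_eq0; rewrite (linear_B _ _ (@hproj_linear _ _ d n)).
  by rewrite [X in _ - X]hsg subrr.
exists s => x; rewrite hs /= /b.
have -> : hproj (c (d n x)) = 0.
  rewrite -(linear_0 (@hproj_linear _ _ d n)); apply: (@hproj_eq _ _ _ _ _ _ x) => /=.
  by rewrite subr0 p2 // bdry_d.
by rewrite linear0 subr0 /= p2 // bdry_d.
Qed.

Lemma projective_split : split_complex d.
Proof.
have P n : exists pi, @cycle_projection n pi.
  elim: n => [|n /split_step [s hs]]; first by exists idfun; split.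
  have l : linear (fun x : V n.+1 => x - s (d n x)).
    exact: (linear_sub (@linear_id _ _) (linear_comp (linear_fun (d n)) (linear_fun s))).
  exists (HB.pack (fun x : V n.+1 => x - s (d n x)) (GRing.isLinear.Build _ _ _ _ _ l) : {linear V n.+1 -> V n.+1}).
  by split=> x /=; [rewrite linearB /= hs subrr | move=> ->; rewrite linear0 subr0].
exists (fun n => projT1 (cid (split_step (P n)))) => n.
exact: (projT2 (cid (split_step (P n)))).
Qed.
End ProjectiveSplit.

Lemma bar_split_projective (k : comNzRingType) (B : algType k) (D : bialgebra B) :
  projective (B : lmodType k) -> (forall n, projective (bar_homology D n)) -> split_complex (bar_diff D).
Proof.
move=> hB hH; apply: projective_split => //; first exact: bar_diff2.
by move=> n; exact: projective_tpow.
Qed.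

Lemma bar_split_field (k : comNzRingType) (B : algType k) (D : bialgebra B) :
  is_field k -> split_complex (bar_diff D).
Proof. by move=> kf; apply: bar_split_projective => [|n]; exact: field_projective. Qed.

(** * The bar resolution *)

Section ExtensionOfScalars.
Variables (k : comNzRingType) (B : algType k).

Definition ext (T : lmodType k) : Type := (B \ox T)%type.

Section Module.
Variable T : lmodType k.
HB.instance Definition _ := GRing.Zmodule.on (ext T).

Definition ext_scale (b : B) (x : ext T) : ext T := tmap ( *%R b) id (x : (B \ox T)%type).

Lemma ext_scale_linear b : linear (ext_scale b : (B \ox T)%type -> (B \ox T)%type).
Proof. exact: tmap_linear (mul_linear b) (@linear_id _ _). Qed.

Lemma ext_scale_pure b a (t : T) : ext_scale b (a \tens t) = (b * a) \tens t.
Proof. by rewrite [LHS]tmap_pure //; exact: mul_linear. Qed.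

Lemma ext_scaleA a b x : ext_scale a (ext_scale b x) = ext_scale (a * b) x.
Proof.
move: x; apply: tensor_ext => [||x t].
- exact: linear_comp (@ext_scale_linear b) (@ext_scale_linear a).
- exact: ext_scale_linear.
by rewrite !ext_scale_pure mulrA.
Qed.
Lemma ext_scale1 : left_id 1 ext_scale.
Proof.
apply: tensor_ext => [||x t]; [exact: ext_scale_linear | exact: linear_id |].
by rewrite ext_scale_pure mul1r.
Qed.
Lemma ext_scaleDr : right_distributive ext_scale +%R.
Proof. by move=> b x y; exact: (linear_D _ _ (@ext_scale_linear b)). Qed.
Lemma ext_scaleDl x : {morph ext_scale^~ x : a b / a + b}.
Proof.
move=> a b; move: x; apply: (tensor_ext (g := fun x => ext_scale a x + ext_scale b x)) => [||x t].
- exact: ext_scale_linear.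
- exact: linear_add (@ext_scale_linear a) (@ext_scale_linear b).
by rewrite !ext_scale_pure mulrDl; exact: (linear_D _ _ (@pure_linl _ _ _ t)).
Qed.
HB.instance Definition _ := GRing.Zmodule_isLmodule.Build B (ext T)
  ext_scaleA ext_scale1 ext_scaleDr ext_scaleDl.

Lemma ext_scaleE b (x : ext T) : b *: x = ext_scale b x.
Proof. by []. Qed.

Lemma ext_restr (c : k) (x : ext T) : (c%:A : B) *: x = (c *: (x : (B \ox T)%type) : (B \ox T)%type).
Proof.
rewrite ext_scaleE; move: x; apply: tensor_ext => [||x t].
- exact: ext_scale_linear.
- exact: scale_lin.
by rewrite ext_scale_pure -scalerAl mul1r (linear_Z (@pure_linl _ _ _ t)).
Qed.

Lemma linear_from_ext (P : lmodType B) (f : {linear ext T -> P}) :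
  linear (f : (B \ox T)%type -> restr P).
Proof. by move=> a x y; rewrite -ext_restr; exact: linearP. Qed.

Lemma linear_to_ext (P : lmodType B) (f : {linear P -> ext T}) :
  linear (f : restr P -> (B \ox T)%type).
Proof. by move=> a x y; rewrite -[in RHS]ext_restr -[RHS]linearP. Qed.

Lemma linear_restr (P Q : lmodType B) (f : {linear P -> Q}) : linear (f : restr P -> restr Q).
Proof. by move=> a x y; apply: linearP. Qed.

Lemma ext_pureE (b : B) (t : T) : (b \tens t : ext T) = b *: (1 \tens t : ext T).
Proof. by rewrite ext_scaleE ext_scale_pure mulr1. Qed.
End Module.

Lemma restr_scaleE (P : lmodType B) a (b : B) (x : P) :
  ((a *: b) *: x : restr P) = a *: (b *: x : restr P).
Proof. by rewrite [RHS](scalerA (a%:A : B) b x) -scalerAl mul1r. Qed.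

Lemma restr_scaleC (P : lmodType B) a (b : B) (x : restr P) :
  (b *: (a *: x : P) : restr P) = a *: (b *: (x : P) : restr P).
Proof. by rewrite -restr_scaleE [LHS](scalerA b (a%:A : B) (x : P)) -scalerAr mulr1. Qed.

Definition ext_lift (T : lmodType k) (P : lmodType B) (h : T -> restr P) : ext T -> P :=
  tlift (fun (b : B) (t : T) => (b *: (h t : P) : restr P)).

Section ExtLift.
Variables (T : lmodType k) (P : lmodType B) (h : T -> restr P).
Hypothesis hl : linear h.

Lemma ext_lift_bilinear :
  bilinear_fun (fun (b : B) (t : T) => (b *: (h t : P) : restr P)).
Proof.
split=> [t a b c|b a t u].
  by rewrite scalerDl; congr (_ + _); exact: restr_scaleE.
by rewrite hl [LHS]scalerDr; congr (_ + _); exact: restr_scaleC.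
Qed.

Lemma ext_lift_pure b t : ext_lift h (b \tens t) = b *: (h t : P).
Proof. exact: tlift_pure ext_lift_bilinear. Qed.

Lemma ext_lift_linear : linear (ext_lift h).
Proof.
move=> b x y; have hL := tlift_linear ext_lift_bilinear.
rewrite [LHS](linear_D _ _ hL); congr (_ + _); move: x.
apply: (@tensor_ext k B T (restr P) (fun x => ext_lift h (ext_scale b x)) (fun x => (b *: (ext_lift h x : P) : restr P))) => [||a t].
- exact: (linear_comp (@ext_scale_linear T b) hL).
- by move=> a u v; rewrite [ext_lift h _]hL [LHS]scalerDr; congr (_ + _); exact: restr_scaleC.
by rewrite ext_scale_pure !ext_lift_pure -scalerA.
Qed.
End ExtLift.

Lemma ext_projective (T : lmodType k) : projective T -> projective (ext T).
Proof.
move=> hT M N g f gs.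
have fl : linear (fun t : T => (f (1 \tens t) : restr N)).
  exact: (linear_comp (@pure_linr _ _ _ 1) (linear_from_ext f)).
pose f' : {linear T -> restr N} := HB.pack (fun t : T => (f (1 \tens t) : restr N)) (GRing.isLinear.Build _ _ _ _ _ fl).
pose g' : {linear restr M -> restr N} := HB.pack (g : restr M -> restr N) (GRing.isLinear.Build _ _ _ _ _ (linear_restr g)).
have [h hh] := hT (restr M) (restr N) g' f' gs.
have hl := linear_fun h.
exists (HB.pack (ext_lift h) (GRing.isLinear.Build _ _ _ _ _ (ext_lift_linear hl)) : {linear ext T -> M}).
apply: (@tensor_ext _ _ _ (restr N)) => [||b t].
- exact: (linear_comp (tlift_linear (ext_lift_bilinear hl)) (linear_restr g)).
- exact: (linear_from_ext f).
rewrite /= ext_lift_pure // linearZ (hh t : g (h t) = f (1 \tens t)).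
by rewrite [in RHS]ext_pureE linearZ.
Qed.
End ExtensionOfScalars.

Section BarResolution.
Variables (k : comNzRingType) (B : algType k) (D : bialgebra B).
Local Notation eps := (counit D).
Local Notation tpow := (tpow B).
Local Notation ext := (@ext k B).

Lemma eps_bilinear n : bilinear_fun (fun (x : B) (t : tpow n) => (eps x : k) *: t).
Proof. by split=> [t a x y|x]; [rewrite linearP scalerDl scalerA | exact: scale_lin]. Qed.

Lemma face0_pure n b (t : tpow n) : face D 0 (b \tens t : tpow n.+1) = (eps b : k) *: t.
Proof. by case: n t => [|n] t; exact: (tlift_pure _ _ (eps_bilinear _)). Qed.

Lemma face1_pure0 b (t : tpow 0) : face D 1 (b \tens t : tpow 1) = (eps b : k) *: t.
Proof. exact: (tlift_pure _ _ (eps_bilinear _)). Qed.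

Lemma face1_pure n b (t : tpow n.+1) : face D 1 (b \tens t : tpow n.+2) = tmap ( *%R b) id t.
Proof.
apply: tlift_pure; split=> [u a x y|x]; last first.
  exact: (tmap_linear (mul_linear x) (@linear_id _ _)).
move: u; apply: (tensor_ext (f := fun u => tmap ( *%R (a *: x + y)) id u)
  (g := fun u => a *: tmap ( *%R x) id u + tmap ( *%R y) id u)) => [||z u].
- exact: (tmap_linear (mul_linear _) (@linear_id _ _)).
- apply: linear_add; last exact: (tmap_linear (mul_linear _) (@linear_id _ _)).
  exact: (linear_comp (tmap_linear (mul_linear _) (@linear_id _ _)) (@scale_lin _ _ a)).
rewrite !tmap_pure; try exact: mul_linear; try exact: linear_id.
by rewrite mulrDl -scalerAl; exact: pure_linl.
Qed.

Lemma faceS_pure n i b (t : tpow n.+1) :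
  face D i.+2 (b \tens t : tpow n.+2) = b \tens face D i.+1 t.
Proof.
apply: tlift_pure; split=> [u|x]; first exact: pure_linl.
exact: (linear_comp (@face_linear _ _ D n i.+1) (pure_linr x)).
Qed.

(* For [n > 0], seen on B \ox tpow n, this is the differential of the bar resolution,
   with 1 \tens _ as contracting homotopy ([rbar_1]); for [n = 0], the augmentation. *)
Definition rbar n (t : tpow n.+1) : tpow n := \sum_(i < n.+1) (-1) ^+ i *: face D i.+1 t.

Lemma rbar_linear n : linear (@rbar n).
Proof.
apply: sum_linear => i; exact: (linear_comp (@face_linear _ _ D n i.+1) (@scale_lin _ _ _)).
Qed.

Lemma rbar0 b (t : tpow 0) : rbar (b \tens t : tpow 1) = (eps b : k) *: t.
Proof. by rewrite /rbar big_ord_recl big_ord0 addr0 expr0 scale1r face1_pure0. Qed.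

Lemma rbarS n b (t : tpow n.+1) :
  rbar (b \tens t : tpow n.+2) = tmap ( *%R b) id t - b \tens rbar t.
Proof.
rewrite /rbar big_ord_recl expr0 scale1r face1_pure; congr (_ + _).
rewrite (linear_bigsum (pure_linr b)) -sumrN; apply: eq_bigr => i _.
by rewrite faceS_pure (linear_Z (pure_linr b)) exprS mulN1r scaleNr.
Qed.

Lemma bar_diffE n (t : tpow n.+1) : bar_diff D n t = face D 0 t - rbar t.
Proof.
rewrite [LHS](_ : _ = bar_fun D t) // /bar_fun big_ord_recl expr0 scale1r; congr (_ + _).
by rewrite -sumrN; apply: eq_bigr => i _; rewrite exprS mulN1r scaleNr.
Qed.

Lemma rbar_1 n (t : tpow n.+1) : rbar ((1 : B) \tens t : tpow n.+2) = t - (1 : B) \tens rbar t.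
Proof. by rewrite rbarS; congr (_ - _); exact: (ext_scale1 t). Qed.

Lemma rbar_ext_linear n : linear (@rbar n.+1 : ext (tpow n.+1) -> ext (tpow n)).
Proof.
move=> b x y; rewrite [LHS](linear_D _ _ (@rbar_linear n.+1)); congr (_ + _); move: x.
apply: (tensor_ext (f := fun x => rbar (ext_scale b x : tpow n.+2))
  (g := fun x => ext_scale b (rbar (x : tpow n.+2) : ext (tpow n)))) => [||a t].
- exact: (linear_comp (@ext_scale_linear _ _ _ b) (@rbar_linear n.+1)).
- exact: (linear_comp (@rbar_linear n.+1) (@ext_scale_linear _ _ _ b)).
rewrite ext_scale_pure !rbarS (linear_B _ _ (@ext_scale_linear _ _ _ b)) ext_scale_pure.
by congr (_ - _); rewrite [RHS]ext_scaleA.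
Qed.
HB.instance Definition _ n := GRing.isLinear.Build B (ext (tpow n.+1)) (ext (tpow n)) *:%R
  (@rbar n.+1 : ext (tpow n.+1) -> ext (tpow n)) (@rbar_ext_linear n).
Definition rbar_diff n : {linear ext (tpow n.+1) -> ext (tpow n)} :=
  (@rbar n.+1 : ext (tpow n.+1) -> ext (tpow n)).

Definition rbar_aug : ext (tpow 0) -> k := @rbar 0.

Lemma rbar_aug_linear b x y : rbar_aug (b *: x + y) = eps b * rbar_aug x + rbar_aug y.
Proof.
rewrite [LHS](linear_D _ _ (@rbar_linear 0)); congr (_ + _); move: x.
apply: (tensor_ext (P := k^o : lmodType k) (f := fun x => rbar (ext_scale b x : tpow 1))
  (g := fun x => (eps b : k) *: rbar (x : tpow 1))) => [||a t].
- exact: (linear_comp (@ext_scale_linear _ _ _ b) (@rbar_linear 0)).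
- exact: (linear_comp (@rbar_linear 0) (@scale_lin _ _ _)).
by rewrite ext_scale_pure !rbar0 counitM scalerA.
Qed.

Lemma rbar_aug1 (c : k^o) : rbar_aug ((1 : B) \tens c) = c.
Proof. by rewrite [LHS]rbar0 counit1 scale1r. Qed.

Lemma rbar_aug_diff x : rbar_aug (rbar_diff 0 x) = 0.
Proof.
move: x; apply: (tensor_ext (P := k^o : lmodType k) (f := fun x => rbar_aug (rbar_diff 0 x)) (g := fun=> 0)) => [||b t].
- exact: (linear_comp (@rbar_linear 1) (@rbar_linear 0)).
- exact: linear_zero.
have -> : b \tens t = b *: ((1 : B) \tens t : ext (tpow 1)) by rewrite -ext_pureE.
rewrite linearZ /= -[b *: _]addr0 rbar_aug_linear [X in _ + X](linear_0 (@rbar_linear 0)) addr0.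
rewrite rbar_1 [X in _ * X](linear_B _ _ (@rbar_linear 0)).
by rewrite [X in _ - X]rbar_aug1 subrr mulr0.
Qed.

Lemma rbar_diff2 n x : rbar_diff n (rbar_diff n.+1 x) = 0.
Proof.
elim: n x => [|n IH].
  apply: (tensor_ext (f := fun x => rbar_diff 0 (rbar_diff 1 x) : tpow 1) (g := fun=> 0)) => [||b t].
  - exact: (linear_comp (@rbar_linear 2) (@rbar_linear 1)).
  - exact: linear_zero.
  have -> : b \tens t = b *: ((1 : B) \tens t : ext (tpow 2)) by rewrite -ext_pureE.
  rewrite !linearZ /= (rbar_1 t) [X in b *: X](linear_B _ _ (@rbar_linear 1)).
  rewrite [X in _ - X]rbar_1; have -> : rbar (rbar t) = 0 by exact: (rbar_aug_diff t).
  by rewrite (linear_0 (@pure_linr _ _ _ 1)) subr0 subrr scaler0.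
apply: (tensor_ext (f := fun x => rbar_diff n.+1 (rbar_diff n.+2 x) : tpow n.+2) (g := fun=> 0)) => [||b t].
- exact: (linear_comp (@rbar_linear n.+3) (@rbar_linear n.+2)).
- exact: linear_zero.
have -> : b \tens t = b *: ((1 : B) \tens t : ext (tpow n.+3)) by rewrite -ext_pureE.
rewrite !linearZ /= (rbar_1 t) [X in b *: X](linear_B _ _ (@rbar_linear n.+2)).
rewrite [X in _ - X]rbar_1; have -> : rbar (rbar t) = 0 by exact: (IH t).
by rewrite (linear_0 (@pure_linr _ _ _ 1)) subr0 subrr scaler0.
Qed.

Hypothesis hB : projective (B : lmodType k).

Definition bar_resolution : resolution D.
Proof.
refine (@Resolution _ _ D (fun n => ext (tpow n)) _ rbar_diff rbar_aug rbar_aug_linear _ _ _).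
- by move=> n; apply: ext_projective; exact: projective_tpow.
- by move=> c; exists ((1 : B) \tens (c : k^o)); exact: rbar_aug1.
- move=> x; split=> [h|[y <-]]; last exact: rbar_aug_diff.
  exists ((1 : B) \tens (x : tpow 1)); rewrite [LHS]rbar_1.
  by rewrite [rbar _]h (linear_0 (@pure_linr _ _ _ 1)) subr0.
move=> n x; split=> [h|[y <-]]; last exact: rbar_diff2.
exists ((1 : B) \tens (x : tpow n.+2)); rewrite [LHS]rbar_1.
by rewrite [rbar _]h (linear_0 (@pure_linr _ _ _ 1)) subr0.
Defined.

Lemma face0_rbar n (t : tpow n.+2) : face D 0 (rbar t) = bar_diff D n (face D 0 t).
Proof.
move: t; apply: tensor_ext => [||b t].
- exact: (linear_comp (@rbar_linear n.+1) (@face_linear _ _ D n 0)).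
- exact: (linear_comp (@face_linear _ _ D n.+1 0) (linear_fun (bar_diff D n))).
rewrite rbarS face0_pure linearZ /= -[bar_fun D t]/(bar_diff D n t) bar_diffE scalerBr.
rewrite (linear_B _ _ (@face_linear _ _ D n 0)) face0_pure; congr (_ - _).
move: t; apply: tensor_ext => [||a t].
- exact: (linear_comp (tmap_linear (mul_linear b) (@linear_id _ _)) (@face_linear _ _ D n 0)).
- exact: (linear_comp (@face_linear _ _ D n 0) (@scale_lin _ _ _)).
by rewrite tmap_pure ?face0_pure ?counitM ?scalerA //; exact: mul_linear.
Qed.
End BarResolution.

Lemma dependent_sequence (T : nat -> Type) (rel : forall n, T n -> T n.+1 -> Prop) :
  forall x0 : T 0%N, (forall n x, exists y, @rel n x y) ->
  exists u : forall n, T n, u 0%N = x0 /\ forall n, rel n (u n) (u n.+1).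
Proof.
move=> x0 h; pose g n x := cid (h n x).
exists (nat_rect T x0 (fun n x => projT1 (g n x))); split=> // n; exact: (projT2 (g n _)).
Qed.

(** * Comparison of resolutions and Tor *)

Section Comparison.
Variables (k : comNzRingType) (B : algType k) (D : bialgebra B).
Local Notation eps := (counit D).

(* k as a left [B]-module through the counit. *)
Definition eps_mod (_ : bialgebra B) : Type := k^o.
Local Notation triv := (eps_mod D).
HB.instance Definition _ := GRing.Zmodule.on triv.
Definition triv_scale (b : B) (c : triv) : triv := eps b * (c : k).
Lemma triv_scaleA a b c : triv_scale a (triv_scale b c) = triv_scale (a * b) c.
Proof. by rewrite /triv_scale counitM mulrA. Qed.
Lemma triv_scale1 : left_id 1 triv_scale.
Proof. by move=> c; rewrite /triv_scale counit1 mul1r. Qed.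
Lemma triv_scaleDr : right_distributive triv_scale +%R.
Proof. by move=> b c c'; rewrite /triv_scale mulrDr. Qed.
Lemma triv_scaleDl c : {morph triv_scale^~ c : a b / a + b}.
Proof. by move=> a b; rewrite /triv_scale raddfD /= mulrDl. Qed.
HB.instance Definition _ := GRing.Zmodule_isLmodule.Build B triv
  triv_scaleA triv_scale1 triv_scaleDr triv_scaleDl.

Section Augmentation.
Variable Q : resolution D.

Lemma aug_linear : linear (res_aug (r := Q) : res_mod Q 0 -> triv).
Proof. exact: (@res_aug_linear _ _ _ Q). Qed.
Definition aug : {linear res_mod Q 0 -> triv} :=
  HB.pack (res_aug (r := Q) : res_mod Q 0 -> triv) (GRing.isLinear.Build _ _ _ _ _ aug_linear).

Definition res_cycle n (x : res_mod Q n) : Prop :=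
  match n return res_mod Q n -> Prop with
  | 0 => fun x => res_aug x = 0
  | m.+1 => fun x => res_diff Q m x = 0
  end x.

Lemma res_cycleP n (x : res_mod Q n) : res_cycle x <-> exists y, res_diff Q n y = x.
Proof. by case: n x => [|n] x; [exact: res_exact0 | exact: res_exact]. Qed.

Lemma res_cycle_diff n y : res_cycle (res_diff Q n y).
Proof. by apply/res_cycleP; exists y. Qed.

Lemma res_diff2 n y : res_diff Q n (res_diff Q n.+1 y) = 0.
Proof. exact: (@res_cycle_diff n.+1 y). Qed.

Lemma res_cycle_lift (P : lmodType B) n (f : P -> res_mod Q n) : projective P -> linear f ->
  (forall x, res_cycle (f x)) ->
  exists h : {linear P -> res_mod Q n.+1}, forall x, res_diff Q n (h x) = f x.
Proof.
move=> hP fl hc; pose f' : {linear P -> res_mod Q n} := HB.pack f (GRing.isLinear.Build _ _ _ _ _ fl).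
have [x|h hh] := projective_lift (g := res_diff Q n) (f := f') hP; last by exists h.
exact/res_cycleP.
Qed.
End Augmentation.

Variables P Q : resolution D.
Local Notation maps := (forall n, {linear res_mod P n -> res_mod Q n}).

Definition res_map (f : maps) :=
  (forall x, res_aug (f 0%N x) = res_aug x) /\
  (forall n x, res_diff Q n (f n.+1 x) = f n (res_diff P n x)).

Lemma res_lift : exists f : maps, res_map f.
Proof.
have [x|f0 hf0] := projective_lift (g := aug Q) (f := aug P) (@res_projective _ _ _ P 0).
  exact: res_aug_surj.
pose T n := {f : {linear res_mod P n -> res_mod Q n} | forall y, res_cycle (f (res_diff P n y))}.
have T0 y : res_cycle (f0 (res_diff P 0 y)).
  rewrite /res_cycle; have := hf0 (res_diff P 0 y) => /= ->.
  exact: (@res_cycle_diff P 0 y).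
pose rel n (f : T n) (g : T n.+1) := forall x, res_diff Q n (sval g x) = sval f (res_diff P n x).
have [n [f hf]|u [u0 hu]] := @dependent_sequence T rel (exist _ f0 T0).
  have fl : linear (fun x => f (res_diff P n x)) by move=> a x y; rewrite !linearP.
  have [h hh] := res_cycle_lift (@res_projective _ _ _ P n.+1) fl hf.
  suff hc y : res_cycle (h (res_diff P n.+1 y)) by exists (exist _ h hc).
  by rewrite /res_cycle hh res_diff2 linear0.
exists (fun n => sval (u n)); split=> //.
by move=> x; rewrite u0; exact: hf0.
Qed.

Lemma res_htpy (f g : maps) : res_map f -> res_map g ->
  exists h : forall n, {linear res_mod P n -> res_mod Q n.+1},
    (forall x, f 0%N x - g 0%N x = res_diff Q 0 (h 0%N x)) /\
    (forall n x, f n.+1 x - g n.+1 x = res_diff Q n.+1 (h n.+1 x) + h n (res_diff P n x)).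
Proof.
move=> [f0 fS] [g0 gS]; pose p n x := f n x - g n x.
have pl n : linear (@p n).
  by move=> a x y; rewrite /p !linearP addrACA -scalerDr.
have pd n x : res_diff Q n (p n.+1 x) = p n (res_diff P n x) by rewrite linearB /= fS gS.
have [x|h0 hh0] := res_cycle_lift (@res_projective _ _ _ P 0) (@pl 0).
  rewrite /res_cycle; apply/eqP; rewrite -[res_aug _]/(aug Q _) linearB /= f0 g0.
  by rewrite [_ - _]subrr.
pose T n := {h : {linear res_mod P n -> res_mod Q n.+1} |
  forall y, p n (res_diff P n y) = res_diff Q n (h (res_diff P n y))}.
pose rel n (h : T n) (h' : T n.+1) := forall x,
  res_diff Q n.+1 (sval h' x) = p n.+1 x - sval h (res_diff P n x).
have [n [h hh]|u [u0 hu]] := @dependent_sequence T rel (exist _ h0 (fun y => esym (hh0 _))).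
  have hl : linear (fun x => p n.+1 x - h (res_diff P n x)).
    by move=> a x y; rewrite pl !linearP addrACA -scalerDr.
  have [x|h' hh'] := res_cycle_lift (@res_projective _ _ _ P n.+1) hl.
    by rewrite /res_cycle linearB /= pd hh subrr.
  suff hc y : p n.+1 (res_diff P n.+1 y) = res_diff Q n.+1 (h' (res_diff P n.+1 y)).
    by exists (exist _ h' hc).
  by rewrite hh' res_diff2 linear0 subr0.
exists (fun n => sval (u n)); split=> [x|n x]; first by rewrite u0 /= hh0.
by rewrite [in RHS]hu subrK.
Qed.

End Comparison.

Section HomologyMap.
Variables (k : comNzRingType) (V W : nat -> lmodType k).
Variables (dV : forall n, {linear V n.+1 -> V n}) (dW : forall n, {linear W n.+1 -> W n}).
Variable f : forall n, V n -> W n.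
Arguments f {n}.
Hypothesis f_lin : forall n, linear (@f n).
Hypothesis f_chain : forall n x, dW n (f x) = f (dV n x).

Lemma bdry_chain n x : bdry dW n (f x) = f (bdry dV n x).
Proof. by case: n x => [|n] x; [rewrite (linear_0 (@f_lin _)) | exact: f_chain]. Qed.

Lemma chain_cycle n (z : cycles dV n) : bdry dW n (f (kval z)) = 0.
Proof. by rewrite bdry_chain cycleP (linear_0 (@f_lin _)). Qed.

Definition cycle_map n (z : cycles dV n) : homology dW n := hproj (mkcycle (chain_cycle z)).
Lemma cycle_map_linear n : linear (@cycle_map n).
Proof.
move=> a x y; rewrite /cycle_map -(@hproj_linear _ _ dW); congr hproj; apply: val_inj.
exact: (@f_lin n).
Qed.
HB.instance Definition _ n := GRing.isLinear.Build k (cycles dV n) (homology dW n) *:%R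
  (@cycle_map n) (@cycle_map_linear n).

Definition hmap n : homology dV n -> homology dW n := qlift (@cycle_map n).

Lemma cycle_map_bdry n (z : cycles dV n) : (exists y, dV n y = kval z) -> cycle_map z = 0.
Proof.
case=> y e; rewrite -(linear_0 (@hproj_linear _ _ dW n)).
by apply: (@hproj_eq _ _ _ _ _ _ (f y)); rewrite /= subr0 f_chain e.
Qed.

Lemma hmap_linear n : linear (@hmap n).
Proof. exact: (qlift_linear (@cycle_map_bdry n)). Qed.

Lemma hmap_hproj n (z : cycles dV n) : hmap (hproj z) = hproj (mkcycle (chain_cycle z)).
Proof. exact: (qlift_pi (@cycle_map_bdry n)). Qed.

Lemma hclass_cycle n (z : cycles dV n) : hclass dV (kval z) = hproj z.
Proof.
rewrite /hclass /hproj; congr (qpi _ _); apply: val_inj.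
by rewrite val_insubd; case: ifP => // /negbT; rewrite kvalP.
Qed.
End HomologyMap.

Section HomotopyEquivalence.
Variables (k : comNzRingType) (V W : nat -> lmodType k).
Variables (dV : forall n, {linear V n.+1 -> V n}) (dW : forall n, {linear W n.+1 -> W n}).
Variables (f : forall n, V n -> W n) (g : forall n, W n -> V n).
Arguments f {n}.
Arguments g {n}.
Hypotheses (f_lin : forall n, linear (@f n)) (g_lin : forall n, linear (@g n)).
Hypothesis f_chain : forall n x, dW n (f x) = f (dV n x).
Hypothesis g_chain : forall n x, dV n (g x) = g (dW n x).
Hypothesis gf_htpy : forall n (z : V n), bdry dV n z = 0 -> exists y, g (f z) - z = dV n y.

Lemma hmapK n (h : homology dV n) : hmap g_lin g_chain (hmap f_lin f_chain h) = h.
Proof.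
have [z <-] := hproj_surj h; rewrite !hmap_hproj.
by have [y e] := gf_htpy (cycleP z); apply: (@hproj_eq _ _ _ _ _ _ y).
Qed.
End HomotopyEquivalence.

Section KTens.
Variables (k : comNzRingType) (B : algType k) (D : bialgebra B).
Local Notation eps := (counit D).

Definition kt (P : lmodType B) (x : restr P) : ktens D P := qpi _ ((1 : k^o) \tens x).

Lemma kt_linear (P : lmodType B) : linear (@kt P).
Proof. exact: (linear_comp (@pure_linr _ _ _ _) (@qpi_linear _ _ _)). Qed.

Lemma kt_scale (P : lmodType B) b (x : P) : kt (b *: x : restr P) = (eps b : k) *: kt (x : restr P).
Proof.
rewrite /kt -(linear_Z (@qpi_linear _ _ _)); apply/esym/qpiP/qspan_gen; exists 1, b, x.
by rewrite -(linear_Z (@pure_linl _ _ _ (x : restr P))) mul1r; congr (_ \tens _ - _); exact: mulr1.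
Qed.

Lemma ktens_ext (P : lmodType B) (M : lmodType k) (f g : ktens D P -> M) :
  linear f -> linear g -> (forall x, f (kt x) = g (kt x)) -> forall t, f t = g t.
Proof.
move=> hf hg h t; rewrite -(qrepr t); move: (repr t).
apply: tensor_ext => [||c x].
- exact: (linear_comp (@qpi_linear _ _ _) hf).
- exact: (linear_comp (@qpi_linear _ _ _) hg).
have -> : c \tens x = (c : k) *: ((1 : k^o) \tens x).
  by rewrite -(linear_Z (@pure_linl _ _ _ x)); congr (_ \tens _); exact/esym/mulr1.
by rewrite (linear_Z (@qpi_linear _ _ _)) (linear_Z hf) (linear_Z hg) h.
Qed.

Lemma ktens_map_kt (P Q : lmodType B) (f : {linear P -> Q}) x :
  @ktens_map k B D P Q f (kt (x : restr P)) = kt (f x : restr Q).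
Proof.
have tl : linear (tmap (id : k^o -> k^o) (f : restr P -> restr Q)).
  exact: (tmap_linear (@linear_id _ _) (linear_restr f)).
have Fl := linear_comp tl (@qpi_linear k _ (@ktens_rel k B D Q)).
pose F : {linear k^o \ox restr P -> ktens D Q} := HB.pack (fun t : k^o \ox restr P => qpi (@ktens_rel k B D Q) (tmap (id : k^o -> k^o) (f : restr P -> restr Q) t)) (GRing.isLinear.Build _ _ _ _ _ Fl).
have F0 t : @ktens_rel k B D P t -> F t = 0.
  case=> c [b [y ->]]; rewrite linearB /=; apply/eqP; rewrite subr_eq0; apply/eqP.
  rewrite !tmap_pure; [|exact: linear_id|exact: linear_restr|exact: linear_id|exact: linear_restr].
  by apply/qpiP/qspan_gen; exists c, b, (f y); rewrite linearZ.
rewrite [LHS](qlift_pi F0) /= tmap_pure //; exact: linear_restr.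
Qed.

Section Lift.
Variables (P : lmodType B) (M : lmodType k) (u : restr P -> M).
Hypothesis (ul : linear u) (us : forall b (x : P), u (b *: x) = (eps b : k) *: u x).

Lemma ktens_lift_bilinear : bilinear_fun (fun (c : k^o) x => (c : k) *: u x).
Proof.
split=> [x a c c'|c]; first by rewrite scalerDl scalerA.
exact: (linear_comp ul (@scale_lin _ _ _)).
Qed.

Definition ktens_lift_fun : {linear k^o \ox restr P -> M} :=
  HB.pack (tlift (fun (c : k^o) x => (c : k) *: u x))
    (GRing.isLinear.Build _ _ _ _ _ (tlift_linear ktens_lift_bilinear)).

Lemma ktens_lift_rel t : @ktens_rel k B D P t -> ktens_lift_fun t = 0.
Proof.
case=> c [b [y ->]]; rewrite linearB /= !tlift_pure; try exact: ktens_lift_bilinear.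
by rewrite us scalerA subrr.
Qed.

Definition ktens_lift : ktens D P -> M := qlift ktens_lift_fun.
Lemma ktens_lift_linear : linear ktens_lift.
Proof. exact: (qlift_linear ktens_lift_rel). Qed.
Lemma ktens_lift_kt x : ktens_lift (kt x) = u x.
Proof.
rewrite [LHS](qlift_pi ktens_lift_rel) /= tlift_pure ?scale1r //.
exact: ktens_lift_bilinear.
Qed.
End Lift.
End KTens.

Section TorIso.
Variables (k : comNzRingType) (B : algType k) (D : bialgebra B).
Local Notation eps := (counit D).
Local Notation tpow := (tpow B).
Local Notation ext := (@ext k B).
Hypothesis hB : projective (B : lmodType k).
Variable R : resolution D.
Local Notation X := (bar_resolution D hB).
Local Notation d := (bar_diff D).

Variables (G : forall n, {linear res_mod X n -> res_mod R n}) (F : forall n, {linear res_mod R n -> res_mod X n}).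
Hypotheses (Gm : res_map G) (Fm : res_map F).

Definition ins n (t : tpow n) : ext (tpow n) := (1 : B) \tens t.
Definition del n (x : ext (tpow n)) : tpow n := face D 0 (x : tpow n.+1).

Lemma del_linear n : linear (@del n : tpow n.+1 -> tpow n).
Proof. exact: face_linear. Qed.
Lemma ins_linear n : linear (@ins n : tpow n -> tpow n.+1).
Proof. exact: pure_linr. Qed.
Lemma del_ins n (t : tpow n) : del (ins t) = t.
Proof. by rewrite /del /ins face0_pure counit1 scale1r. Qed.

Lemma del_scale n b (x : ext (tpow n)) : del (b *: x) = (eps b : k) *: del x.
Proof.
move: x; apply: (tensor_ext (f := fun x => del (ext_scale b x)) (g := fun x => (eps b : k) *: del x)) => [||a t].
- exact: (linear_comp (@ext_scale_linear _ _ _ b) (@del_linear n)).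
- exact: (linear_comp (@del_linear n) (@scale_lin _ _ _)).
by rewrite ext_scale_pure /del !face0_pure counitM scalerA.
Qed.

Lemma factor_del n (M : lmodType k) (u : tpow n.+1 -> M) : linear u ->
  (forall b (x : ext (tpow n)), u (b *: x) = (eps b : k) *: u x) ->
  forall x, u x = u (ins (del x)).
Proof.
move=> ul us; apply: tensor_ext => [||b t] //.
  exact: (linear_comp (linear_comp (@del_linear n) (@ins_linear n)) ul).
have -> : b \tens t = b *: (ins t : ext (tpow n)) by rewrite -ext_pureE.
by rewrite us del_scale del_ins (linear_Z (@ins_linear n)) (linear_Z ul).
Qed.

Definition to_tor n (t : tpow n) : ktens D (res_mod R n) := kt D (G n (ins t) : restr (res_mod R n)).

Lemma G_linear n : linear (G n : tpow n.+1 -> restr (res_mod R n)).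
Proof. exact: linear_from_ext. Qed.
Lemma G_ins_linear n : linear (fun t : tpow n => G n (ins t) : restr (res_mod R n)).
Proof. exact: (linear_comp (@ins_linear n) (@G_linear n)). Qed.

Lemma to_tor_linear n : linear (@to_tor n).
Proof. exact: (linear_comp (@G_ins_linear n) (@kt_linear _ _ _ _)). Qed.

Lemma kt_G n (x : ext (tpow n)) : kt D (G n x : restr (res_mod R n)) = to_tor (del x).
Proof.
apply: (factor_del (u := fun x => kt D (G n x : restr (res_mod R n)))).
  exact: (linear_comp (@G_linear n) (@kt_linear _ _ _ _)).
by move=> b y; rewrite linearZ kt_scale.
Qed.

Lemma to_tor_chain n (t : tpow n.+1) : tor_diff R n (to_tor t) = to_tor (d n t).
Proof.
rewrite [LHS]ktens_map_kt; have [_ ->] := Gm.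
rewrite [res_diff X n _]rbar_1 kt_G (linear_B _ _ (@del_linear n)) del_ins.
by rewrite bar_diffE.
Qed.

Lemma F_linear n : linear (F n : restr (res_mod R n) -> tpow n.+1).
Proof. exact: linear_to_ext. Qed.

Lemma del_F_linear n : linear (fun x : restr (res_mod R n) => del (F n x) : tpow n).
Proof. exact: (linear_comp (@F_linear n) (@del_linear n)). Qed.
Lemma del_F_scale n b (x : res_mod R n) : del (F n (b *: x)) = (eps b : k) *: del (F n x).
Proof. by rewrite linearZ del_scale. Qed.

Definition of_tor n : ktens D (res_mod R n) -> tpow n := ktens_lift (@del_F_linear n).

Lemma of_tor_linear n : linear (@of_tor n).
Proof. exact: (ktens_lift_linear (@del_F_linear n) (@del_F_scale n)). Qed.
Lemma of_tor_kt n x : of_tor (kt D (x : restr (res_mod R n))) = del (F n x).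
Proof. exact: (ktens_lift_kt (@del_F_linear n) (@del_F_scale n)). Qed.

Lemma of_tor_chain n x : d n (of_tor x) = of_tor (tor_diff R n x).
Proof.
move: x; apply: ktens_ext => [||x].
- exact: (linear_comp (@of_tor_linear n.+1) (linear_fun (d n))).
- exact: (linear_comp (linear_fun (tor_diff R n)) (@of_tor_linear n)).
rewrite [tor_diff R n _]ktens_map_kt !of_tor_kt; have [_ <-] := Fm.
exact/esym/face0_rbar.
Qed.

Lemma of_to_tor n (z : tpow n) : bdry d n z = 0 -> exists y, of_tor (to_tor z) - z = d n y.
Proof.
have FG : res_map (fun n => F n \o G n : {linear res_mod X n -> res_mod X n}).
  by case: Gm => g0 gS; case: Fm => f0 fS; split=> [x|m x]; [exact: etrans (f0 _) (g0 _) | exact: etrans (fS _ _) (congr1 _ (gS _ _))].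
have FI : @res_map _ _ _ X X (fun n => idfun) by split.
have [h [h0 hS]] := res_htpy FG FI.
move=> hz; exists (del (h n (ins z))); rewrite /to_tor of_tor_kt.
rewrite -{2}(del_ins z) -(linear_B _ _ (@del_linear n)) -face0_rbar.
case: n z hz => [|n] z hz; first by rewrite [X in del X]h0.
rewrite [X in del X]hS (linear_D _ _ (@del_linear n.+1)) -[RHS]addr0; congr (_ + _).
rewrite [res_diff X n _]rbar_1.
pose u (x : tpow n.+1) := del (h n x).
have ul : linear u.
  move=> a x y; have e : (eps (a%:A) : k) = a by rewrite linearZ /= counit1; exact: mulr1.
  by rewrite /u -[a *: x]ext_restr linearP /= (linear_D _ _ (@del_linear n.+1)) del_scale e.
rewrite -[LHS]/(u _) (factor_del ul); last by move=> b x; rewrite /u linearZ del_scale.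
by rewrite (linear_B _ _ (@del_linear n)) del_ins -bar_diffE [d n z]hz (linear_0 (@ins_linear n)) (linear_0 ul).
Qed.

Lemma to_of_tor n (x : ktens D (res_mod R n)) : bdry (tor_diff R) n x = 0 ->
  exists y, to_tor (of_tor x) - x = tor_diff R n y.
Proof.
have GF : res_map (fun n => G n \o F n : {linear res_mod R n -> res_mod R n}).
  by case: Gm => g0 gS; case: Fm => f0 fS; split=> [y|m y]; [exact: etrans (g0 _) (f0 _) | exact: etrans (gS _ _) (congr1 _ (fS _ _))].
have FI : @res_map _ _ _ R R (fun n => idfun) by split.
have [h [h0 hS]] := res_htpy GF FI.
move=> hx; exists (@ktens_map k B D _ _ (h n) x).
have hk n' := linear_fun (@ktens_map k B D _ _ (h n')).
have l1 m := linear_sub (linear_comp (@of_tor_linear m) (@to_tor_linear m)) (@linear_id _ _).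
have l2 m := linear_comp (hk m) (linear_fun (tor_diff R m)).
case: n x hx => [|n] x hx.
  move: x {hx}; apply: ktens_ext => [||x]; [exact: l1 | exact: l2 |].
  rewrite of_tor_kt -kt_G ktens_map_kt [tor_diff R _ _]ktens_map_kt -(linear_B _ _ (@kt_linear _ _ _ _)).
  exact: (congr1 (@kt k B D _) (h0 x)).
transitivity (tor_diff R n.+1 (@ktens_map k B D _ _ (h n.+1) x) + @ktens_map k B D _ _ (h n) (tor_diff R n x)).
  move: x {hx}; apply: ktens_ext => [||x]; first exact: l1.
    exact: linear_add (l2 n.+1) (linear_comp (linear_fun (tor_diff R n)) (hk n)).
  rewrite of_tor_kt -kt_G ktens_map_kt [tor_diff R n _]ktens_map_kt ktens_map_kt.
  rewrite [tor_diff R _ _]ktens_map_kt -(linear_B _ _ (@kt_linear _ _ _ _)).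
  rewrite -(linear_D _ _ (@kt_linear _ _ _ _)); exact: (congr1 (@kt k B D _) (hS n x)).
by rewrite [tor_diff R n x]hx linear0 addr0.
Qed.

Lemma to_tor_iso : is_tor_iso (hmap to_tor_linear to_tor_chain).
Proof.
pose g n : {linear tpow n -> restr (res_mod R n)} :=
  HB.pack (fun t : tpow n => G n (ins t) : restr (res_mod R n)) (GRing.isLinear.Build _ _ _ _ _ (@G_ins_linear n)).
exists g => [|n].
  split; first by have [-> _] := Gm; exact: rbar_aug1.
  move=> n x; have [_ e] := Gm.
  rewrite [LHS]e [res_diff X n _]rbar_1 [LHS](linear_B _ _ (@G_linear n)); congr (_ + _).
    move: x; apply: tensor_ext => [||b t]; first exact: G_linear.
      exact: (tlift_linear (ext_lift_bilinear (@G_ins_linear n))).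
    rewrite [RHS](ext_lift_pure (@G_ins_linear n)) ext_pureE.
    exact: linearZ.
  rewrite -[LHS]/(- (g n (rbar D x))) /rbar (linear_bigsum (linear_fun (g n))) -sumrN.
  by apply: eq_bigr => i _; rewrite (linear_Z (linear_fun (g n))) exprS mulN1r scaleNr.
split.
- exact: hmap_linear.
- exists (hmap of_tor_linear of_tor_chain (n := n)).
    exact: (hmapK to_tor_linear of_tor_linear to_tor_chain of_tor_chain of_to_tor).
  exact: (hmapK of_tor_linear to_tor_linear of_tor_chain to_tor_chain to_of_tor).
move=> z; rewrite hmap_hproj -hclass_cycle; congr hclass.
Qed.
End TorIso.

Lemma tor_iso_exists (k : comNzRingType) (B : algType k) (D : bialgebra B) :
  projective (B : lmodType k) -> forall R : resolution D,
  exists phi : forall n, bar_homology D n -> Tor R n, is_tor_iso phi.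
Proof.
move=> hB R; have [G Gm] := res_lift (bar_resolution D hB) R.
have [F Fm] := res_lift R (bar_resolution D hB).
by exists (hmap (to_tor_linear G) (to_tor_chain Gm)); exact: to_tor_iso Fm.
Qed.

Theorem proposition5p7 (k : comNzRingType) (B : algType k) (D : bialgebra B) :
  (* On the complex, and in the homology of its tensor powers. *)
  is_gerstenhaber_coalgebra_up_to_boundaries (bar_diff D) (bar_cup D) (bar_br D)
  /\
  (* On homology, under the Kuenneth hypothesis. *)
  (split_complex (bar_diff D) ->
   exists (cup br : coop (bar_homology D)) (eps : bar_homology D 0 -> k^o),
     [/\ induces 0 (bar_cup D) cup,
         induces 1 (bar_br D) br,
         forall z : cycles (bar_diff D) 0, eps (hproj z) = kval z,
         forall cup' br' : coop (bar_homology D),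
           induces 0 (bar_cup D) cup' -> induces 1 (bar_br D) br' ->
           forall n p q x, cup' n p q x = cup n p q x /\ br' n p q x = br n p q x
       & is_gerstenhaber_coalgebra cup br /\ is_counit cup eps /\
         (* On Tor. *)
         (projective B ->
          forall R : resolution D,
          exists phi : forall n, bar_homology D n -> Tor R n,
            is_tor_iso phi /\
            exists (cupT brT : coop (Tor R)) (epsT : Tor R 0 -> k^o),
              [/\ forall n p q x,
                    cupT n p q (phi n x) = tmap (phi p) (phi q) (cup n p q x),
                  forall n p q x,
                    brT n p q (phi n x) = tmap (phi p) (phi q) (br n p q x),
                  forall x, epsT (phi 0%N x) = eps x,
                  is_gerstenhaber_coalgebra cupT brT
                & is_counit cupT epsT])])
  /\
  (* The Tor groups are the homology groups, without Kuenneth hypothesis. *)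
  (projective B -> forall R : resolution D,
     exists phi : forall n, bar_homology D n -> Tor R n, is_tor_iso phi)
  /\
  (* The Kuenneth hypothesis holds over a field, and for projective modules. *)
  (is_field k -> split_complex (bar_diff D))
  /\
  (projective B -> (forall n, projective (bar_homology D n)) ->
     split_complex (bar_diff D)).
Proof.
split; first exact: bar_gerstenhaber_up_to_boundaries.
split; last first.
  split; first exact: tor_iso_exists.
  by split; [exact: bar_split_field | exact: bar_split_projective].
case/bar_homology_gerstenhaber => [cup [br [eps [i1 i2 e u [g c]]]]].
exists cup, br, eps; split=> //; split=> //; split=> // hB R.
have [phi phi_iso] := tor_iso_exists hB R; exists phi; split=> //.
have [g0 _ phiE] := phi_iso.
have phi_lin n : linear (phi n) by have [h _ _] := phiE n.
have phi_inv n : exists psi, cancel (phi n) psi /\ cancel psi (phi n).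
  by have [_ [psi h1 h2] _] := phiE n; exists psi.
pose psi n := projT1 (cid (phi_inv n)).
have phiK n : cancel (phi n) (psi n) := (projT2 (cid (phi_inv n))).1.
have psiK n : cancel (psi n) (phi n) := (projT2 (cid (phi_inv n))).2.
exists (transport phi psi cup), (transport phi psi br), (fun x => eps (psi 0%N x)); split.
- by move=> n p q x; exact: transportE.
- by move=> n p q x; exact: transportE.
- by move=> x; rewrite phiK.
- exact: transport_gerstenhaber.
- exact: transport_counit.
Qed.
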